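(* Let $c>0$ and, for $\alpha>-\frac12$, let $(\lambda_{n,\alpha}(c))_{n\ge 0}$ be the sequence of eigenvalues, arranged in decreasing order, of the operator $\mathcal Q_c^{\alpha}=c\,\mathcal H_c^{\alpha}\mathcal H_c^{\alpha}$ on $L^2(0,1)$. Then for every integer $n\ge 0$, $$\lambda_{n,\alpha}(c)\le \lambda_{n,\alpha'}(c)\qquad\text{for all } \alpha\ge\alpha'>-\tfrac12 .$$
   Context: $J_\alpha$ denotes the Bessel function of the first kind of order $\alpha$. For real numbers $c>0$, $\alpha>-\frac12$, the finite Hankel transform operator $\mathcal H_c^{\alpha}$ is the compact self-adjoint operator on $L^2(0,1)$ given by $\mathcal H_c^{\alpha}(f)(x)=\int_0^1\sqrt{cxt}\,J_\alpha(cxt)f(t)\,dt$, $x\in[0,1]$. The operator $\mathcal Q_c^{\alpha}=c\,\mathcal H_c^{\alpha}\mathcal H_c^{\alpha}$ is compact, positive and self-adjoint; if $(\mu_{n,\alpha}(c))_{n\ge0}$ are the eigenvalues of $\mathcal H_c^\alpha$ arranged in decreasing order of magnitude, then $\lambda_{n,\alpha}(c)=c\,|\mu_{n,\alpha}(c)|^2$. *)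

(* Defs.v *)
From HB Require Import structures.
From mathcomp Require Import all_boot all_order all_algebra.
From mathcomp Require Import all_classical all_reals all_analysis.

Set Implicit Arguments.
Unset Strict Implicit.
Unset Printing Implicit Defensive.

Import Order.TTheory GRing.Theory Num.Theory.
Import numFieldNormedType.Exports.

Local Open Scope classical_set_scope.
Local Open Scope ring_scope.

Section Bessel.
Context {R : realType}.
Implicit Types a x : R.

(* Euler's integral; it represents the Gamma function only for 0 < a. *)
Definition euler_gamma a : R :=
  \int[lebesgue_measure]_(t in `]0, +oo[) (t `^ (a - 1) * expR (- t)).

(* Meant for -1 < a, so that every Gamma factor has a positive argument, and
   for 0 <= x.  If a < 0, where the series diverges at the origin, the
   convention 0 `^ a = 0 gives besselJ a 0 = 0. *)
Definition besselJ a x : R :=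
  limn (series (fun m : nat =>
    (-1) ^+ m / (m`!%:R * euler_gamma (m%:R + a + 1))
      * (x / 2) `^ (2 * m%:R + a))).

End Bessel.

Section L2_01.
Context {R : realType}.

(* Lebesgue measure of the part of a set lying in ]0, 1[, so that L^2(0,1) is
   the L^2 space of this measure on R. *)
Definition leb01 : {measure set measurableTypeR R -> \bar R} :=
  mrestr (@lebesgue_measure R) (measurable_itv `]0%R, 1%R[).

Definition L2_01 : set (R -> R) := [set f | f \in Lfun leb01 2%:E].

Definition ae_lin_indep k (f : 'I_k -> R -> R) : Prop :=
  forall a : 'I_k -> R,
    (fun x => \sum_(i < k) a i * f i x) = (fun=> 0) %[ae leb01] ->
    forall i, a i = 0.

(* The operator A acts on representatives of classes in L^2(0,1). *)
Definition eigenspace01 (A : (R -> R) -> R -> R) (mu : R) : set (R -> R) :=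
  [set f | L2_01 f /\ A f = (fun x => mu * f x) %[ae leb01]].

(* lam lists the eigenvalues of A in decreasing order, each repeated according
   to its multiplicity: the eigenspace of mu contains k linearly independent
   functions exactly when mu occurs at k distinct places in lam.  With k = 1,
   this says that the values of lam are exactly the eigenvalues of A. *)
Definition decreasing_eigenvalues (A : (R -> R) -> R -> R) (lam : nat -> R)
    : Prop :=
  nonincreasing_seq lam /\
  forall (mu : R) (k : nat),
    (exists f : 'I_k -> R -> R,
        (forall i, eigenspace01 A mu (f i)) /\ ae_lin_indep f) <->
    (exists p : 'I_k -> nat, injective p /\ forall i, lam (p i) = mu).

End L2_01.

Section Hankel.
Context {R : realType}.
Implicit Types c alpha : R.

Definition hankel c alpha (f : R -> R) (x : R) : R :=
  \int[leb01]_t (Num.sqrt (c * x * t) * besselJ alpha (c * x * t) * f t).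

Definition hankelQ c alpha (f : R -> R) (x : R) : R :=
  c * hankel c alpha (hankel c alpha f) x.

End Hankel.

(* Main.v *)
(* Let F_nu be the Hankel transform on ]0, +oo[, for which c * |F_nu f|^2 = |f|^2.
   By Sonine's formula, if f t = t^(nu + 1/2) phi(t^2) and d = nu - nu' > 0,
   then F_nu f x = (c x / 2)^d F_nu' g x, where g t = t^(nu' + 1/2) psi(t^2) and
   psi is the Weyl fractional integral of phi of order d, which vanishes beyond
   1 when phi does.  Since x^d <= 1 exactly on ]0, 1[, passing from f to g raises
   the proportion of the energy of the transform that lies in ]0, 1[, which is
   the Rayleigh quotient c |H f|^2 / |f|^2 of the finite transform.  Apply this
   to the span of the first n + 1 eigenfunctions for nu (those with a positive
   eigenvalue have the required form, with phi a power series cut off at 1), and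
   conclude by the min-max principle for nu'. *)

Require Import Defs.
From mathcomp Require Import all_boot all_order all_algebra.
From mathcomp Require Import all_classical all_reals all_analysis.
From mathcomp Require Import measurable_realfun ring lra.

Set Implicit Arguments.
Unset Strict Implicit.
Unset Printing Implicit Defensive.

Import Order.TTheory GRing.Theory Num.Theory.
Import numFieldNormedType.Exports.

Local Open Scope classical_set_scope.
Local Open Scope ring_scope.

(** Plancherel and Sonine are both reduced to the functions t^(nu + 1/2) exp (- p t^2), whose
    transform is of the same kind with p replaced by (c/2)^2 / p. On finite combinations with p = 1,
    2, 3, ... both statements are identities between finite sums, so the behaviour of Bessel
    functions at infinity never enters. The variable s = exp (- t^2) turns these combinations into
    polynomials, and Bernstein approximation then reaches the functions cut off at 1, pointwise and
    under a Gaussian majorant. On ]0, 1[ the kernel is an absolutely convergent sum of products of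
    one function of x and the same function of t, whence the symmetry and compactness of the finite
    transform. The list of eigenvalues is known only through multiplicities. Min-max therefore takes
    this form: n + 1 functions all of whose nontrivial combinations have Rayleigh quotient at least
    lam > 0 yield n + 1 orthogonal eigenfunctions with eigenvalues at least lam, which are then
    counted against the list. *)

Lemma eq_cvgr {T : Type} {U : topologicalType} (F : set_system T) (f g : T -> U) (l : U) :
  Filter F -> f =1 g -> f x @[x --> F] --> l -> g x @[x --> F] --> l.
Proof. by move=> FF /funext ->. Qed.

Lemma exists_left_kernel (F : fieldType) m k (M : 'M[F]_(k, m)) : (m < k)%N ->
  exists2 v : 'rV[F]_k, v != 0 & v *m M = 0.
Proof.
move=> mk.
have : kermx M != 0.
  rewrite kermx_eq0 /row_free; apply/eqP => e.
  by have := rank_leq_col M; rewrite e leqNgt mk.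
by move=> /rowV0Pn[v /sub_kermxP v0 vn0]; exists v.
Qed.

(** * Eigenvectors of compact symmetric operators *)

Section CompactOperator.
Context {R : realType} {V : lmodType R}.
(** Vectors will be functions, not classes modulo null sets: [D] selects the square-integrable ones,
    and [ip] is only semidefinite. Equations between vectors are therefore tested by [ip] against
    every vector of [D]. *)
Variables (D : V -> Prop) (ip : V -> V -> R) (H : V -> V) (M : R).
Hypothesis DD : forall u v, D u -> D v -> D (u + v).
Hypothesis DZ : forall a u, D u -> D (a *: u).
Hypothesis ipC : forall u v, ip u v = ip v u.
Hypothesis ipDl : forall u v w, D u -> D v -> D w ->
  ip (u + v) w = ip u w + ip v w.
Hypothesis ipZl : forall a u w, D u -> D w -> ip (a *: u) w = a * ip u w.
Hypothesis ip_ge0 : forall u, 0 <= ip u u.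
Hypothesis HD : forall u, D u -> D (H u).
Hypothesis Hsym : forall u v, D u -> D v -> ip (H u) v = ip u (H v).
Hypothesis M0 : 0 <= M.
Hypothesis Hbnd : forall u, D u -> ip (H u) (H u) <= M * ip u u.
Hypothesis Hcpt : forall g : nat -> V,
  (forall k, D (g k) /\ ip (g k) (g k) <= 1) ->
  exists (s : nat -> nat) (h : V), [/\ forall j, (j <= s j)%N, D h &
    ip (H (g (s j)) - h) (H (g (s j)) - h) @[j --> \oo] --> (0 : R)].

Lemma ipDr u v w : D u -> D v -> D w -> ip w (u + v) = ip w u + ip w v.
Proof. by move=> *; rewrite ipC ipDl// !(ipC w). Qed.

Lemma ipZr a u w : D u -> D w -> ip w (a *: u) = a * ip w u.
Proof. by move=> *; rewrite ipC ipZl// (ipC w). Qed.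

Lemma DN u : D u -> D (- u).
Proof. by rewrite -scaleN1r; exact: DZ. Qed.

Lemma DB u v : D u -> D v -> D (u - v).
Proof. by move=> Du /DN; exact: DD. Qed.

Lemma ipNl u w : D u -> D w -> ip (- u) w = - ip u w.
Proof. by move=> ? ?; rewrite -scaleN1r ipZl// mulN1r. Qed.

Lemma ipNr u w : D u -> D w -> ip w (- u) = - ip w u.
Proof. by move=> ? ?; rewrite ipC ipNl// ipC. Qed.

Lemma ipBl u v w : D u -> D v -> D w -> ip (u - v) w = ip u w - ip v w.
Proof. by move=> Du Dv Dw; rewrite ipDl ?ipNl//; exact: DN. Qed.

Lemma ipBr u v w : D u -> D v -> D w -> ip w (u - v) = ip w u - ip w v.
Proof. by move=> Du Dv Dw; rewrite ipDr ?ipNr//; exact: DN. Qed.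

Lemma ipBZ u v t : D u -> D v ->
  ip (u - t *: v) (u - t *: v) = ip u u - 2 * t * ip u v + t ^+ 2 * ip v v.
Proof.
move=> Du Dv; have Dtv := DZ t Dv; have Duv := DB Du Dtv.
rewrite ipBl// !ipBr// !ipZl// !ipZr// (ipC v u); ring.
Qed.

Lemma ip_CauchySchwarz u v : D u -> D v -> ip u v ^+ 2 <= ip u u * ip v v.
Proof.
move=> Du Dv.
have key t : 0 <= ip u u - 2 * t * ip u v + t ^+ 2 * ip v v.
  by rewrite -ipBZ.
have := ip_ge0 v; rewrite le_eqVlt => /orP[/eqP v0|v0]; last first.
  have := key (ip u v / ip v v).
  rewrite (_ : _ + _ = (ip u u * ip v v - ip u v ^+ 2) / ip v v); last first.
    by field; rewrite gt_eqF.
  by rewrite pmulr_lge0 ?invr_gt0// subr_ge0.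
rewrite -v0 mulr0.
suff -> : ip u v = 0 by rewrite expr0n.
apply/eqP/negP => /negP uv0.
(* With [ip v v = 0] the quadratic is affine in t, and this t gives it the value -1. *)
have := key ((ip u u + 1) / (2 * ip u v)).
rewrite -v0 mulr0 addr0 (_ : _ - _ = - 1); last by field.
by rewrite oppr_ge0 ler10.
Qed.

Lemma ip0 u w : D u -> D w -> ip u u = 0 -> ip u w = 0.
Proof.
move=> Du Dw u0; have := ip_CauchySchwarz Du Dw; rewrite u0 mul0r => h.
by apply/eqP; rewrite -sqrf_eq0 eq_le h sqr_ge0.
Qed.

(** Symmetry stands in for linearity of [H]: the vectors [H u - H v] and [H (u - v)] have the same
    product with every vector of [D]. *)
Lemma ip_HB u v : D u -> D v ->
  ip (H u - H v) (H u - H v) = ip (H (u - v)) (H (u - v)).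
Proof.
move=> Du Dv; have Duv := DB Du Dv.
have e w : D w -> ip (H u - H v) w = ip (H (u - v)) w.
  move=> Dw; rewrite (ipBl (HD Du) (HD Dv) Dw) (Hsym Du Dw) (Hsym Dv Dw) (Hsym Duv Dw).
  by rewrite (ipBl Du Dv (HD Dw)).
rewrite e; last by apply: DB; exact: HD.
by rewrite ipC e//; exact: HD.
Qed.

Lemma HH_sym u v : D u -> D v -> ip (H (H u)) v = ip u (H (H v)).
Proof.
by move=> Du Dv; rewrite (Hsym (HD Du) Dv) (Hsym Du (HD Dv)).
Qed.

Lemma ip_quasi_triangle u v w : D u -> D v -> D w ->
  ip (u - w) (u - w) <= 2 * ip (u - v) (u - v) + 2 * ip (v - w) (v - w).
Proof.
move=> Du Dv Dw; have Duv := DB Du Dv; have Dvw := DB Dv Dw.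
have := ip_ge0 ((u - v) - (v - w)).
have -> : u - w = (u - v) + (v - w) by rewrite addrA subrK.
move: (u - v) (v - w) Duv Dvw => a b Da Db.
have Dab := DD Da Db; have DaB := DB Da Db.
rewrite (ipBl Da Db DaB) (ipBr Da Db Da) (ipBr Da Db Db).
rewrite (ipDl Da Db Dab) (ipDr Da Db Da) (ipDr Da Db Db).
rewrite (ipC b a); lra.
Qed.

Lemma ip_cvg (g : nat -> V) u w : D u -> D w -> (forall j, D (g j)) ->
  ip (g j - u) (g j - u) @[j --> \oo] --> (0 : R) ->
  ip (g j) w @[j --> \oo] --> ip u w.
Proof.
move=> Du Dw Dg gu.
rewrite -subr_cvg0.
have h : (ip (g j) w - ip u w) ^+ 2 @[j --> \oo] --> (0 : R).
  apply: (squeeze_cvgr (f := fun=> 0) (h := (fun j => ip (g j - u) (g j - u) * ip w w))).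
  - near=> j; rewrite sqr_ge0/= -ipBl//.
    by apply: ip_CauchySchwarz => //; exact: DB.
  - exact: cvg_cst.
  - by rewrite -[X in _ --> X](mul0r (ip w w)); apply: cvgMl.
have := @cvg_comp _ _ _ _ _ _ _ _ h (@sqrt_continuous R 0).
rewrite sqrtr0 /comp => h'.
apply/norm_cvg0P; rewrite (_ : (fun _ => _) = (fun j => Num.sqrt ((ip (g j) w - ip u w) ^+ 2)))//.
by apply/funext => j; rewrite sqrtr_sqr.
Unshelve. all: by end_near. Qed.

(* A maximizing sequence g_k for ip (H g) (H g) on the unit ball of the orthogonal
   complement of the e_i satisfies H (H g_k) - s g_k -> 0, s being the supremum;
   compactness of H then makes s g_k converge to an eigenvector. *)
Lemma next_eigenvector (m : nat) (e : nat -> V) (nu : nat -> R) (g : V) (lam : R) :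
  0 < lam ->
  (forall i, (i < m)%N -> D (e i) /\
     forall v, D v -> ip (H (H (e i))) v = nu i * ip (e i) v) ->
  D g -> (forall i, (i < m)%N -> ip g (e i) = 0) ->
  0 < ip g g -> lam * ip g g <= ip (H g) (H g) ->
  exists (u : V) (s : R), [/\ D u, forall i, (i < m)%N -> ip u (e i) = 0,
    0 < ip u u, lam <= s & forall v, D v -> ip (H (H u)) v = s * ip u v].
Proof.
move=> lam0 he Dg ge g0 glam.
pose X u := D u /\ forall i, (i < m)%N -> ip u (e i) = 0.
have XZ a u : X u -> X (a *: u).
  move=> [Du Xu]; split; first exact: DZ.
  by move=> i im; rewrite ipZl ?Xu ?mulr0//; case: (he i im).
have XT u : X u -> X (H (H u)).
  move=> [Du Xu]; split; first by do 2 apply: HD.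
  move=> i im; have [De e1] := he i im.
  by rewrite (HH_sym Du De) ipC (e1 _ Du) ipC (Xu _ im) mulr0.
pose S : set R := [set r | exists u, [/\ X u, ip u u <= 1 & r = ip (H u) (H u)]].
have S_unit u : X u -> 0 < ip u u -> S (ip (H u) (H u) / ip u u).
  move=> Xu u0; have [Du _] := Xu.
  exists ((Num.sqrt (ip u u))^-1 *: u).
  have Hz : ip (H ((Num.sqrt (ip u u))^-1 *: u)) (H ((Num.sqrt (ip u u))^-1 *: u)) =
      (Num.sqrt (ip u u))^-1 ^+ 2 * ip (H u) (H u).
    move: (Num.sqrt _)^-1 => t; have Dtu := DZ t Du.
    rewrite (Hsym Dtu (HD Dtu)) (ipZl t Du (HD (HD Dtu))) ipC (HH_sym Dtu Du).
    by rewrite (ipZl t Du (HD (HD Du))) (Hsym Du (HD Du)) mulrA expr2.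
  split; first exact: XZ.
    rewrite ipZl ?ipZr//; last exact: DZ.
    by rewrite mulrA -expr2 exprVn sqr_sqrtr ?ip_ge0// mulVf// gt_eqF.
  by rewrite Hz exprVn sqr_sqrtr ?ip_ge0// mulrC.
have supS : has_sup S.
  split.
    by exists (ip (H g) (H g) / ip g g); apply: S_unit.
  exists M => _ [u [[Du _] u1 ->]].
  by rewrite (le_trans (Hbnd Du))// ler_piMr.
pose s := sup S.
have lams : lam <= s.
  apply: (@le_trans _ _ (ip (H g) (H g) / ip g g)).
    by rewrite ler_pdivlMr.
  by apply: sup_upper_bound => //; exact: S_unit.
have s0 : 0 < s by exact: lt_le_trans lams.
have Hs u : X u -> ip (H u) (H u) <= s * ip u u.
  move=> Xu; have [Du _] := Xu.
  have := ip_ge0 u; rewrite le_eqVlt => /orP[/eqP u0|u0].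
    by rewrite (le_trans (Hbnd Du))// -u0 !mulr0.
  by rewrite -ler_pdivrMr//; apply: sup_upper_bound => //; exact: S_unit.
(* Write T for H o H. By Cauchy-Schwarz |T u|^4 = <H u, H (T u)>^2 <= |H u|^2 |H (T u)|^2 <= s |u|^2
   * s |T u|^2, and |T u|^2 cancels. *)
have Ts u : X u -> ip (H (H u)) (H (H u)) <= s ^+ 2 * ip u u.
  move=> Xu; have [Du _] := Xu; have XTu := XT _ Xu; have [DTu _] := XTu.
  have h1 := ip_CauchySchwarz (HD Du) (HD DTu).
  rewrite -(Hsym (HD Du) DTu) in h1.
  have h2 := Hs _ Xu; have h3 := Hs _ XTu.
  have t0 := ip_ge0 (H (H u)); have u0 := ip_ge0 u.
  have h4 : ip (H (H u)) (H (H u)) ^+ 2 <=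
      (s * ip u u) * (s * ip (H (H u)) (H (H u))).
    by apply: (le_trans h1); apply: ler_pM => //; exact: ip_ge0.
  move: t0; rewrite le_eqVlt => /orP[/eqP <-|t0].
    by rewrite mulr_ge0// sqr_ge0.
  rewrite -(ler_pM2r t0) -expr2 (le_trans h4)//.
  by rewrite le_eqVlt; apply/orP; left; apply/eqP; ring.
have /choice[gk gkP] : forall k : nat, exists u, [/\ X u, ip u u <= 1 &
    s - k.+1%:R^-1 < ip (H u) (H u)].
  move=> k; have k0 : 0 < k.+1%:R^-1 :> R by rewrite invr_gt0.
  have [_ [u [Xu u1 ->]] h] := sup_adherent k0 supS.
  by exists u.
have Dgk k : D (gk k) by case: (gkP k) => -[].
have [|sg [h [incs Dh hcvg]]] := Hcpt (g := gk).
  by move=> k; case: (gkP k) => -[].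
pose u := H h.
have Du : D u by exact: HD.
have c1 : ip (H (H (gk (sg j))) - u) (H (H (gk (sg j))) - u) @[j --> \oo] --> (0 : R).
  apply: (squeeze_cvgr (f := fun=> 0) (h :=
    (fun j => M * ip (H (gk (sg j)) - h) (H (gk (sg j)) - h)))).
  - near=> j; rewrite ip_ge0/= ip_HB//; last exact: HD.
    by apply: Hbnd; apply: DB => //; exact: HD.
  - exact: cvg_cst.
  - by rewrite -[X in _ --> X](mulr0 M); apply: cvgMr.
have c2 : (sg j).+1%:R^-1 @[j --> \oo] --> (0 : R).
  apply: (squeeze_cvgr (f := fun=> 0) (h := @harmonic R)).
  - near=> j; rewrite invr_ge0 ler0n/= lef_pV2 ?posrE ?ltr0n//.
    by rewrite ler_nat ltnS.
  - exact: cvg_cst.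
  - exact: cvg_harmonic.
(* With k = [sg j], |T g_k - s g_k|^2 = |T g_k|^2 - 2 s |H g_k|^2 + s^2 |g_k|^2 <= 2 s^2 - 2 s (s -
   1/(k+1)) = 2 s / (k+1). *)
have c3 : ip (s *: gk (sg j) - u) (s *: gk (sg j) - u) @[j --> \oo] --> (0 : R).
  apply: (squeeze_cvgr (f := fun=> 0) (h :=
    (fun j => 2 * (2 * s * (sg j).+1%:R^-1) + 2 * ip (H (H (gk (sg j))) - u) (H (H (gk (sg j))) - u)))).
  - near=> j; rewrite ip_ge0/=.
    have [Xg g1 gs] := gkP (sg j).
    have DT : D (H (H (gk (sg j)))) by do 2 apply: HD.
    apply: (le_trans (ip_quasi_triangle (v := H (H (gk (sg j)))) _ _ _)) => //; first exact: DZ.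
    rewrite lerD2r ler_pM2l//.
    rewrite -opprB ipNl ?ipNr ?opprK; [|by apply: DB => //; exact: DZ..|
      by apply: DN; apply: DB => //; exact: DZ].
    rewrite ipBZ//.
    have := Ts _ Xg.
    have := ip_ge0 (gk (sg j)).
    rewrite (Hsym (HD (Dgk (sg j))) (Dgk (sg j))).
    move: gs g1; set q := ip (H _) (H _); set n := ip (gk _) _; set r := _^-1.
    move=> gs g1 n0 tt.
    have : s ^+ 2 * n <= s ^+ 2 by rewrite ler_piMr// sqr_ge0.
    have : s * (s - r) <= s * q by rewrite ler_pM2l// ltW.
    nra.
  - exact: cvg_cst.
  - rewrite [X in _ --> X](_ : _ = 2 * (2 * s * 0) + 2 * 0); last by rewrite !mulr0 addr0.
    by apply: cvgD; apply: cvgMr => //; apply: cvgMr.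
have Xsg j : X (s *: gk (sg j)) by apply: XZ; case: (gkP (sg j)).
have Dsg j : D (s *: gk (sg j)) by case: (Xsg j).
have lim_sg w : D w -> s * ip (gk (sg j)) w @[j --> \oo] --> ip u w.
  move=> Dw; have := ip_cvg Du Dw Dsg c3.
  by under eq_fun do rewrite ipZl//.
exists u, s; split => //.
- move=> i im; have [De _] := he i im.
  have := lim_sg _ De => /cvg_lim <-//.
  apply: cvg_lim => //; under eq_fun.
    by move=> j; case: (gkP (sg j)) => -[_ ->//] _ _; rewrite mulr0 over.
  exact: cvg_cst.
(* A null limit would force s^2 |g_k|^2 -> 0, whereas s (s - 1/(k+1)) <= s |H g_k|^2 <= s^2
   |g_k|^2. *)
- rewrite lt_neqAle ip_ge0 andbT eq_sym; apply/eqP => u0.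
  have c4 : s ^+ 2 * ip (gk (sg j)) (gk (sg j)) @[j --> \oo] --> (0 : R).
    apply: eq_cvgr c3 => j.
    have DB' := DB (Dsg j) Du.
    rewrite (ipBl (Dsg j) Du DB') (ip0 Du DB' u0) subr0 (ipBr (Dsg j) Du (Dsg j)).
    by rewrite (ipC _ u) (ip0 Du (Dsg j) u0) subr0 ipZl ?ipZr// mulrA -expr2.
  have c5 : s * (s - (sg j).+1%:R^-1) @[j --> \oo] --> (s * (s - 0)).
    by apply: cvgMr; apply: cvgB => //; exact: cvg_cst.
  have : s * (s - 0) <= 0.
    apply: ler_cvg_to c5 c4 _; near=> j.
    have [Xg g1 gs] := gkP (sg j).
    have hh := Hs _ Xg.
    by rewrite expr2 -mulrA ler_pM2l// (le_trans _ hh)// ltW.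
  by rewrite subr0 leNgt mulr_gt0.
(* The limit of s <g_k, T v> is found twice: it is s <u, v> because T g_k -> u, and <u, T v> because
   s g_k -> u. *)
- move=> v Dv.
  have c6 : ip (H (H (gk (sg j)))) v @[j --> \oo] --> ip u v.
    by apply: ip_cvg => // j; do 2 apply: HD.
  have c7 : s * ip (gk (sg j)) (H (H v)) @[j --> \oo] --> s * ip u v.
    apply: cvgMr; apply: eq_cvgr c6 => j.
    by rewrite (HH_sym (Dgk _) Dv).
  have c8 := lim_sg _ (HD (HD Dv)).
  rewrite (HH_sym Du Dv).
  exact: cvg_unique c8 c7.
Unshelve. all: by end_near. Qed.

Lemma exists_orthogonal_combination n m (W : 'I_n -> V) (e : nat -> V) :
  (m < n)%N -> exists a : 'I_n -> R, (exists i, a i != 0) /\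
   forall j, (j < m)%N -> \sum_i a i * ip (W i) (e j) = 0.
Proof.
move=> mn; pose A := \matrix_(i < n, j < m) ip (W i) (e j).
have [v v0 vA] := exists_left_kernel A mn.
exists (fun i => v 0 i); split.
  by move: v0 => /rV0Pn.
move=> j jm; have := congr1 (fun M : 'rV_m => M 0 (Ordinal jm)) vA.
rewrite !mxE => h; rewrite -[RHS]h.
by apply: eq_bigr => i _; rewrite mxE.
Qed.

Lemma lincomb_closed n (W : 'I_n -> V) (a : 'I_n -> R) : D 0 -> (forall i, D (W i)) ->
  D (\sum_i a i *: W i).
Proof. by move=> D0 DW; apply: (big_ind D) => // i _; exact: DZ. Qed.

Lemma ip_lincombl n (W : 'I_n -> V) (a : 'I_n -> R) w : D w -> D 0 -> (forall i, D (W i)) ->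
  ip (\sum_i a i *: W i) w = \sum_i a i * ip (W i) w.
Proof.
move=> Dw D0 DW.
suff [] : D (\sum_i a i *: W i) /\ ip (\sum_i a i *: W i) w = \sum_i a i * ip (W i) w by [].
elim/big_rec2 : _ => [|i x y _ [Dy <-]].
  by split => //; rewrite -(scale0r 0) ipZl// mul0r.
split; first by apply: DD => //; exact: DZ.
by rewrite ipDl ?ipZl//; exact: DZ.
Qed.

(** While m < n eigenvectors are known, some nontrivial combination of the [W i] is orthogonal to
    all of them. Its Rayleigh quotient bounds from below the supremum over their orthogonal
    complement, where [next_eigenvector] finds the next one. *)
Lemma orthogonal_eigenvectors n (W : 'I_n -> V) lam : 0 < lam -> D 0 ->
  (forall i, D (W i)) ->
  (forall a : 'I_n -> R, (exists i, a i != 0) ->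
    0 < ip (\sum_i a i *: W i) (\sum_i a i *: W i) /\
    lam * ip (\sum_i a i *: W i) (\sum_i a i *: W i) <=
      ip (H (\sum_i a i *: W i)) (H (\sum_i a i *: W i))) ->
  exists (e : nat -> V) (nu : nat -> R),
    (forall i, (i < n)%N -> [/\ D (e i), 0 < ip (e i) (e i), lam <= nu i &
      forall v, D v -> ip (H (H (e i))) v = nu i * ip (e i) v]) /\
    (forall i j, (i < n)%N -> (j < i)%N -> ip (e i) (e j) = 0).
Proof.
move=> lam0 D0 DW hW.
suff : forall m, (m <= n)%N -> exists (e : nat -> V) (nu : nat -> R),
    (forall i, (i < m)%N -> [/\ D (e i), 0 < ip (e i) (e i), lam <= nu i &
      forall v, D v -> ip (H (H (e i))) v = nu i * ip (e i) v]) /\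
    (forall i j, (i < m)%N -> (j < i)%N -> ip (e i) (e j) = 0).
  by apply.
elim=> [_|m IH mn]; first by exists (fun=> 0), (fun=> 0).
have [e [nu [he eo]]] := IH (ltnW mn).
have [a [a0 ae]] := exists_orthogonal_combination W e mn.
have [g0 glam] := hW _ a0.
have [|||u [s [Du ue u0 ls us]]] := @next_eigenvector m e nu (\sum_i a i *: W i) lam lam0 _ _ _ g0 glam.
- by move=> i /he[].
- exact: lincomb_closed.
- by move=> i im; have [De _ _ _] := he i im; rewrite ip_lincombl// ae.
exists (fun i => if i == m then u else e i), (fun i => if i == m then s else nu i).
split.
  move=> i; rewrite ltnS leq_eqVlt; case: eqP => [-> _//|_ /=]; exact: he.
move=> i j; rewrite ltnS leq_eqVlt; case: eqP => [-> _|_ /= im] jm.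
  by rewrite ltn_eqF//; exact: ue.
by rewrite ltn_eqF ?eo//; exact: ltn_trans im.
Qed.

End CompactOperator.

Lemma cvg_sqr {R : realType} (f : nat -> R) (l : R) :
  f n @[n --> \oo] --> l -> f n ^+ 2 @[n --> \oo] --> l ^+ 2.
Proof. by move=> h; rewrite expr2; under eq_fun do rewrite expr2; exact: cvgM. Qed.

(** * Integration and approximation *)

Section IntegralTools.
Context d (T : measurableType d) (R : realType) (mu : {measure set T -> \bar R}).
Variables (D : set T) (mD : measurable D).

Lemma Rdominated_cvg (N : set T) (f_ : nat -> T -> R) (f g : T -> R) :
  measurable N -> mu N = 0%E ->
  (forall n, measurable_fun D (f_ n)) -> measurable_fun D f ->
  (forall x, D x -> ~ N x -> f_ n x @[n --> \oo] --> f x) ->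
  mu.-integrable D (EFin \o g) ->
  (forall n x, D x -> `|f_ n x| <= g x) ->
  mu.-integrable D (EFin \o f) /\
  \int[mu]_(x in D) f_ n x @[n --> \oo] --> \int[mu]_(x in D) f x.
Proof.
move=> mN N0 mf_ mf fcvg ig fg.
have [|||//||if_ _ icvg] := @dominated_convergence _ _ _ mu D mD (fun n => EFin \o f_ n)
  (EFin \o f) (EFin \o g).
- by move=> n; exact/measurable_EFinP.
- exact/measurable_EFinP.
- exists N; split => // x /= /not_implyP[Dx]; apply: contra_notP => Nx.
  by apply: cvg_EFin; [exact: nearW|exact: fcvg].
- by apply: aeW => x n Dx /=; rewrite lee_fin fg.
split => //.
have fin : (\int[mu]_(x in D) (EFin \o f) x)%E \is a fin_num by exact: integrable_fin_num.
by apply: fine_cvg; rewrite fineK.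
Qed.

Lemma fatou_le (f_ : nat -> T -> \bar R) (f : T -> \bar R) (a : nat -> \bar R) (l : \bar R) :
  (forall n, measurable_fun D (f_ n)) ->
  (forall n x, D x -> 0 <= f_ n x)%E ->
  (forall x, D x -> f_ n x @[n --> \oo] --> f x) ->
  (forall n, \int[mu]_(x in D) f_ n x <= a n)%E ->
  a n @[n --> \oo] --> l -> (\int[mu]_(x in D) f x <= l)%E.
Proof.
move=> mf f0 fcvg fa al.
rewrite (_ : integral _ _ _ = \int[mu]_(x in D) limn_einf (f_ ^~ x))%E; last first.
  apply: eq_integral => x /[!inE] Dx.
  by rewrite (cvg_limn_einf_sup (fcvg _ Dx)).1.
apply: (le_trans (fatou mu mD mf f0)).
rewrite -(cvg_limn_einf_sup al).1.
rewrite !limn_einf_lim; apply: lee_lim; [exact: is_cvg_einfs..|].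
apply: nearW => n; apply: le_ereal_inf_tmp => _ [m /= nm <-].
by apply: le_trans (fa m); apply: ereal_inf_lbound; exists m.
Qed.

Lemma Rintegral_series (f : nat -> T -> R) (S : T -> R) :
  (forall m, measurable_fun D (f m)) ->
  (\sum_(m <oo) \int[mu]_(x in D) `|f m x|%:E < +oo)%E ->
  (forall x, D x -> series (f ^~ x) @ \oo --> S x) ->
  mu.-integrable D (EFin \o S) /\
  series (fun m => \int[mu]_(x in D) f m x) @ \oo --> \int[mu]_(x in D) S x.
Proof.
move=> mf sfin fS.
pose g : T -> \bar R := fun x => (\sum_(m <oo) `|f m x|%:E)%E.
have mg : measurable_fun D g.
  apply: ge0_emeasurable_sum => //= m _.
  by apply/measurable_EFinP; exact: measurableT_comp.
have intg : mu.-integrable D g.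
  apply/integrableP; split => //.
  under eq_integral do rewrite gee0_abs ?nneseries_ge0//.
  rewrite integral_nneseries// => m.
  by apply/measurable_EFinP; exact: measurableT_comp.
have mS : measurable_fun D S.
  apply/measurable_EFinP.
  apply: (emeasurable_fun_cvg (fun n => EFin \o (fun x => series (f ^~ x) n))) => //=.
    move=> n; apply/measurable_EFinP.
    by rewrite /series/=; exact: measurable_sum.
  by move=> x Dx; apply: cvg_EFin; [exact: nearW|exact: fS].
have intf m : mu.-integrable D (EFin \o f m).
  apply/integrableP; split; first exact/measurable_EFinP.
  apply: le_lt_trans sfin.
  apply: le_trans (nneseries_lim_ge m.+1 _); last first.
    by move=> k _ _; exact: integral_ge0.
  rewrite big_mkord (bigD1 ord_max)//= leeDl// sume_ge0// => i _.
  exact: integral_ge0.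
have [|||//||iS _ icvg] := @dominated_convergence _ _ _ mu D mD
  (fun n x => (series (f ^~ x) n)%:E) (EFin \o S) g.
- move=> n; apply/measurable_EFinP.
  by rewrite /series/=; exact: measurable_sum.
- exact/measurable_EFinP.
- by apply: aeW => x Dx; apply: cvg_EFin; [exact: nearW|exact: fS].
- apply: aeW => x n Dx; rewrite /g.
  apply: le_trans (nneseries_lim_ge n _); last by move=> k _ _; rewrite lee_fin.
  rewrite sumEFin lee_fin; exact: ler_norm_sum.
split=> //.
have fin : (\int[mu]_(x in D) (EFin \o S) x)%E \is a fin_num by exact: integrable_fin_num.
have : fine (\int[mu]_(x in D) (series (f ^~ x) n)%:E)%E @[n --> \oo] -->
   \int[mu]_(x in D) S x by apply: fine_cvg; rewrite fineK.
apply: eq_cvgr => n; rewrite /series/= .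
rewrite -[RHS]/(fine (EFin _)) -sumEFin; congr fine.
under eq_integral do rewrite -sumEFin.
rewrite integral_sum//.
by apply: eq_bigr => i _; rewrite /Rintegral fineK//; exact: (integrable_fin_num mD (intf i)).
Qed.

End IntegralTools.

(** * Bernstein polynomials and their pointwise convergence *)

Section Bernstein.
Context {R : realType}.

(* De Casteljau's recursion for \sum_k 'C(n, k) X^k (1 - X)^(n - k) g k. *)
Fixpoint bernstein (n : nat) (g : nat -> R) : {poly R} :=
  if n is n'.+1 then (1 - 'X) * bernstein n' g + 'X * bernstein n' (g \o S)
  else (g 0%N)%:P.

(* n s (1 - s) + (n s - a)^2 is the second moment about a of a binomial variable
   with parameters n and s: this is Chebyshev's inequality. *)
Lemma bernstein_near n (g : nat -> R) (L e K a s : R) : 0 <= s <= 1 ->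
  (forall k, `|g k - L| <= e + K * (k%:R - a) ^+ 2) ->
  `|(bernstein n g).[s] - L| <= e + K * (n%:R * s * (1 - s) + (n%:R * s - a) ^+ 2).
Proof.
move=> /andP[s0 s1]; elim: n g a => [|n IH] g a gL /=.
  rewrite hornerC; have := gL 0%N; congr (_ <= _); ring.
rewrite !hornerE.
have h1 := IH g a gL.
(* Shifting g by one moves the centre of the moment from a to a - 1. *)
have h2 : `|(bernstein n (g \o S)).[s] - L| <=
    e + K * (n%:R * s * (1 - s) + (n%:R * s - (a - 1)) ^+ 2).
  apply: IH => k; rewrite (le_trans (gL k.+1))// -natr1.
  by rewrite (_ : k%:R + 1 - a = k%:R - (a - 1))//; ring.
rewrite (_ : _ - L = (1 - s) * ((bernstein n g).[s] - L)
  + s * ((bernstein n (g \o S)).[s] - L)); last by ring.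
apply: (le_trans (ler_normD _ _)).
rewrite !normrM (ger0_norm s0) (ger0_norm (_ : 0 <= 1 - s)) ?subr_ge0//.
have s1' : 0 <= 1 - s by rewrite subr_ge0.
apply: (le_trans (lerD (ler_wpM2l s1' h1) (ler_wpM2l s0 h2))).
by rewrite le_eqVlt; apply/orP; left; apply/eqP; rewrite -natr1; ring.
Qed.

Lemma bernstein_le n (g : nat -> R) (C s : R) : 0 <= s <= 1 ->
  (forall k, `|g k| <= C) -> `|(bernstein n g).[s]| <= C.
Proof.
move=> s01 gC; have := @bernstein_near n g 0 C 0 0 s s01.
by rewrite mul0r addr0 subr0; apply => k; rewrite subr0 mul0r addr0.
Qed.

Lemma bernstein_cvg (F : R -> R) (C s : R) : 0 <= s <= 1 -> (forall r, `|F r| <= C) ->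
  {for s, continuous F} ->
  (bernstein n (fun k => F (k%:R / n%:R))).[s] @[n --> \oo] --> F s.
Proof.
move=> s01 FC Fs; have C0 : 0 <= C by exact: le_trans (FC 0).
apply/cvgrPdist_le => e e0.
have e20 : 0 < e / 2 by rewrite divr_gt0.
have /cvgrPdist_le/(_ _ e20)/nbhs_normP[h/= h0 hF] := Fs.
near=> n.
have n0 : 0 < n%:R :> R by rewrite ltr0n; near: n; exact: nbhs_infty_gt.
have hn : 2 * C / h ^+ 2 / (e / 2) <= n%:R.
  by near: n; exact: nbhs_infty_ger.
rewrite distrC.
(* If |k/n - s| >= h then K (k - n s)^2 >= 2 C, which bounds the difference of any two values of F.
   The variance contributes at most K n s (1 - s) <= (2 C / h^2) / n. *)
pose K := 2 * C / (n%:R * h) ^+ 2.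
have K0 : 0 <= K by rewrite /K divr_ge0 ?sqr_ge0// mulr_ge0.
have := @bernstein_near n (fun k => F (k%:R / n%:R)) (F s) (e / 2) K (n%:R * s) s s01.
move=> H; apply: (le_trans (H _)) => [k|].
  have [lt|ge] := ltP `|s - k%:R / n%:R| h.
    have := hF _ lt; rewrite /= distrC => h1; apply: (le_trans h1).
    by rewrite lerDl mulr_ge0// sqr_ge0.
  have h2 : `|F (k%:R / n%:R) - F s| <= 2 * C.
    have := ler_normB (F (k%:R / n%:R)) (F s); have := FC (k%:R / n%:R); have := FC s; lra.
  suff : 2 * C <= K * (k%:R - n%:R * s) ^+ 2 by lra.
  rewrite /K mulrAC ler_pdivlMr; last by rewrite exprn_gt0 ?mulr_gt0.
  apply: ler_wpM2l; first exact: mulr_ge0.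
  rewrite (_ : k%:R - n%:R * s = - (n%:R * (s - k%:R / n%:R))); last first.
    by field; rewrite gt_eqF.
  rewrite sqrrN !exprMn ler_wpM2l ?sqr_ge0// -[leRHS]real_normK ?num_real//.
  by rewrite ler_pXn2r// ?nnegrE// ltW.
rewrite subrr expr0n addr0.
have : K * (n%:R * s * (1 - s)) <= e / 2.
  have -> : K * (n%:R * s * (1 - s)) = 2 * C / h ^+ 2 / n%:R * (s * (1 - s)).
    by rewrite /K; field; rewrite !gt_eqF.
  apply: (@le_trans _ _ (2 * C / h ^+ 2 / n%:R)).
    rewrite ler_piMr//; last by case/andP: s01 => s0 s1; nra.
    by rewrite !divr_ge0 ?mulr_ge0 ?sqr_ge0// ltW.
  have e1 : 2 * C / h ^+ 2 <= n%:R * (e / 2) by rewrite -ler_pdivrMr.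
  by rewrite ler_pdivrMr// (mulrC (e / 2)).
lra.
Unshelve. all: by end_near. Qed.

End Bernstein.

(** * Euler's Gamma integral *)

Section Gamma.
Context {R : realType}.
Notation mu := (@lebesgue_measure R).
Let D : set (measurableTypeR R) := `]0%R, +oo[%classic.
Let mD : measurable D.
Proof. exact: measurable_itv. Qed.

Lemma measurable_powR_expR D' (a : R) (g : R -> R) : measurable_fun D' g ->
  measurable_fun D' (fun t : R => t `^ a * expR (g t)).
Proof.
move=> mg; apply: measurable_funM.
  exact: measurable_funTS (measurable_powR _).
exact: measurableT_comp.
Qed.

Lemma bigcup_itv0y : \bigcup_n `[(n.+1%:R^-1 : R), n.+1%:R]%classic = D.
Proof.
apply/seteqP; split => [x [n _]|x]; rewrite /D /= !in_itv/=.
  by move=> /andP[h _]; rewrite andbT (lt_le_trans _ h)// invr_gt0.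
rewrite andbT => x0.
have [n [nx xn]] : exists n : nat, x <= n.+1%:R /\ x^-1 <= n.+1%:R.
  have := Num.Theory.truncnS_gt (Num.max x x^-1); rewrite gt_max => /andP[/ltW h1 /ltW h2].
  by exists (Num.truncn (Num.max x x^-1)).
exists n => //=; rewrite in_itv/= nx andbT.
by rewrite invf_ple ?posrE.
Qed.

(** G may be singular at 0, so the substitution y = p x^(k+1) is made on the compact intervals
    [1/(n+1), n+1] and extended by monotone convergence. *)
Lemma ge0_integral_monomial_subst (p : R) k (G : R -> R) : 0 < p ->
  (forall x : R, 0 < x -> {for x, continuous G}) -> (forall x : R, 0 < x -> 0 <= G x) ->
  (\int[mu]_(x in D) (G x)%:E =
   \int[mu]_(x in D) (G (p * x ^+ k.+1) * (p * (k.+1%:R * x ^+ k)))%:E)%E.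
Proof.
move=> p0 cG G0.
pose F (x : R) := p * x ^+ k.+1.
have dF (x : R) : is_derive x 1 F (p * (k.+1%:R * x ^+ k)).
  have -> : F = p *: (@id R ^+ k.+1).
    by apply/funext => y; rewrite /F /GRing.scale/= fctE.
  by apply: is_derive_eq; rewrite /GRing.scale/= mulr1.
have dF1 : F^`()%classic = (fun x => p * (k.+1%:R * x ^+ k)).
  by apply/funext => x; rewrite derive1E; exact: derive_val.
have cF x : {for x, continuous F}.
  by apply: differentiable_continuous; apply/derivable1_diffP; case: (dF x).
have cF1 x : {for x, continuous F^`()%classic}.
  rewrite dF1; apply: continuousM; first exact: cst_continuous.
  apply: continuousM; first exact: cst_continuous.
  exact: exprn_continuous.
pose E n := `[(n.+1%:R^-1 : R), n.+1%:R]%classic.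
have E0 n x : E n x -> 0 < x.
  by rewrite /E/= in_itv/= => /andP[h _]; rewrite (lt_le_trans _ h)// invr_gt0.
have ndE : nondecreasing_seq E.
  move=> n m nm; rewrite subsetEset; apply: subset_itv; rewrite bnd_simp.
    by rewrite lef_pV2 ?posrE// ler_nat ltnS.
  by rewrite ler_nat ltnS.
pose E' n := `[F n.+1%:R^-1, F n.+1%:R]%classic.
have incF (x y : R) : 0 <= x -> x < y -> F x < F y.
  by move=> x0 xy; rewrite /F ltr_pM2l// ltrXn2r// nnegrE// (le_trans x0)// ltW.
have lF (x y : R) : 0 <= x -> x <= y -> F x <= F y.
  by move=> x0; rewrite le_eqVlt => /orP[/eqP ->//|]; move/(incF _ _ x0)/ltW.
have F0 (x : R) : 0 < x -> 0 < F x.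
  by move=> x0; rewrite /F mulr_gt0// exprn_gt0.
have E'0 n x : E' n x -> 0 < x.
  rewrite /E'/= in_itv/= => /andP[h _]; rewrite (lt_le_trans _ h)//.
  by rewrite F0// invr_gt0.
have ndE' : nondecreasing_seq E'.
  move=> n m nm; rewrite subsetEset; apply: subset_itv; rewrite bnd_simp.
    by rewrite lF// lef_pV2 ?posrE// ler_nat ltnS.
  by rewrite lF// ler_nat ltnS.
have bigE' : \bigcup_n E' n = D.
  apply/seteqP; split => [x [n _ /E'0 x0]|x]; rewrite /D /= !in_itv/= ?x0// andbT => x0.
  have [n hn] : exists n : nat, Num.max (x / p) (p / x) <= n.+1%:R.
    have /ltW h := Num.Theory.truncnS_gt (Num.max (x / p) (p / x)).
    by exists (Num.Def.trunc (Num.max (x / p) (p / x))).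
  move: hn; rewrite ge_max => /andP[h1 h2].
  have n1 : 1 <= n.+1%:R :> R by rewrite ler1n.
  have hk : n.+1%:R <= n.+1%:R ^+ k.+1 :> R by rewrite -[leLHS]expr1 ler_weXn2l.
  exists n => //; rewrite /E' /F /= in_itv/=; apply/andP; split.
    rewrite -ler_pdivlMl// exprVn invf_ple ?posrE ?mulr_gt0 ?invr_gt0 ?exprn_gt0//.
    by rewrite invfM invrK (le_trans _ hk)// mulrC.
  by rewrite -ler_pdivrMl// mulrC (le_trans h1).
have mG : forall n, measurable_fun (E' n) (EFin \o G).
  move=> n; apply/measurable_EFinP; apply: (@measurable_funS _ _ _ _ D).
    exact: measurable_itv.
    by move=> x /E'0 x0; rewrite /D/= in_itv/= x0.
  apply: open_continuous_measurable_fun; first exact: interval_open.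
  by move=> x; rewrite inE /D/= in_itv/= andbT; exact: cG.
pose G2 := (G \o F) * F^`()%classic.
have cG2 x : 0 < x -> {for x, continuous G2}.
  move=> x0; apply: continuousM; last exact: cF1.
  by apply: continuous_comp; [exact: cF|exact/cG/F0].
have mG2 : forall n, measurable_fun (E n) (EFin \o G2).
  move=> n; apply/measurable_EFinP; apply: (@measurable_funS _ _ _ _ D).
    exact: measurable_itv.
    by move=> x /E0 x0; rewrite /D/= in_itv/= x0.
  apply: open_continuous_measurable_fun; first exact: interval_open.
  by move=> x; rewrite inE /D/= in_itv/= andbT; exact: cG2.
have c1 := @ge0_nondecreasing_set_cvg_integral _ (measurableTypeR R) R E' (EFin \o G) mu ndE'
  (fun n => measurable_itv _) mG (fun n x h => G0 x (E'0 n x h)).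
have G20 n x : E n x -> (0 <= (EFin \o G2) x)%E.
  move=> /E0 x0; rewrite /G2 /= dF1 lee_fin mulr_ge0 ?G0 ?F0//.
  by rewrite !mulr_ge0 ?exprn_ge0// ltW.
have c2 := @ge0_nondecreasing_set_cvg_integral _ (measurableTypeR R) R E (EFin \o G2) mu ndE
  (fun n => measurable_itv _) mG2 G20.
rewrite bigE' in c1; rewrite bigcup_itv0y in c2.
have E12 n : (\int[mu]_(x in E' n) (EFin \o G) x = \int[mu]_(x in E n) (EFin \o G2) x)%E.
  have v0 : 0 < n.+1%:R^-1 :> R by rewrite invr_gt0.
  apply: integration_by_substitution_increasing.
  - by rewrite (@le_trans _ _ 1) ?ler1n// invf_le1// ler1n.
  - move=> x y; rewrite !in_itv/= => /andP[x1 _] _; apply: incF.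
    by rewrite (le_trans _ x1)// ltW.
  - by move=> x _; exact: cF1.
  - by apply: cvgP; apply: cvg_at_right_filter; exact: cF1.
  - by apply: cvgP; apply: cvg_at_left_filter; exact: cF1.
  - split.
    + by move=> x _; case: (dF x).
    + by apply: cvg_at_right_filter; exact: cF.
    + by apply: cvg_at_left_filter; exact: cF.
  - apply: continuous_in_subspaceT => x; rewrite inE => /(E'0 n).
    exact: cG.
rewrite (_ : (fun x => (G (p * x ^+ k.+1) * _)%:E) = EFin \o G2); last first.
  by apply/funext => x; rewrite /G2/= dF1.
rewrite (funext E12) in c1; exact: cvg_unique c1 c2.
Qed.

Let Gf (a t : R) := t `^ (a - 1) * expR (- t).

Lemma continuous_powR (a x : R) : 0 < x -> {for x, continuous (@powR R ^~ a)}.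
Proof.
move=> x0; apply: differentiable_continuous; apply/derivable1_diffP.
by case: (is_derive1_powR a x0).
Qed.

Lemma continuous_gammaf (a x : R) : 0 < x -> {for x, continuous (Gf a)}.
Proof.
move=> x0; apply: continuousM; first exact: continuous_powR.
apply: continuous_comp; first exact: continuousN.
exact: continuous_expR.
Qed.

Lemma measurable_gammaf (a : R) D' : measurable_fun D' (Gf a).
Proof.
by apply: measurable_powR_expR; exact: measurable_funTS.
Qed.

Lemma integrable_expRN (r : R) : 0 < r -> mu.-integrable D (fun x => (expR (- (r * x)))%:E).
Proof.
move=> r0; have h := integrable_exponential_pdf r0.
have hD : mu.-integrable D (EFin \o exponential_pdf r).
  by apply: integrableS h => //; exact: measurable_itv.
move: hD.
move=> /(@integrableZl _ (measurableTypeR R) R mu D mD r^-1).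
apply: eq_integrable => //= x; rewrite inE /D/= in_itv/= andbT => x0.
rewrite exponential_pdfE ?ltW// -EFinM mulrA mulVf ?gt_eqF// mul1r.
by rewrite mulNr.
Qed.

(** The inequality z <= exp z, at z = u / (2 N), raised to the power N. *)
Lemma pow_le_expR (N : nat) (u : R) : 0 <= u -> (0 < N)%N ->
  u ^+ N <= (2 * N%:R) ^+ N * expR (u / 2).
Proof.
move=> u0 N0; have N1 : 0 < 2 * N%:R :> R by rewrite mulr_gt0// ltr0n.
have h : u / (2 * N%:R) <= expR (u / (2 * N%:R)).
  by rewrite (le_trans _ (expR_ge1Dx _))// lerDr.
have := @lerXn2r _ N (u / (2 * N%:R)) (expR (u / (2 * N%:R))).
rewrite !nnegrE divr_ge0 ?expR_ge0 ?(ltW N1)// => /(_ isT isT h).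
rewrite -expRM_natl exprMn exprVn ler_pdivrMr ?exprn_gt0// mulrC.
by rewrite (_ : N%:R * _ = u / 2)//; field; rewrite gt_eqF// ltr0n.
Qed.

(** The substitution t = x^(k+1) with (k+1) a >= 1 removes the singularity at 0: the integrand
    becomes (k+1) x^b exp (- x^(k+1)) with b >= 0, which a multiple of exp (- x/2) dominates. *)
Lemma integrable_gammaf (a : R) : 0 < a -> mu.-integrable D (EFin \o Gf a).
Proof.
move=> a0; apply/integrableP; split.
  by apply/measurable_EFinP; exact: measurable_gammaf.
have Gf0 t : 0 <= Gf a t by rewrite mulr_ge0 ?powR_ge0 ?expR_ge0.
under eq_integral do rewrite /= ger0_norm//.
have [k hk] : exists k : nat, 1 <= k.+1%:R * a.
  exists (Num.Def.trunc a^-1); rewrite -ler_pdivrMr// div1r ltW//.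
  exact: Num.Theory.truncnS_gt.
rewrite (@ge0_integral_monomial_subst 1 k (Gf a))//; last first.
  by move=> x x0; exact: continuous_gammaf.
pose b := k.+1%:R * a - 1.
have b0 : 0 <= b by rewrite subr_ge0.
pose M := (Num.Def.trunc b).+1.
have bM : b <= M%:R by rewrite ltW//; exact: Num.Theory.truncnS_gt.
(* The summand [expR 1] serves x <= 1, where 1 <= e * exp (- x/2). The other one serves x > 1, where
   the integrand is at most (k+1) x^M exp (- x) and [pow_le_expR] applies. *)
pose C : R := k.+1%:R * ((2 * M%:R) ^+ M + expR 1).
have C0 : 0 <= C by rewrite mulr_ge0// addr_ge0 ?expR_ge0// exprn_ge0// mulr_ge0.
apply: (@le_lt_trans _ _ (\int[mu]_(x in D) (C%:E * (expR (- (2^-1 * x)))%:E))%E).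
  apply: ge0_le_integral => //.
  - move=> x; rewrite /D/= in_itv/= andbT => x0.
    by rewrite lee_fin mulr_ge0// mul1r mulr_ge0// exprn_ge0// ltW.
  - apply/measurable_EFinP; apply: measurable_funM; last first.
      by apply: measurable_funM => //; apply: measurable_funM => //; exact: measurable_funTS.
    have mm : measurable_fun [set: R] (fun x : R => Gf a (1 * x ^+ k.+1)).
      apply: (@measurableT_comp _ _ _ _ _ _ (Gf a)); first exact: measurable_gammaf.
      by apply: measurable_funM => //; exact: exprn_measurable.
    exact: measurable_funTS mm.
  - apply/measurable_EFinP; apply: measurable_funM => //.
    apply: measurable_funTS; apply: measurableT_comp => //.
    by apply: measurableT_comp => //; exact: measurable_funM.
  - move=> x; rewrite /D/= in_itv/= andbT => x0; rewrite -EFinM lee_fin.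
    have -> : Gf a (1 * x ^+ k.+1) * (1 * (k.+1%:R * x ^+ k)) =
        k.+1%:R * (x `^ b * expR (- x ^+ k.+1)).
      rewrite /Gf !mul1r -(powR_mulrn k.+1 (ltW x0)) -(powR_mulrn k (ltW x0)).
      rewrite -powRrM (_ : x `^ b = x `^ (k.+1%:R * (a - 1)) * x `^ k%:R); first by ring.
      rewrite -powRD; last by rewrite (gt_eqF x0) implybT.
      by congr (_ `^ _); rewrite /b -natr1; ring.
    rewrite /C -mulrA ler_wpM2l//.
    have [x1|x1] := lerP x 1.
      apply: (@le_trans _ _ 1).
        rewrite mulr_ile1 ?powR_ge0 ?expR_ge0//.
          have := @ge0_ler_powR R b b0 x 1; rewrite powR1; apply => //.
          by rewrite nnegrE ltW.
          by rewrite nnegrE.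
        by rewrite -[leRHS]expR0 ler_expR oppr_le0 exprn_ge0// ltW.
      rewrite mulrDl -[leLHS]add0r lerD// ?mulr_ge0 ?expR_ge0// ?exprn_ge0 ?mulr_ge0//.
      by rewrite -expRD -[leLHS]expR0 ler_expR; lra.
    apply: (@le_trans _ _ (x ^+ M * expR (- x))).
      rewrite ler_pM ?powR_ge0 ?expR_ge0//.
        by rewrite -powR_mulrn ?(ltW x0)// ler_powR// ltW.
      by rewrite ler_expR lerN2 -[leLHS]expr1 ler_weXn2l// ltW.
    have := pow_le_expR (ltW x0) (isT : (0 < M)%N).
    move=> h; apply: (@le_trans _ _ ((2 * M%:R) ^+ M * expR (x / 2) * expR (- x))).
      by rewrite ler_wpM2r ?expR_ge0.
    rewrite -mulrA -expRD (_ : x / 2 - x = - (2^-1 * x)); last by field.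
    by rewrite ler_wpM2r ?expR_ge0// lerDl expR_ge0.
rewrite integralZl//; last exact: integrable_expRN.
rewrite lte_mul_pinfty// ?lee_fin//.
by apply: integrable_lty => //; exact: integrable_expRN.
Qed.

Lemma euler_gammaE (a : R) : 0 < a ->
  (\int[mu]_(t in D) (Gf a t)%:E = (euler_gamma a)%:E)%E.
Proof.
move=> a0; rewrite /euler_gamma /Rintegral fineK//.
by apply: integrable_fin_num => //; exact: integrable_gammaf.
Qed.

(** On [1, 2] the integrand is at least exp (-2) / 2, since t^(a-1) >= 1/t. A bound uniform in a is
    enough to dominate the Bessel coefficients by those of an exponential series. *)
Lemma euler_gamma_ge (a : R) : 0 < a -> expR (-2) / 2 <= euler_gamma a.
Proof.
move=> a0; rewrite -lee_fin -euler_gammaE//.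
have sub : `[(1:R), 2]%classic `<=` D.
  by move=> x; rewrite /D/= !in_itv/= andbT => /andP[h _]; rewrite (lt_le_trans _ h).
have mI : measurable (`[1:R, 2:R]%classic : set (measurableTypeR R)) by exact: measurable_itv.
have h1 : (\int[mu]_(t in `[1%R, 2%R]) (Gf a t)%:E <= \int[mu]_(t in D) (Gf a t)%:E)%E.
  apply: ge0_subset_integral => //.
    by apply/measurable_EFinP; exact: measurable_gammaf.
  by move=> x _; rewrite lee_fin mulr_ge0 ?powR_ge0 ?expR_ge0.
apply: le_trans h1.
have h2 : (\int[mu]_(t in `[1%R, 2%R]) (expR (-2) / 2)%:E = (expR (-2) / 2)%:E)%E.
  rewrite integral_cst// /= lebesgue_measure_itv/= lte_fin ltr1n -EFinD -EFinM.
  by congr EFin; ring.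
rewrite -h2; apply: ge0_le_integral => //.
- by apply/measurable_EFinP; exact: measurable_gammaf.
- move=> x /=; rewrite in_itv/= => /andP[x1 x2]; rewrite lee_fin /Gf mulrC.
  have x0 : 0 < x by rewrite (lt_le_trans _ x1).
  rewrite ler_pM ?expR_ge0 ?invr_ge0//.
    apply: (@le_trans _ _ (x `^ (-1))); last by rewrite ler_powR//; lra.
    by rewrite powR_inv1 ?(ltW x0)// lef_pV2 ?posrE.
  by rewrite ler_expR lerN2.
Qed.

Lemma euler_gamma_gt0 (a : R) : 0 < a -> 0 < euler_gamma a.
Proof. by move=> /euler_gamma_ge; apply: lt_le_trans; rewrite divr_gt0 ?expR_gt0. Qed.

(** Euler's integral after the substitution p t^(k+1). The case k = 1 gives the Gaussian moments for
    the Hankel transform, the case k = 0 the action of the Weyl integral on exponentials. *)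
Lemma ge0_integral_powR_exp (p a : R) k : 0 < p -> 0 < a ->
  (\int[mu]_(t in D) (t `^ (k.+1%:R * a - 1) * expR (- (p * t ^+ k.+1)))%:E =
   (euler_gamma a / k.+1%:R * p `^ (- a))%:E)%E.
Proof.
move=> p0 a0.
have := euler_gammaE a0; rewrite (@ge0_integral_monomial_subst p k (Gf a))//; first last.
- by move=> x _; rewrite mulr_ge0 ?powR_ge0 ?expR_ge0.
- by move=> x x0; exact: continuous_gammaf.
rewrite (_ : integral _ _ _ = \int[mu]_(t in D) ((p `^ a * k.+1%:R)%:E *
   (t `^ (k.+1%:R * a - 1) * expR (- (p * t ^+ k.+1)))%:E))%E; last first.
  apply: eq_integral => x; rewrite inE /D/= in_itv/= andbT => x0.
  rewrite -EFinM; congr EFin; rewrite /Gf powRM ?exprn_ge0 ?(ltW x0) ?(ltW p0)//.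
  rewrite -(powR_mulrn k.+1 (ltW x0)) -(powR_mulrn k (ltW x0)) -powRrM.
  rewrite (_ : p `^ a = p `^ (a - 1) * p); last first.
    by rewrite -[X in _ * X](powRr1 (ltW p0)) -powRD ?(gt_eqF p0) ?implybT// subrK.
  rewrite (_ : x `^ (k.+1%:R * a - 1) = x `^ (k.+1%:R * (a - 1)) * x `^ k%:R); first by ring.
  rewrite -powRD; last by rewrite (gt_eqF x0) implybT.
  by congr (_ `^ _); rewrite -natr1; ring.
rewrite ge0_integralZl_EFin//; first last.
- by rewrite mulr_ge0 ?powR_ge0.
- apply/measurable_EFinP; apply: measurable_powR_expR; apply: measurable_funTS.
  by apply: measurableT_comp => //; apply: measurable_funM => //; exact: exprn_measurable.
- by move=> x _; rewrite lee_fin mulr_ge0 ?powR_ge0 ?expR_ge0.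
have q0 : p `^ a * k.+1%:R != 0 by rewrite mulf_neq0// gt_eqF ?powR_gt0.
move=> h; rewrite (_ : euler_gamma a / k.+1%:R * _ = (p `^ a * k.+1%:R)^-1 * euler_gamma a); last first.
  by rewrite powRN invfM; ring.
rewrite EFinM -h muleA -EFinM mulVf// mul1e.
by [].
Qed.

End Gamma.

(** * The Hankel kernel *)

Section BesselKernel.
Context {R : realType}.
Notation mu := (@lebesgue_measure R).
Variables (c nu : R).
Hypothesis (c0 : 0 < c) (nu0 : - (1 / 2) < nu).
Let D : set (measurableTypeR R) := `]0%R, +oo[%classic.
Lemma mD : measurable D.
Proof. exact: measurable_itv. Qed.
Hint Resolve mD : core.

Lemma in_itv0y (x : R) : D x = (0 < x) :> Prop.
Proof. by rewrite /D/= in_itv/= andbT. Qed.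

(** These constants separate the variables: the m-th term of the series of sqrt (c x t) J_nu (c x t)
    is [ncoef m * emono m x * emono m t]. The scale c enters through [kap] and [amp], and [wt] is
    the common factor of the [emono m]. *)
Definition wt (t : R) : R := t `^ (nu + 1 / 2).
Definition bcoef (m : nat) : R := (-1) ^+ m / (m`!%:R * euler_gamma (m%:R + nu + 1)).
Definition kap : R := (c / 2) ^+ 2.
Definition amp : R := Num.sqrt c * (c / 2) `^ nu.
Definition ncoef (m : nat) : R := amp * bcoef m * kap ^+ m.
Definition emono (m : nat) (t : R) : R := wt t * t ^+ (2 * m).
Definition bkernel (x t : R) : R := Num.sqrt (c * x * t) * besselJ nu (c * x * t).

Lemma amp_gt0 : 0 < amp.
Proof. by rewrite mulr_gt0// ?sqrtr_gt0// powR_gt0// divr_gt0. Qed.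

Lemma kap_gt0 : 0 < kap.
Proof. by rewrite exprn_gt0// divr_gt0. Qed.

Lemma amp_ge0 : 0 <= amp. Proof. exact: ltW amp_gt0. Qed.

Lemma kap_ge0 : 0 <= kap. Proof. exact: ltW kap_gt0. Qed.

Lemma mnu1_gt0 (m : nat) : 0 < m%:R + nu + 1.
Proof. have : 0 <= m%:R :> R by []. by move: nu0; lra. Qed.

Lemma norm_bcoef m : `|bcoef m| = (m`!%:R * euler_gamma (m%:R + nu + 1))^-1.
Proof.
rewrite normrM normrX normrN1 expr1n mul1r normfV gtr0_norm// mulr_gt0//.
exact/euler_gamma_gt0/mnu1_gt0.
Qed.

Lemma norm_bcoef_le m : `|bcoef m| <= (2 * expR 2) / m`!%:R.
Proof.
rewrite norm_bcoef invfM mulrC ler_pM2r ?invr_gt0 ?ltr0n ?fact_gt0//.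
rewrite -[leRHS]invrK lef_pV2 ?posrE ?invr_gt0 ?mulr_gt0 ?expR_gt0//.
  by rewrite invfM -expRN mulrC; exact/euler_gamma_ge/mnu1_gt0.
exact/euler_gamma_gt0/mnu1_gt0.
Qed.

Lemma sqrt_powR (x : R) : 0 <= x -> Num.sqrt x = x `^ (1 / 2).
Proof. by move=> x0; rewrite div1r powR12_sqrt. Qed.

Lemma norm_ncoef m : `|ncoef m| = amp * `|bcoef m| * kap ^+ m.
Proof.
rewrite (normrM (amp * bcoef m)) (normrM amp) (gtr0_norm amp_gt0).
by rewrite (ger0_norm (exprn_ge0 m kap_ge0)).
Qed.

Lemma norm_ncoef_le m : `|ncoef m| <= amp * (2 * expR 2) * (kap ^+ m / m`!%:R).
Proof.
have q0 : 0 <= amp * kap ^+ m := mulr_ge0 amp_ge0 (exprn_ge0 m kap_ge0).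
rewrite norm_ncoef.
have := ler_wpM2r q0 (norm_bcoef_le m); congr (_ <= _); ring.
Qed.

Lemma emono_ge0 m (t : R) : 0 < t -> 0 <= emono m t.
Proof. by move=> t0; rewrite mulr_ge0 ?powR_ge0 ?exprn_ge0// ltW. Qed.

Lemma bkernel_term (x t : R) m : 0 < x -> 0 < t ->
  Num.sqrt (c * x * t) * ((-1) ^+ m / (m`!%:R * euler_gamma (m%:R + nu + 1))
      * (c * x * t / 2) `^ (2 * m%:R + nu)) = ncoef m * emono m x * emono m t.
Proof.
move=> x0 t0.
have x0' := ltW x0; have t0' := ltW t0; have c0' := ltW c0.
rewrite (_ : c * x * t / 2 = (c / 2) * x * t); last by ring.
have c20 : 0 < c / 2 by rewrite divr_gt0.
have z0 : 0 < c / 2 * x * t by rewrite !mulr_gt0.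
rewrite powRD; last by rewrite (gt_eqF z0) implybT.
rewrite -natrM powR_mulrn ?(ltW z0)//.
rewrite 2?powRM ?mulr_ge0 ?(ltW c20)// !sqrtrM ?mulr_ge0//.
rewrite /emono /wt !powRD ?(gt_eqF x0) ?(gt_eqF t0) ?implybT//.
rewrite (sqrt_powR x0') (sqrt_powR t0').
rewrite /ncoef /amp /bcoef /kap -exprM 2!exprMn.
ring.
Qed.

Lemma cvg_series_le (u v : nat -> R) : (forall n, `|u n| <= v n) ->
  cvgn (series v) -> cvgn (series u).
Proof.
move=> uv cv; apply: normed_cvg; apply: series_le_cvg cv => // n; rewrite ?normr_ge0//.
exact: le_trans (uv n).
Qed.

Lemma cvg_exp_series (C x : R) : cvgn (series (fun m => C * (x ^+ m / m`!%:R))).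
Proof.
have := @is_cvg_seriesZ _ _ C (is_cvg_series_exp_coeff x).
by [].
Qed.
Arguments cvg_exp_series : clear implicits.

Lemma cvg_ncoef : cvgn (series (fun m => `|ncoef m|)).
Proof.
have h := cvg_exp_series (amp * (2 * expR 2)) kap.
by apply: (cvg_series_le _ h) => m; rewrite normr_id norm_ncoef_le.
Qed.

Lemma bkernel_series (x t : R) : 0 < x -> 0 < t ->
  series (fun m => ncoef m * emono m x * emono m t) @ \oo --> bkernel x t.
Proof.
move=> x0 t0.
have e m := bkernel_term m x0 t0.
have cv : cvgn (series (fun m => ncoef m * emono m x * emono m t)).
  have h := cvg_exp_series (amp * (2 * expR 2) * wt x * wt t) (kap * x ^+ 2 * t ^+ 2).
  apply: (cvg_series_le _ h) => m.
  rewrite (normrM (ncoef m * emono m x)) (normrM (ncoef m)).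
  rewrite (ger0_norm (emono_ge0 m x0)) (ger0_norm (emono_ge0 m t0)) -mulrA.
  have q0 : 0 <= emono m x * emono m t by rewrite mulr_ge0 ?emono_ge0.
  have := ler_wpM2r q0 (norm_ncoef_le m); congr (_ <= _).
  have -> : (kap * x ^+ 2 * t ^+ 2) ^+ m = kap ^+ m * x ^+ (2 * m) * t ^+ (2 * m).
    by rewrite 2!(exprMn m) -!exprM.
  rewrite /emono; ring.
rewrite /bkernel /besselJ.
have Nz : Num.sqrt (c * x * t) != 0 by rewrite gt_eqF// sqrtr_gt0 !mulr_gt0.
pose v (m : nat) : R := (-1) ^+ m / (m`!%:R * euler_gamma (m%:R + nu + 1))
      * (c * x * t / 2) `^ (2 * m%:R + nu).
have uv : (fun m => ncoef m * emono m x * emono m t) = Num.sqrt (c * x * t) *: v.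
  by apply/funext => m; rewrite -e.
have cv' : cvgn (series v).
  have := @is_cvg_seriesZ _ _ (Num.sqrt (c * x * t))^-1 cv.
  by rewrite uv scalerA mulVf// scale1r.
rewrite uv.
rewrite (_ : Num.sqrt _ * _ = limn (series (Num.sqrt (c * x * t) *: v))).
  exact: is_cvg_seriesZ.
by rewrite lim_seriesZ.
Qed.

Lemma nneseries_lty (u : nat -> R) : (forall n, 0 <= u n) -> cvgn (series u) ->
  (\sum_(m <oo) (u m)%:E < +oo)%E.
Proof.
move=> u0 cu.
under eq_fun do rewrite sumEFin.
by rewrite EFin_lim// ltry.
Qed.

Lemma wt_sq (t : R) : 0 < t -> wt t ^+ 2 = t `^ (2 * (nu + 1) - 1).
Proof.
move=> t0; rewrite expr2 /wt -powRD; last by rewrite (gt_eqF t0) implybT.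
by congr (_ `^ _); field.
Qed.

Lemma gauss_integral_pow m (p : R) : 0 < p ->
  (\int[mu]_(t in D) (emono m t * (wt t * expR (- (p * t ^+ 2))))%:E =
  (euler_gamma (m%:R + nu + 1) / 2 * p `^ (- (m%:R + nu + 1)))%:E)%E.
Proof.
move=> p0; rewrite -(ge0_integral_powR_exp 1 p0 (mnu1_gt0 m)).
apply: eq_integral => t; rewrite inE in_itv0y => t0.
congr EFin; rewrite mulrA; congr (_ * _).
rewrite /emono mulrAC -expr2 wt_sq// -powR_mulrn ?(ltW t0)// -powRD; last first.
  by rewrite (gt_eqF t0) implybT.
by congr (_ `^ _); rewrite natrM; ring.
Qed.

Lemma measurable_wt : measurable_fun [set: R] wt.
Proof. exact: measurable_powR. Qed.

Lemma measurable_emono m : measurable_fun [set: R] (emono m).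
Proof. by apply: measurable_funM; [exact: measurable_wt|exact: exprn_measurable]. Qed.

Lemma measurable_gauss (p : R) : measurable_fun [set: R] (fun t : R => expR (- (p * t ^+ 2))).
Proof.
apply: measurableT_comp => //; apply: measurableT_comp => //.
by apply: measurable_funM => //; exact: exprn_measurable.
Qed.

Lemma emono_gauss_ge0 m p (t : R) : 0 < t -> 0 <= emono m t * (wt t * expR (- (p * t ^+ 2))).
Proof.
by move=> t0; rewrite !mulr_ge0 ?powR_ge0 ?expR_ge0 ?exprn_ge0// ltW.
Qed.

Lemma integrable_emono_gauss m (p : R) : 0 < p ->
  mu.-integrable D (fun t => (emono m t * (wt t * expR (- (p * t ^+ 2))))%:E).
Proof.
move=> p0; apply/integrableP; split.
  apply/measurable_EFinP; have mm : measurable_fun [set: R]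
     (fun t => emono m t * (wt t * expR (- (p * t ^+ 2)))).
    apply: measurable_funM; first exact: measurable_emono.
    by apply: measurable_funM; [exact: measurable_wt|exact: measurable_gauss].
  exact: measurable_funTS mm.
rewrite (_ : integral _ _ _ =
  \int[mu]_(t in D) (emono m t * (wt t * expR (- (p * t ^+ 2))))%:E)%E; last first.
  apply: eq_integral => t; rewrite inE in_itv0y => t0.
  by rewrite gee0_abs// lee_fin emono_gauss_ge0.
by rewrite gauss_integral_pow// ltry.
Qed.

(** Integrated termwise, the m-th Gaussian moment produces Gamma (m + nu + 1), which cancels the
    same factor in the Bessel coefficient; what remains is the exponential series at - kap x^2 / p.
    The series of absolute values is the one at + kap x^2 / p, which justifies the exchange. *)
Lemma hankel_gauss (x p : R) : 0 < x -> 0 < p ->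
  mu.-integrable D (fun t => (bkernel x t * (wt t * expR (- (p * t ^+ 2))))%:E) /\
  \int[mu]_(t in D) (bkernel x t * (wt t * expR (- (p * t ^+ 2)))) =
   amp / 2 * wt x * p `^ (- (nu + 1)) * expR (- (kap / p * x ^+ 2)).
Proof.
move=> x0 p0.
pose f m (t : R) := ncoef m * emono m x * (emono m t * (wt t * expR (- (p * t ^+ 2)))).
have intf m : \int[mu]_(t in D) f m t =
   amp / 2 * wt x * p `^ (- (nu + 1)) * exp_coeff (- (kap / p * x ^+ 2)) m.
  rewrite RintegralZl//; last exact: integrable_emono_gauss.
  rewrite /Rintegral gauss_integral_pow//=.
  rewrite (_ : - (m%:R + nu + 1) = - m%:R - (nu + 1)); last by ring.
  rewrite powRD; last by rewrite (gt_eqF p0) implybT.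
  rewrite (powRN p m%:R) powR_mulrn ?(ltW p0)//.
  have -> : exp_coeff (- (kap / p * x ^+ 2)) m =
      (-1) ^+ m * kap ^+ m / p ^+ m * x ^+ (2 * m) / m`!%:R.
    rewrite /exp_coeff/= -[X in X ^+ m]mulN1r 3!(exprMn m) exprVn -(exprM x).
    ring.
  rewrite /ncoef /emono /bcoef.
  have g0 := euler_gamma_gt0 (mnu1_gt0 m).
  field; rewrite !gt_eqF//= ?exprn_gt0// ltr0n fact_gt0//.
have absf m : (\int[mu]_(t in D) `|f m t|%:E)%E =
   (amp / 2 * wt x * p `^ (- (nu + 1)) * exp_coeff (kap / p * x ^+ 2) m)%:E.
  rewrite (_ : integral _ _ _ = \int[mu]_(t in D)
     ((`|ncoef m| * emono m x)%:E * (emono m t * (wt t * expR (- (p * t ^+ 2))))%:E))%E; last first.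
    apply: eq_integral => t; rewrite inE in_itv0y => t0.
    rewrite -EFinM; congr EFin; rewrite /f (normrM (ncoef m * emono m x)) (normrM (ncoef m)).
    by rewrite (ger0_norm (emono_ge0 m x0)) (ger0_norm (emono_gauss_ge0 m p t0)).
  rewrite integralZl//; last exact: integrable_emono_gauss.
  rewrite gauss_integral_pow// -EFinM; congr EFin.
  rewrite (_ : - (m%:R + nu + 1) = - m%:R - (nu + 1)); last by ring.
  rewrite powRD; last by rewrite (gt_eqF p0) implybT.
  rewrite (powRN p m%:R) powR_mulrn ?(ltW p0)//.
  have -> : exp_coeff (kap / p * x ^+ 2) m = kap ^+ m / p ^+ m * x ^+ (2 * m) / m`!%:R.
    by rewrite /exp_coeff/= 2!(exprMn m) exprVn -(exprM x).
  rewrite norm_ncoef norm_bcoef /emono.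
  have g0 := euler_gamma_gt0 (mnu1_gt0 m).
  field; rewrite !gt_eqF//= ?exprn_gt0// ltr0n fact_gt0//.
have [|||iS cvgS] := @Rintegral_series _ (measurableTypeR R) R mu D mD f
  (fun t => bkernel x t * (wt t * expR (- (p * t ^+ 2)))).
- move=> m; have mm : measurable_fun [set: R] (f m).
    apply: measurable_funM => //; apply: measurable_funM; first exact: measurable_emono.
    by apply: measurable_funM; [exact: measurable_wt|exact: measurable_gauss].
  exact: measurable_funTS mm.
- under eq_eseriesr do rewrite absf.
  apply: nneseries_lty => [m|].
    rewrite mulr_ge0// ?mulr_ge0 ?powR_ge0// ?divr_ge0// ?amp_ge0//.
    by rewrite exprn_ge0// mulr_ge0 ?sqr_ge0// divr_ge0 ?kap_ge0// ltW.
  exact: (is_cvg_seriesZ (is_cvg_series_exp_coeff _)).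
- move=> t; rewrite in_itv0y => t0.
  have h : (fun n => series (fun m => ncoef m * emono m x * emono m t) n *
      (wt t * expR (- (p * t ^+ 2)))) @ \oo --> bkernel x t * (wt t * expR (- (p * t ^+ 2))).
    by apply: cvgM; [exact: bkernel_series|exact: cvg_cst].
  apply: eq_cvgr h => n; rewrite /series/= mulr_suml; apply: eq_bigr => i _.
  by rewrite /f mulrA.
split => //; move: cvgS => /cvg_lim <-//.
apply/cvg_lim => //.
have -> : series (fun m => \int[mu]_(t in D) f m t) =
  series ((amp / 2 * wt x * p `^ (- (nu + 1))) *: exp_coeff (- (kap / p * x ^+ 2))).
  by congr series; apply/funext => m; rewrite intf.
have h := is_cvg_series_exp_coeff (- (kap / p * x ^+ 2)).
rewrite (_ : _ * expR _ = limn (series ((amp / 2 * wt x * p `^ (- (nu + 1))) *: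
    exp_coeff (- (kap / p * x ^+ 2))))).
  exact: is_cvg_seriesZ.
by rewrite lim_seriesZ.
Qed.

Lemma measurable_bkernel (x : R) : 0 < x -> measurable_fun D (bkernel x).
Proof.
move=> x0; apply/measurable_EFinP.
apply: (emeasurable_fun_cvg (fun n t =>
   (series (fun m => ncoef m * emono m x * emono m t) n)%:E)).
  move=> n; apply/measurable_EFinP; rewrite /series/=; apply: measurable_sum => m.
  have mm : measurable_fun [set: R] (fun t => ncoef m * emono m x * emono m t).
    by apply: measurable_funM => //; exact: measurable_emono.
  exact: measurable_funTS mm.
move=> t; rewrite in_itv0y => t0.
by apply: cvg_EFin; [exact: nearW|exact: bkernel_series].
Qed.

Lemma gauss_int (p : R) : 0 < p ->
  mu.-integrable D (fun t => (wt t ^+ 2 * expR (- (p * t ^+ 2)))%:E) /\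
  \int[mu]_(t in D) (wt t ^+ 2 * expR (- (p * t ^+ 2))) =
   euler_gamma (nu + 1) / 2 * p `^ (- (nu + 1)).
Proof.
move=> p0.
have e t : wt t ^+ 2 * expR (- (p * t ^+ 2)) = emono 0 t * (wt t * expR (- (p * t ^+ 2))).
  by rewrite /emono muln0 expr0 mulr1 expr2 mulrA.
under eq_fun do rewrite e; split; first exact: integrable_emono_gauss.
under eq_Rintegral do rewrite e.
by rewrite /Rintegral gauss_integral_pow// add0r.
Qed.

(** This is where the factor c of Plancherel's identity comes from: kap^(nu+1) cancels the
    kap^(-(nu+1)) released by the rates kap / k of the transformed sum. *)
Lemma amp_kap : c * (amp / 2) ^+ 2 = kap `^ (nu + 1).
Proof.
have c20 : 0 < c / 2 by rewrite divr_gt0.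
rewrite /kap /amp -(powR_mulrn 2 (ltW c20)) -powRrM expr_div_n exprMn sqr_sqrtr ?(ltW c0)//.
rewrite -[X in c * (c * X / _)]powR_mulrn ?powR_ge0// -powRrM.
rewrite (_ : 2%:R * (nu + 1) = 2 + nu * 2%:R); last by ring.
rewrite powRD; last by rewrite (gt_eqF c20) implybT.
by rewrite powR_mulrn ?(ltW c20)//; field.
Qed.

End BesselKernel.

Section Lincomb.
Context d (T : measurableType d) (R : realType) (mu : {measure set T -> \bar R}).
Variables (D : set T) (mD : measurable D).

Lemma Rintegral_lincomb n (a : nat -> R) (g : nat -> T -> R) :
  (forall k, mu.-integrable D (EFin \o g k)) ->
  mu.-integrable D (fun x => (\sum_(k < n) a k * g k x)%:E) /\
  \int[mu]_(x in D) (\sum_(k < n) a k * g k x) =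
    \sum_(k < n) a k * \int[mu]_(x in D) g k x.
Proof.
move=> ig; elim: n => [|n [IH1 IH2]].
  under eq_fun do rewrite big_ord0.
  split; first exact: integrable0.
  under eq_Rintegral do rewrite big_ord0.
  by rewrite Rintegral_cst// mul0r big_ord0.
have ign : mu.-integrable D (EFin \o (fun x => a n * g n x)).
  by have := integrableZl mD (a n) (ig n).
have e x : \sum_(k < n.+1) a k * g k x = \sum_(k < n) a k * g k x + a n * g n x.
  by rewrite big_ord_recr.
split.
  under eq_fun do rewrite e EFinD.
  exact: integrableD.
under eq_Rintegral do rewrite e.
by rewrite RintegralD// IH2 RintegralZl// big_ord_recr.
Qed.

End Lincomb.

(** * The Hankel transform on the half-line *)

Section Plancherel.
Context {R : realType}.
Notation mu := (@lebesgue_measure R).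
Variables (c nu : R).
Hypothesis (c0 : 0 < c) (nu0 : - (1 / 2) < nu).
Let D : set (measurableTypeR R) := `]0%R, +oo[%classic.
Let mD : measurable D := @mD R.
Hint Resolve mD : core.
Local Notation wt := (wt nu).
Local Notation bkernel := (bkernel c nu).
Local Notation kap := (kap c).
Local Notation amp := (amp c nu).
Let DE (x : R) : D x = (0 < x) :> Prop.
Proof. exact: in_itv0y. Qed.

Definition expsum n (a q : nat -> R) (y : R) : R := \sum_(k < n) a k * expR (- (q k * y)).

Definition hankel0y (phi : R -> R) (x : R) : R :=
  \int[mu]_(t in D) (bkernel x t * (wt t * phi (t ^+ 2))).

Lemma expsum_sq n (a q : nat -> R) : (forall k, 0 < q k) ->
  mu.-integrable D (fun t => ((wt t * expsum n a q (t ^+ 2)) ^+ 2)%:E) /\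
  \int[mu]_(t in D) ((wt t * expsum n a q (t ^+ 2)) ^+ 2) =
   \sum_(k < n) a k * \sum_(l < n) a l *
     (euler_gamma (nu + 1) / 2 * (q k + q l) `^ (- (nu + 1))).
Proof.
move=> q0.
have e t : (wt t * expsum n a q (t ^+ 2)) ^+ 2 =
  \sum_(k < n) a k * \sum_(l < n) a l * (wt t ^+ 2 * expR (- ((q k + q l) * t ^+ 2))).
  rewrite exprMn expr2 [X in _ * X]expr2 {1}/expsum mulr_suml mulr_sumr.
  apply: eq_bigr => k _; rewrite /expsum mulr_sumr !mulr_sumr.
  apply: eq_bigr => l _; rewrite mulrDl opprD expRD expr2; ring.
have qq k l : 0 < q k + q l by rewrite addr_gt0.
have h1 k := @Rintegral_lincomb _ _ _ mu D mD n a
   (fun l t => wt t ^+ 2 * expR (- ((q k + q l) * t ^+ 2)))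
   (fun l => (gauss_int nu0 (qq k l)).1).
have [h2 h3] := @Rintegral_lincomb _ _ _ mu D mD n a
   (fun k t => \sum_(l < n) a l * (wt t ^+ 2 * expR (- ((q k + q l) * t ^+ 2))))
   (fun k => (h1 k).1).
split.
  by under eq_fun do rewrite e.
under eq_Rintegral do rewrite e.
rewrite h3; apply: eq_bigr => k _; rewrite (h1 k).2; congr (_ * _).
by apply: eq_bigr => l _; rewrite (gauss_int nu0 (qq k l)).2.
Qed.

Lemma hankel0y_expsum n a (x : R) : 0 < x ->
  mu.-integrable D
    (fun t => (bkernel x t * (wt t * expsum n a (fun k => k.+1%:R) (t ^+ 2)))%:E) /\
  hankel0y (expsum n a (fun k => k.+1%:R)) x =
    wt x * expsum n (fun k => amp / 2 * a k * k.+1%:R `^ (- (nu + 1)))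
      (fun k => kap / k.+1%:R) (x ^+ 2).
Proof.
move=> x0.
have e t : bkernel x t * (wt t * expsum n a (fun k => k.+1%:R) (t ^+ 2)) =
  \sum_(k < n) a k * (bkernel x t * (wt t * expR (- (k.+1%:R * t ^+ 2)))).
  rewrite /expsum !mulr_sumr; apply: eq_bigr => k _; ring.
have k0 k : 0 < k.+1%:R :> R by [].
have [h1 h2] := @Rintegral_lincomb _ _ _ mu D mD n a
   (fun k t => bkernel x t * (wt t * expR (- (k.+1%:R * t ^+ 2))))
   (fun k => (hankel_gauss c0 nu0 x0 (k0 k)).1).
split.
  by under eq_fun do rewrite e.
rewrite /hankel0y; under eq_Rintegral do rewrite e.
rewrite h2 /expsum mulr_sumr; apply: eq_bigr => k _.
rewrite (hankel_gauss c0 nu0 x0 (k0 k)).2; ring.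
Qed.

(** The Gram matrices of both sides agree entry by entry: with s = - (nu + 1), (kap/k + kap/l)^s k^s
    l^s = kap^s (k + l)^s. *)
Lemma plancherel_expsum n a :
  mu.-integrable D (fun x => ((hankel0y (expsum n a (fun k => k.+1%:R)) x) ^+ 2)%:E) /\
  c * \int[mu]_(x in D) ((hankel0y (expsum n a (fun k => k.+1%:R)) x) ^+ 2) =
  \int[mu]_(t in D) ((wt t * expsum n a (fun k => k.+1%:R) (t ^+ 2)) ^+ 2).
Proof.
have k0 k : 0 < k.+1%:R :> R by [].
have kk k : 0 < kap / k.+1%:R by rewrite divr_gt0 ?kap_gt0.
have [h1 h2] := expsum_sq n (fun k => amp / 2 * a k * k.+1%:R `^ (- (nu + 1))) kk.
split.
  apply: eq_integrable h1 => // x; rewrite inE DE => x0.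
  by rewrite (hankel0y_expsum n a x0).2.
under eq_Rintegral => x xD.
  rewrite (hankel0y_expsum n a _).2; last by move: xD; rewrite inE DE.
  over.
rewrite h2 (expsum_sq n a k0).2 mulr_sumr; apply: eq_bigr => k _.
rewrite mulr_sumr !mulr_sumr; apply: eq_bigr => l _.
set s := - (nu + 1); set G := euler_gamma _ / 2; set Z := (_ + _) `^ s.
have eZ : Z * (k.+1%:R `^ s * l.+1%:R `^ s) = kap `^ s * (k.+1%:R + l.+1%:R) `^ s.
  have kl0 : 0 <= k.+1%:R + l.+1%:R :> R by [].
  rewrite /Z -!powRM ?kap_ge0 ?mulr_ge0 ?addr_ge0 ?(ltW (kk _))//.
  by congr (_ `^ _); field; rewrite !nat1r ?pnatr_eq0.
have e1 : kap `^ (nu + 1) * kap `^ s = 1.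
  rewrite -powRD ?subrr ?powRr0// (gt_eqF (kap_gt0 c0)).
  by rewrite implybT.
transitivity ((c * (amp / 2) ^+ 2) * (a k * (a l * G)) * (Z * (k.+1%:R `^ s * l.+1%:R `^ s))).
  by ring.
rewrite eZ (amp_kap nu c0) .
transitivity ((kap `^ (nu + 1) * kap `^ s) * (a k * (a l * G)) * (k.+1%:R + l.+1%:R) `^ s).
  by ring.
rewrite e1; ring.
Qed.

(** The factor [expR (- y)] makes the exponents start at 1 instead of 0, so that every [phip p]
    decays, whatever the polynomial. *)
Definition phip (p : {poly R}) (y : R) : R := expR (- y) * p.[expR (- y)].

Lemma phipE p y : phip p y = expsum (size p) (fun k => p`_k) (fun k => k.+1%:R) y.
Proof.
rewrite /phip horner_coef mulr_sumr; apply: eq_bigr => k _.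
rewrite mulrCA; congr (_ * _); rewrite -expRM_natl -expRD; congr expR.
by rewrite -natr1; ring.
Qed.

Lemma phipB p q y : phip (2 *: p - q) y = 2 * phip p y - phip q y.
Proof. by rewrite /phip hornerD hornerN hornerZ mulrBr mulrCA. Qed.

Lemma measurable_phip p : measurable_fun [set: R] (phip p).
Proof.
have -> : phip p = expsum (size p) (fun k => p`_k) (fun k => k.+1%:R).
  by apply/funext => y; exact: phipE.
apply: measurable_sum => k; apply: measurable_funM => //.
by apply: measurableT_comp => //; apply: measurableT_comp => //.
Qed.

(* On exponential sums the transform is explicit.  Exempting y = 1 from the
   convergence admits functions that are cut off at 1. *)
Definition exp_approx (phi : R -> R) (P : nat -> {poly R}) (C : R) :=
  [/\ measurable_fun D phi, forall y : R, 0 < y -> `|phi y| <= C * expR (- y),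
     (forall n (y : R), 0 < y -> `|phip (P n) y| <= C * expR (- y)) &
     (forall y : R, 0 < y -> y != 1 -> phip (P n) y @[n --> \oo] --> phi y)].

(** With n fixed, this makes Bessel's inequality available for 2 phi_n - phi. *)
Lemma exp_approxB phi P C n : exp_approx phi P C ->
  exp_approx (fun y => 2 * phip (P n) y - phi y) (fun m => 2 *: P n - P m) (3 * C).
Proof.
move=> [mphi phiC PC Pphi]; split.
- apply: measurable_funB => //; apply: measurable_funM => //.
  exact: measurable_funTS (measurable_phip _).
- move=> y y0; have h1 := PC n _ y0; have h2 := phiC _ y0.
  have := ler_normB (2 * phip (P n) y) (phi y).
  by rewrite normrM (ger0_norm (_ : 0 <= 2))//; lra.
- move=> m y y0; rewrite phipB.
  have h1 := PC n _ y0; have h2 := PC m _ y0.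
  have := ler_normB (2 * phip (P n) y) (phip (P m) y).
  by rewrite normrM (ger0_norm (_ : 0 <= 2))//; lra.
- move=> y y0 y1; under eq_fun do rewrite phipB.
  by apply: cvgB; [exact: cvg_cst|exact: Pphi].
Qed.

Lemma measurable_sqr_comp (phi : R -> R) : measurable_fun D phi ->
  measurable_fun D (fun t => phi (t ^+ 2)).
Proof.
move=> mphi; apply: (@measurable_comp _ _ _ _ _ _ D phi D (fun t => t ^+ 2)) => //.
by move=> _ [t + <-]; rewrite !DE => t0; rewrite exprn_gt0.
Qed.

Lemma sqr_neq1 (t : R) : D t -> ~ [set 1] t -> t ^+ 2 != 1.
Proof.
rewrite DE => t0 /= t1; apply/eqP => h; apply: t1.
by apply/eqP; rewrite -(@eqrXn2 _ 2) ?h ?expr1n// ltW.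
Qed.

Section Approx.
Variables (phi : R -> R) (P : nat -> {poly R}) (C : R).
Hypothesis aphi : exp_approx phi P C.

(** For fixed x the case p = 1 of [hankel_gauss] supplies the majorant. The exempted value y = 1
    corresponds to the single point t = 1. *)
Lemma hankel0y_cvg (x : R) : 0 < x ->
  mu.-integrable D (fun t => (bkernel x t * (wt t * phi (t ^+ 2)))%:E) /\
  hankel0y (phip (P n)) x @[n --> \oo] --> hankel0y phi x.
Proof.
case: aphi => mphi phiC PC Pphi x0.
have mk := measurable_bkernel c0 nu0 x0.
have mw : measurable_fun D wt by exact: measurable_funTS (measurable_wt nu).
apply: (@Rdominated_cvg _ _ _ mu D mD [set 1] (fun n t => bkernel x t * (wt t * phip (P n) (t ^+ 2)))
  (fun t => bkernel x t * (wt t * phi (t ^+ 2)))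
  (fun t => C * `|bkernel x t * (wt t * expR (- (1 * t ^+ 2)))|)).
- exact: measurable_set1.
- exact: lebesgue_measure_set1.
- move=> n; apply: measurable_funM => //; apply: measurable_funM => //.
  by apply: measurable_sqr_comp; exact: measurable_funTS (measurable_phip _).
- apply: measurable_funM => //; apply: measurable_funM => //.
  exact: measurable_sqr_comp.
- move=> t Dt Nt; have t1 := sqr_neq1 Dt Nt; move: Dt; rewrite DE => t0.
  apply: cvgM; first exact: cvg_cst.
  apply: cvgM; first exact: cvg_cst.
  by apply: Pphi => //; rewrite exprn_gt0.
- have h := (hankel_gauss c0 nu0 x0 ltr01).1.
  by have := integrableZl mD C (integrable_norm h).
- move=> n t; rewrite DE => t0.
  rewrite mul1r; set k := bkernel x t; set u := wt t.
  rewrite (normrM k) (normrM u) (normrM k) (normrM u) (ger0_norm (expR_ge0 _)).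
  rewrite (_ : C * _ = `|k| * (`|u| * (C * expR (- t ^+ 2)))); last by ring.
  do 2 (apply: ler_wpM2l => //).
  by apply: PC; rewrite exprn_gt0.
Qed.

Lemma sq_norm_cvg :
  [/\ mu.-integrable D (fun t => ((wt t * phi (t ^+ 2)) ^+ 2)%:E),
  \int[mu]_(t in D) ((wt t * phip (P n) (t ^+ 2)) ^+ 2) @[n --> \oo] -->
  \int[mu]_(t in D) ((wt t * phi (t ^+ 2)) ^+ 2) &
  \int[mu]_(t in D) ((wt t * (2 * phip (P n) (t ^+ 2) - phi (t ^+ 2))) ^+ 2)
    @[n --> \oo] --> \int[mu]_(t in D) ((wt t * phi (t ^+ 2)) ^+ 2)].
Proof.
case: aphi => mphi phiC PC Pphi.
have mw : measurable_fun D wt by exact: measurable_funTS (measurable_wt nu).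
have mphi2 := measurable_sqr_comp mphi.
have mp n : measurable_fun D (fun t => phip (P n) (t ^+ 2)).
  by apply: measurable_sqr_comp; exact: measurable_funTS (measurable_phip _).
have [ig _] := gauss_int nu0 (ltr0n R 2).
pose g K (t : R) := K ^+ 2 * (wt t ^+ 2 * expR (- (2 * t ^+ 2))).
have igK K : mu.-integrable D (EFin \o g K).
  by have := integrableZl mD (K ^+ 2) ig.
have gE K t : g K t = (wt t * (K * expR (- t ^+ 2))) ^+ 2.
  rewrite /g exprMn exprMn (_ : - (2 * t ^+ 2) = - t ^+ 2 + - t ^+ 2); last by ring.
  rewrite expRD; ring.
have C0 : 0 <= C.
  by have := le_trans (normr_ge0 _) (phiC 1 ltr01); rewrite pmulr_lge0 ?expR_gt0.
have bound K (r t : R) : 0 <= K -> `|r| <= K * expR (- t ^+ 2) -> `|(wt t * r) ^+ 2| <= g K t.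
  move=> K0 h; rewrite gE normrX ler_pXn2r ?nnegrE// ?mulr_ge0 ?powR_ge0 ?expR_ge0//.
  by rewrite normrM (ger0_norm (powR_ge0 _ _)) ler_wpM2l ?powR_ge0.
have [h1 h2] : mu.-integrable D (fun t => ((wt t * phi (t ^+ 2)) ^+ 2)%:E) /\
  \int[mu]_(t in D) ((wt t * phip (P n) (t ^+ 2)) ^+ 2) @[n --> \oo] -->
  \int[mu]_(t in D) ((wt t * phi (t ^+ 2)) ^+ 2).
  apply: (@Rdominated_cvg _ _ _ mu D mD [set 1] (fun n t => (wt t * phip (P n) (t ^+ 2)) ^+ 2)
    (fun t => (wt t * phi (t ^+ 2)) ^+ 2) (g C)) => //.
  - exact: lebesgue_measure_set1.
  - by move=> n; apply: measurable_funX; exact: measurable_funM.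
  - by apply: measurable_funX; exact: measurable_funM.
  - move=> t Dt Nt; have t1 := sqr_neq1 Dt Nt; move: Dt; rewrite DE => t0.
    apply: cvg_sqr; apply: cvgM; first exact: cvg_cst.
    by apply: Pphi => //; rewrite exprn_gt0.
  - move=> n t; rewrite DE => t0; apply: bound => //.
    by apply: PC; rewrite exprn_gt0.
split => //.
suff [] : mu.-integrable D (fun t => ((wt t * phi (t ^+ 2)) ^+ 2)%:E) /\
  \int[mu]_(t in D) ((wt t * (2 * phip (P n) (t ^+ 2) - phi (t ^+ 2))) ^+ 2)
    @[n --> \oo] --> \int[mu]_(t in D) ((wt t * phi (t ^+ 2)) ^+ 2) by [].
apply: (@Rdominated_cvg _ _ _ mu D mD [set 1]
    (fun n t => (wt t * (2 * phip (P n) (t ^+ 2) - phi (t ^+ 2))) ^+ 2)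
    (fun t => (wt t * phi (t ^+ 2)) ^+ 2) (g (3 * C))) => //.
- exact: lebesgue_measure_set1.
- move=> n; apply: measurable_funX; apply: measurable_funM => //.
  by apply: measurable_funB => //; exact: measurable_funM.
- by apply: measurable_funX; exact: measurable_funM.
- move=> t Dt Nt; have t1 := sqr_neq1 Dt Nt; move: Dt; rewrite DE => t0.
  apply: cvg_sqr; apply: cvgM; first exact: cvg_cst.
  have t20 : 0 < t ^+ 2 by rewrite exprn_gt0.
  rewrite [X in _ --> X](_ : _ = 2 * phi (t ^+ 2) - phi (t ^+ 2)); last by ring.
  apply: cvgB; last exact: cvg_cst.
  by apply: cvgM; [exact: cvg_cst|exact: Pphi].
- move=> n t; rewrite DE => t0; apply: bound; first by rewrite mulr_ge0.
  have t20 : 0 < t ^+ 2 by rewrite exprn_gt0.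
  have h3 := PC n _ t20; have h4 := phiC _ t20.
  have := ler_normB (2 * phip (P n) (t ^+ 2)) (phi (t ^+ 2)).
  by rewrite normrM (ger0_norm (_ : 0 <= 2))//; lra.
Qed.

Let hphip n (x : R) : 0 < x -> hankel0y (phip (P n)) x =
  wt x * expsum (size (P n)) (fun k => amp / 2 * (P n)`_k * k.+1%:R `^ (- (nu + 1)))
      (fun k => kap / k.+1%:R) (x ^+ 2).
Proof.
move=> x0; rewrite -(hankel0y_expsum _ _ x0).2.
by congr hankel0y; apply/funext => y; exact: phipE.
Qed.

Lemma measurable_hankel0y_phip n : measurable_fun D (hankel0y (phip (P n))).
Proof.
apply: (eq_measurable_fun (fun x => wt x * expsum (size (P n))
   (fun k => amp / 2 * (P n)`_k * k.+1%:R `^ (- (nu + 1)))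
      (fun k => kap / k.+1%:R) (x ^+ 2))).
  by move=> x; rewrite inE DE => x0; rewrite hphip.
have mm : measurable_fun [set: R] (fun x => wt x * expsum (size (P n))
   (fun k => amp / 2 * (P n)`_k * k.+1%:R `^ (- (nu + 1)))
      (fun k => kap / k.+1%:R) (x ^+ 2)).
  apply: measurable_funM; first exact: measurable_wt.
  apply: measurable_sum => k; apply: measurable_funM => //.
  exact: measurable_gauss.
exact: measurable_funTS mm.
Qed.

Lemma measurable_hankel0y : measurable_fun D (hankel0y phi).
Proof.
apply/measurable_EFinP.
apply: (emeasurable_fun_cvg (fun n x => (hankel0y (phip (P n)) x)%:E)).
  by move=> n; apply/measurable_EFinP; exact: measurable_hankel0y_phip.
move=> x; rewrite DE => x0.
by apply: cvg_EFin; [exact: nearW|exact: (hankel0y_cvg x0).2].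
Qed.

Lemma plancherel_phip n :
  mu.-integrable D (fun x => ((hankel0y (phip (P n)) x) ^+ 2)%:E) /\
  c * \int[mu]_(x in D) ((hankel0y (phip (P n)) x) ^+ 2) =
  \int[mu]_(t in D) ((wt t * phip (P n) (t ^+ 2)) ^+ 2).
Proof.
have := plancherel_expsum (size (P n)) (fun k => (P n)`_k).
rewrite (_ : expsum _ _ _ = phip (P n))//.
by apply/funext => y; rewrite phipE.
Qed.

(** The transforms converge pointwise, with no square-integrable majorant in x at hand, so Fatou's
    lemma lets only an inequality pass to the limit. *)
Lemma hankel0y_bessel :
  mu.-integrable D (fun x => ((hankel0y phi x) ^+ 2)%:E) /\
  c * \int[mu]_(x in D) ((hankel0y phi x) ^+ 2) <=
  \int[mu]_(t in D) ((wt t * phi (t ^+ 2)) ^+ 2).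
Proof.
have [iphi cphi _] := sq_norm_cvg.
have mh := measurable_hankel0y.
have key : (\int[mu]_(x in D) ((hankel0y phi x) ^+ 2)%:E <=
   (c^-1 * \int[mu]_(t in D) ((wt t * phi (t ^+ 2)) ^+ 2))%:E)%E.
  apply: (@fatou_le _ _ _ mu D mD (fun n x => ((hankel0y (phip (P n)) x) ^+ 2)%:E) _
    (fun n => (c^-1 * \int[mu]_(t in D) ((wt t * phip (P n) (t ^+ 2)) ^+ 2))%:E)).
  - move=> n; apply/measurable_EFinP; apply: measurable_funX.
    exact: measurable_hankel0y_phip.
  - by move=> n x _; rewrite lee_fin sqr_ge0.
  - move=> x; rewrite DE => x0; apply: cvg_EFin; first exact: nearW.
    by apply: cvg_sqr; exact: (hankel0y_cvg x0).2.
  - move=> n; have [h1 h2] := plancherel_phip n.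
    rewrite -h2 mulrA mulVf ?gt_eqF// mul1r /Rintegral fineK//.
    exact: integrable_fin_num.
  - apply: cvg_EFin; first exact: nearW.
    by apply: cvgM; first exact: cvg_cst.
have ih : mu.-integrable D (fun x => ((hankel0y phi x) ^+ 2)%:E).
  apply/integrableP; split.
    by apply/measurable_EFinP; exact: measurable_funX.
  under eq_integral do rewrite gee0_abs ?lee_fin ?sqr_ge0//.
  by apply: le_lt_trans key _; rewrite ltry.
split => //.
rewrite -ler_pdivlMl// -lee_fin /Rintegral fineK//.
exact: integrable_fin_num.
Qed.

End Approx.

(* With F the transform and phi_n = phip (P n), the parallelogram identity gives
   2 (F phi_n)^2 <= (F phi)^2 + (F (2 phi_n - phi))^2; the integral of the left
   side is known exactly and that of the last term is bounded by Bessel. *)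
Lemma hankel0y_plancherel_ge phi P C : exp_approx phi P C ->
  \int[mu]_(t in D) ((wt t * phi (t ^+ 2)) ^+ 2) <=
  c * \int[mu]_(x in D) ((hankel0y phi x) ^+ 2).
Proof.
move=> aphi.
have [iphi c1 c2] := sq_norm_cvg aphi.
have [ih hb] := hankel0y_bessel aphi.
(* The left side is exact for every n, and both integrals tend to the squared norm of phi, so the
   limit is 2 - 1 = 1 times it. *)
have c3 : 2 * \int[mu]_(t in D) ((wt t * phip (P n) (t ^+ 2)) ^+ 2) -
   \int[mu]_(t in D) ((wt t * (2 * phip (P n) (t ^+ 2) - phi (t ^+ 2))) ^+ 2)
   @[n --> \oo] --> \int[mu]_(t in D) ((wt t * phi (t ^+ 2)) ^+ 2).
  rewrite [X in _ --> X](_ : _ = 2 * \int[mu]_(t in D) ((wt t * phi (t ^+ 2)) ^+ 2) -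
     \int[mu]_(t in D) ((wt t * phi (t ^+ 2)) ^+ 2)); last by ring.
  by apply: cvgB => //; apply: cvgM => //; exact: cvg_cst.
apply: (ler_cvg_to c3 (cvg_cst _)); apply: nearW => n.
have aB := exp_approxB n aphi.
have [iB hB] := hankel0y_bessel aB.
have [iP hP] := plancherel_phip P n.
set phiB := (fun y => 2 * _ - _) in aB iB hB.
rewrite lerBlDr -hP.
apply: le_trans (lerD (lexx _) hB).
rewrite mulrCA -mulrDr ler_pM2l// -RintegralZl// -RintegralD//.
apply: le_Rintegral => //.
- exact: (integrableZl mD 2 iP).
- exact: (integrableD mD ih iB).
- move=> x; rewrite DE => x0.
  have [i1 _] := hankel0y_cvg aphi x0.
  have [i2 _] := hankel0y_cvg aB x0.
  have e : hankel0y phi x + hankel0y phiB x = 2 * hankel0y (phip (P n)) x.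
    rewrite /hankel0y -RintegralD// -RintegralZl//.
      by apply: eq_Rintegral => t _; rewrite /phiB; ring.
    have := (hankel0y_expsum (size (P n)) (fun k => (P n)`_k) x0).1.
    by apply: eq_integrable => // t _; rewrite /= phipE.
  have := sqr_ge0 (hankel0y phi x - hankel0y phiB x).
  have -> : hankel0y phiB x = 2 * hankel0y (phip (P n)) x - hankel0y phi x by rewrite -e; ring.
  nra.
Qed.

End Plancherel.

(** * Sonine's formula *)

Section Sonine.
Context {R : realType}.
Notation mu := (@lebesgue_measure R).
Variables (c nu nu' : R).
Hypothesis (c0 : 0 < c) (nu0 : - (1 / 2) < nu') (nunu : nu' < nu).
Let D : set (measurableTypeR R) := `]0%R, +oo[%classic.
Let mD : measurable D := @mD R.
Hint Resolve mD : core.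
Let DE (x : R) : D x = (0 < x) :> Prop.
Proof. exact: in_itv0y. Qed.
Let d := nu - nu'.
Let d0 : 0 < d.
Proof. by rewrite subr_gt0. Qed.
Let nu1 : - (1 / 2) < nu.
Proof. exact: lt_trans nunu. Qed.

Definition weyl (phi : R -> R) (v : R) : R :=
  (euler_gamma d)^-1 * \int[mu]_(z in D) (z `^ (d - 1) * phi (v + z)).

(* The Weyl integral multiplies expR (- p v) by p `^ (- d). *)
Definition weylp (p : {poly R}) : {poly R} :=
  \poly_(k < size p) (p`_k * k.+1%:R `^ (- d)).

Lemma gamma_exp (p : R) : 0 < p ->
  mu.-integrable D (fun z => (z `^ (d - 1) * expR (- (p * z)))%:E) /\
  \int[mu]_(z in D) (z `^ (d - 1) * expR (- (p * z))) = euler_gamma d * p `^ (- d).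
Proof.
move=> p0; have h := ge0_integral_powR_exp 0 p0 d0; rewrite mul1r divr1 in h.
have mm : measurable_fun [set: R] (fun z : R => z `^ (d - 1) * expR (- (p * z))).
  apply: measurable_powR_expR; apply: measurableT_comp => //.
split; last by rewrite /Rintegral h.
apply/integrableP; split; first by apply/measurable_EFinP; exact: measurable_funTS mm.
under eq_integral do rewrite gee0_abs ?lee_fin ?mulr_ge0 ?powR_ge0 ?expR_ge0//.
by rewrite h ltry.
Qed.

Lemma phip_weylp p y : phip (weylp p) y =
  expsum (size p) (fun k => p`_k * k.+1%:R `^ (- d)) (fun k => k.+1%:R) y.
Proof.
rewrite /phip /weylp horner_poly mulr_sumr; apply: eq_bigr => k _.
rewrite mulrCA; congr (_ * _); rewrite -expRM_natl -expRD; congr expR.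
by rewrite -natr1; ring.
Qed.

Lemma weyl_phip p v : weyl (phip p) v = phip (weylp p) v.
Proof.
have k0 k : 0 < k.+1%:R :> R by [].
have e z : z `^ (d - 1) * phip p (v + z) = \sum_(k < size p)
   (p`_k * expR (- (k.+1%:R * v))) * (z `^ (d - 1) * expR (- (k.+1%:R * z))).
  rewrite phipE /expsum mulr_sumr; apply: eq_bigr => k _.
  rewrite mulrDr opprD expRD; ring.
have [_ h] := @Rintegral_lincomb _ _ _ mu D mD (size p)
   (fun k => p`_k * expR (- (k.+1%:R * v)))
   (fun k z => z `^ (d - 1) * expR (- (k.+1%:R * z))) (fun k => (gamma_exp (k0 k)).1).
rewrite /weyl; under eq_Rintegral do rewrite e.
rewrite h phip_weylp /expsum mulr_sumr; apply: eq_bigr => k _.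
rewrite (gamma_exp (k0 k)).2.
by have := euler_gamma_gt0 d0 => g0; field; rewrite gt_eqF.
Qed.

(** Both transforms are explicit exponential sums in x^2 with the same rates. Writing nu = nu' + d
    splits off x^d from [wt], (c/2)^d from [amp], and from k^(-(nu+1)) the factor k^(- d) that the
    Weyl integral provides. *)
Lemma sonine_phip p (x : R) : 0 < x ->
  hankel0y c nu (phip p) x = (c / 2 * x) `^ d * hankel0y c nu' (phip (weylp p)) x.
Proof.
move=> x0.
have c20 : 0 < c / 2 by rewrite divr_gt0.
have -> : phip p = expsum (size p) (fun k => p`_k) (fun k => k.+1%:R).
  by apply/funext => y; exact: phipE.
have -> : phip (weylp p) = expsum (size p) (fun k => p`_k * k.+1%:R `^ (- d)) (fun k => k.+1%:R).
  by apply/funext => y; exact: phip_weylp.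
rewrite (hankel0y_expsum c0 nu1 _ _ x0).2 (hankel0y_expsum c0 nu0 _ _ x0).2.
rewrite /expsum !mulr_sumr; apply: eq_bigr => k _.
have nuE : nu = nu' + d by rewrite /d; ring.
have -> : wt nu x = wt nu' x * x `^ d.
  rewrite /wt -powRD; last by rewrite (gt_eqF x0) implybT.
  by congr (_ `^ _); rewrite nuE; ring.
have -> : amp c nu = amp c nu' * (c / 2) `^ d.
  by rewrite /amp nuE -mulrA -powRD// (gt_eqF c20) implybT.
have -> : k.+1%:R `^ (- (nu + 1)) = k.+1%:R `^ (- d) * k.+1%:R `^ (- (nu' + 1)) :> R.
  rewrite -powRD; last by rewrite pnatr_eq0 implybT.
  by congr (_ `^ _); rewrite nuE; ring.
rewrite (powRM _ (ltW c20) (ltW x0)); ring.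
Qed.

Section Approx.
Variables (phi : R -> R) (P : nat -> {poly R}) (C : R).
Hypothesis aphi : exp_approx phi P C.

Lemma measurable_shift v : 0 < v -> measurable_fun D (fun z => phi (v + z)).
Proof.
case: aphi => mphi _ _ _ v0.
apply: (@measurable_comp _ _ _ _ _ _ D phi D (fun z => v + z)) => //.
  by move=> _ [t + <-]; rewrite !DE => t0; rewrite addr_gt0.
have mm : measurable_fun [set: R] (fun z : R => v + z) by exact: measurable_funD.
exact: measurable_funTS mm.
Qed.

Lemma weyl_cvg v : 0 < v ->
  mu.-integrable D (fun z => (z `^ (d - 1) * phi (v + z))%:E) /\
  weyl (phip (P n)) v @[n --> \oo] --> weyl phi v.
Proof.
move=> v0; have ms := measurable_shift v0; case: aphi => mphi phiC PC Pphi.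
have mw : measurable_fun D (fun z : R => z `^ (d - 1)).
  exact: measurable_funTS (measurable_powR _).
suff [h1 h2] : mu.-integrable D (fun z => (z `^ (d - 1) * phi (v + z))%:E) /\
  \int[mu]_(z in D) (z `^ (d - 1) * phip (P n) (v + z)) @[n --> \oo] -->
  \int[mu]_(z in D) (z `^ (d - 1) * phi (v + z)).
  by split => //; apply: cvgM; first exact: cvg_cst.
apply: (@Rdominated_cvg _ _ _ mu D mD [set 1 - v]
  (fun n z => z `^ (d - 1) * phip (P n) (v + z)) (fun z => z `^ (d - 1) * phi (v + z))
  (fun z => (C * expR (- v)) * (z `^ (d - 1) * expR (- (1 * z))))).
- exact: measurable_set1.
- exact: lebesgue_measure_set1.
- move=> n; apply: measurable_funM => //.
  have mm : measurable_fun [set: R] (fun z => phip (P n) (v + z)).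
    apply: measurableT_comp; first exact: measurable_phip.
    exact: measurable_funD.
  exact: measurable_funTS mm.
- exact: measurable_funM.
- move=> z; rewrite DE /= => z0 zv; apply: cvgM; first exact: cvg_cst.
  apply: Pphi; first by rewrite addr_gt0.
  by apply/eqP => h; apply: zv; rewrite -h addrAC subrr add0r.
- by have := integrableZl mD (C * expR (- v)) (gamma_exp ltr01).1.
- move=> n z; rewrite DE => z0; rewrite normrM (ger0_norm (powR_ge0 _ _)).
  rewrite mulrCA ler_wpM2l ?powR_ge0// -mulrA -expRD.
  have := PC n (v + z); rewrite addr_gt0// => /(_ isT).
  by rewrite mul1r opprD.
Qed.

(** The constant C is preserved because the Weyl integral fixes [expR (- y)]: its multiplier p^(- d)
    is 1 at p = 1. *)
Lemma weyl_phip_le n v : 0 < v -> `|phip (weylp (P n)) v| <= C * expR (- v).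
Proof.
move=> v0; case: aphi => mphi phiC PC Pphi.
rewrite -weyl_phip /weyl normrM gtr0_norm; last by rewrite invr_gt0 euler_gamma_gt0.
rewrite ler_pdivrMl ?euler_gamma_gt0//.
have mm : measurable_fun [set: R] (fun z => z `^ (d - 1) * phip (P n) (v + z)).
  apply: measurable_funM; first exact: measurable_powR.
  apply: measurableT_comp; first exact: measurable_phip.
  exact: measurable_funD.
have [i1 e1] := gamma_exp ltr01.
have i2 : mu.-integrable D (EFin \o (fun z => (C * expR (- v)) * (z `^ (d - 1) * expR (- (1 * z))))).
  by have := integrableZl mD (C * expR (- v)) i1.
have b z : D z -> `|z `^ (d - 1) * phip (P n) (v + z)| <=
   (C * expR (- v)) * (z `^ (d - 1) * expR (- (1 * z))).
  rewrite DE => z0; rewrite normrM (ger0_norm (powR_ge0 _ _)).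
  rewrite mulrCA ler_wpM2l ?powR_ge0// -mulrA -expRD.
  have := PC n (v + z); rewrite addr_gt0// => /(_ isT).
  by rewrite mul1r opprD.
have i3 : mu.-integrable D (EFin \o (fun z => z `^ (d - 1) * phip (P n) (v + z))).
  apply: le_integrable i2 => //.
    by apply/measurable_EFinP; exact: measurable_funTS mm.
  by move=> z Dz; rewrite /= lee_fin (le_trans (b _ Dz))// ler_norm.
apply: le_trans (le_normr_Rintegral mD i3) _.
apply: le_trans (le_Rintegral mD (integrable_norm i3) i2 b) _.
by rewrite RintegralZl// e1 powR1 mulr1 mulrC.
Qed.

Lemma exp_approx_weyl : exp_approx (weyl phi) (weylp \o P) C.
Proof.
have cv v : 0 < v -> phip (weylp (P n)) v @[n --> \oo] --> weyl phi v.
  move=> v0; have [_ h] := weyl_cvg v0.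
  by apply: eq_cvgr h => n; rewrite weyl_phip.
split.
- apply/measurable_EFinP.
  apply: (emeasurable_fun_cvg (fun n x => (phip (weylp (P n)) x)%:E)).
    by move=> n; apply/measurable_EFinP; exact: measurable_funTS (measurable_phip _).
  move=> v Dv; have v0 : 0 < v by rewrite -DE.
  by apply: cvg_EFin; [exact: nearW|exact: cv].
- move=> v v0; have h : `|phip (weylp (P n)) v| @[n --> \oo] --> `|weyl phi v|.
    by apply: cvg_norm; exact: cv.
  have h2 : (fun=> C * expR (- v)) @ \oo --> C * expR (- v) by exact: cvg_cst.
  by apply: (ler_cvg_to h h2); apply: nearW => n; exact: weyl_phip_le.
- by move=> n v; exact: weyl_phip_le.
(* Integration removes the exceptional point: convergence holds at v = 1 as well. *)
- by move=> v v0 _; exact: cv.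
Qed.

Lemma sonine (x : R) : 0 < x ->
  hankel0y c nu phi x = (c / 2 * x) `^ d * hankel0y c nu' (weyl phi) x.
Proof.
move=> x0.
have [_ h1] := hankel0y_cvg c0 nu1 aphi x0.
have [_ h2] := hankel0y_cvg c0 nu0 exp_approx_weyl x0.
have h3 : (c / 2 * x) `^ d * hankel0y c nu' (phip (weylp (P n))) x @[n --> \oo] -->
    (c / 2 * x) `^ d * hankel0y c nu' (weyl phi) x.
  by apply: cvgM; first exact: cvg_cst.
suff h4 : hankel0y c nu (phip (P n)) x @[n --> \oo] -->
    (c / 2 * x) `^ d * hankel0y c nu' (weyl phi) x by exact: cvg_unique h1 h4.
by apply: eq_cvgr h3 => n; rewrite sonine_phip.
Qed.

End Approx.

End Sonine.

(** * Approximation of functions cut off at 1 by exponential sums *)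

Section CompactSupport.
Context {R : realType}.
Let D : set (measurableTypeR R) := `]0%R, +oo[%classic.

(** In the variable s = exp (- y) the support 0 < y < 1 becomes exp (-1) < s < 1. Dividing by s
    compensates the factor [expR (- y)] of [phip] and stays bounded there. The Bernstein polynomials
    of F inherit its bound, and they converge wherever F is continuous, hence at every y > 0 except
    the possible jump at 1. *)
Lemma exp_approx_compact (phi : R -> R) (C : R) : measurable_fun D phi ->
  (forall y, 0 < y < 1 -> `|phi y| <= C) -> (forall y, 1 <= y -> phi y = 0) ->
  (forall y, 0 < y < 1 -> {for y, continuous phi}) ->
  exists P K, exp_approx phi P K.
Proof.
move=> mphi phiC phi0 cphi.
have C0 : 0 <= C.
  have h : 0 < (2^-1 : R) < 1 by apply/andP; split; lra.
  exact: le_trans (normr_ge0 _) (phiC _ h).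
pose F (s : R) := if expR (-1) < s < 1 then s^-1 * phi (- ln s) else 0.
have FC s : `|F s| <= expR 1 * C.
  rewrite /F; case: ifPn => [/andP[s1 s2]|_]; last by rewrite normr0 mulr_ge0 ?expR_ge0.
  have s0 : 0 < s by rewrite (lt_trans _ s1)// expR_gt0.
  rewrite normrM ler_pM//.
    rewrite gtr0_norm ?invr_gt0// -[leRHS]invrK -expRN lef_pV2 ?posrE ?expR_gt0//.
    exact: ltW.
  apply: phiC; rewrite oppr_gt0 ltrNl ln_lt0 ?s0//=.
  by rewrite -[ltLHS]expRK ltr_ln ?posrE ?expR_gt0.
exists (fun n => bernstein n (fun k => F (k%:R / n%:R))), (expR 1 * C); split => //.
- move=> y y0; have [y1|y1] := ltP y 1; last first.
    by rewrite phi0// normr0 !mulr_ge0 ?expR_ge0.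
  rewrite mulrAC -expRD; apply: (@le_trans _ _ C); first by rewrite phiC// y0.
  by rewrite ler_peMl// -[leLHS]expR0 ler_expR; lra.
- move=> n y y0; rewrite /phip normrM (ger0_norm (expR_ge0 _)) mulrC ler_wpM2r ?expR_ge0//.
  apply: bernstein_le => //; rewrite expR_ge0/= -[leRHS]expR0 ler_expR.
  by rewrite oppr_le0 ltW.
- move=> y y0 y1.
  have s01 : 0 <= expR (- y) <= 1.
    by rewrite expR_ge0/= -[leRHS]expR0 ler_expR oppr_le0 ltW.
  have phiE : phi y = expR (- y) * F (expR (- y)).
    have e1 : expR (- y) < 1 by rewrite -[ltRHS]expR0 ltr_expR oppr_lt0.
    rewrite /F e1 andbT ltr_expR ltrN2 expRK opprK.
    case: ifPn => [_|]; first by rewrite mulrA mulfV ?mul1r// gt_eqF// expR_gt0.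
    by rewrite -leNgt mulr0 => h; exact: phi0.
  rewrite phiE; apply: cvgM; first exact: cvg_cst.
  apply: (bernstein_cvg s01 FC).
  have [y1'|y1'] := ltP y 1.
    pose G (s : R) := s^-1 * phi (- ln s).
    have s0 : 0 < expR (- y) by exact: expR_gt0.
    have cG : {for expR (- y), continuous G}.
      apply: continuousM; first by apply: continuousV => //; rewrite gt_eqF.
      apply: continuous_comp.
        apply: continuous_comp; first exact: continuous_ln.
        exact: continuousN.
      by rewrite expRK opprK; apply: cphi; rewrite y0.
    have nG : \forall s \near expR (- y), F s = G s.
      near=> s; rewrite /F ifT//; apply/andP; split.
        near: s; apply: lt_nbhsr; rewrite ltr_expR ltrN2//.
      near: s; apply: lt_nbhsl; by rewrite -[ltRHS]expR0 ltr_expR oppr_lt0.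
    suff : F s @[s --> expR (- y)] --> F (expR (- y)) by [].
    rewrite (nbhs_singleton nG); apply: cvg_trans cG; apply: near_eq_cvg.
    by apply: filterS nG => s ->.
  have {}y1 : 1 < y by rewrite lt_neqAle eq_sym y1.
  have nG : \forall s \near expR (- y), F s = 0.
    near=> s; rewrite /F ifF//; apply/negP => /andP[+ _]; apply/negP; rewrite -leNgt ltW//.
    near: s; apply: lt_nbhsl; by rewrite ltr_expR ltrN2.
  suff : F s @[s --> expR (- y)] --> F (expR (- y)) by [].
  have h : (fun=> 0 : R) s @[s --> expR (- y)] --> (0 : R) by exact: cvg_cst.
  rewrite (nbhs_singleton nG); apply: cvg_trans h; apply: near_eq_cvg.
  by apply: filterS nG => s ->.
Unshelve. all: by end_near. Qed.

End CompactSupport.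

(** * Nuclear operators on L^2 *)

Lemma increasing_seq_ge (f : nat -> nat) : increasing_seq f -> forall j, (j <= f j)%N.
Proof.
move=> fi; elim=> // j IH; apply: leq_ltn_trans IH _.
by rewrite ltnNge -[X in ~~ X]/(f j.+1 <= f j)%O fi -[X in ~~ X]/(j.+1 <= j)%N ltnn.
Qed.

Lemma cvg_sum0 {R : realType} (f : nat -> nat -> R) n :
  (forall m, f m j @[j --> \oo] --> (0 : R)) ->
  \sum_(0 <= m < n) f m j @[j --> \oo] --> (0 : R).
Proof.
move=> f0; elim: n => [|n IH].
  by under eq_fun do rewrite big_geq//; exact: cvg_cst.
have h : (fun j => \sum_(0 <= m < n) f m j + f n j) @ \oo --> (0 + 0 : R) by exact: cvgD.
by rewrite addr0 in h; apply: eq_cvgr h => j; rewrite big_nat_recr.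
Qed.

Lemma diagonal_subsequence {R : realType} (b : nat -> nat -> R) (M : R) :
  (forall m k, `|b m k| <= M) ->
  exists s : nat -> nat, (forall j, (j <= s j)%N) /\
    forall m, exists l : R, b m (s j) @[j --> \oo] --> l.
Proof.
move=> bM.
have /choice[F FP] : forall u : nat -> R, exists f : nat -> nat,
    (forall k, `|u k| <= M) -> increasing_seq f /\ cvgn (u \o f).
  move=> u; have [uM|uM] := pselect (forall k, `|u k| <= M); last first.
    by exists id => /uM.
  have [|f fi fc] := @bolzano_weierstrass R u.
    by exists M; split; [exact: num_real|move=> x Mx k _ /=; rewrite (le_trans (uM k))// ltW].
  by exists f.
pose sig := fix sig (m : nat) : nat -> nat :=
  if m is m'.+1 then sig m' \o F (b m' \o sig m') else id.
have Fi m : increasing_seq (F (b m \o sig m)).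
  by apply: (FP _ _).1 => k; exact: bM.
have Fc m : cvgn (b m \o sig m.+1).
  by have := (FP (b m \o sig m) (fun k => bM m _)).2.
(* Past rank m the diagonal is read off [sig m] at an index i >= j, so convergence along [sig m]
   carries over to it. *)
have sigE k m j : exists2 i, (j <= i)%N & sig (k + m)%N j = sig m i.
  elim: k j => [|k IH] j; first by exists j.
  have [i ji ei] := IH (F (b (k + m)%N \o sig (k + m)%N) j).
  exists i; last by rewrite -ei.
  by apply: leq_trans ji; exact: increasing_seq_ge.
exists (fun j => sig j j); split.
  by move=> j; have [i ji] := sigE j 0%N j; rewrite addn0 => ->.
move=> m; have /cvg_ex[l /= hl] := Fc m; exists l.
apply/cvgrPdist_le => e e0.
move/cvgrPdist_le : hl => /(_ _ e0)[N _ hN].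
exists (maxn N m.+1) => // j /=; rewrite geq_max => /andP[Nj mj].
have [i ji] := sigE (j - m.+1)%N m.+1 j.
rewrite subnK// => ->; apply: hN => /=.
exact: leq_trans ji.
Qed.

(** * Square-integrable functions on a probability space *)

Section L2.
Context d (T : measurableType d) (R : realType) (mu : {measure set T -> \bar R}).
Hypothesis mu1 : mu setT = 1%E.
Implicit Types f g : T -> R.

Definition L2 f : Prop := f \in Lfun mu 2%:E.
Definition ip f g : R := \int[mu]_x (f x * g x).

Lemma L2_measurable f : L2 f -> measurable_fun setT f.
Proof. by rewrite /L2 inE => /andP[]; rewrite inE. Qed.

Lemma L2I f : measurable_fun setT f ->
  mu.-integrable setT (fun x => (f x ^+ 2)%:E) -> L2 f.
Proof.
move=> mf if2; rewrite /L2 inE; apply/andP; split; rewrite inE//=.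
rewrite /finite_norm unlock poweR_lty//.
under eq_integral do rewrite /= powR_mulrn ?normr_ge0// real_normK ?num_real//.
exact: integrable_lty.
Qed.

Lemma integrable_ip f g : L2 f -> L2 g -> mu.-integrable setT (fun x => (f x * g x)%:E).
Proof. by move=> Lf Lg; have /Lfun1_integrable := Lfun2_mul_Lfun1 Lf Lg. Qed.

Lemma integrable_bounded f (K : R) : measurable_fun setT f -> (forall x, `|f x| <= K) ->
  mu.-integrable setT (EFin \o f).
Proof.
move=> mf fK; apply: measurable_bounded_integrable => //.
  by rewrite mu1 ltry.
exists K; split; first exact: num_real.
by move=> x Kx y _ /=; rewrite (le_trans (fK y))// ltW.
Qed.

Lemma L2_bounded f (K : R) : measurable_fun setT f -> (forall x, `|f x| <= K) -> L2 f.
Proof.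
move=> mf fK; apply: L2I => //.
apply: (@integrable_bounded (fun x => f x ^+ 2) (K ^+ 2)).
  exact: measurable_funX.
by move=> x; rewrite normrX lerXn2r// nnegrE// (le_trans _ (fK x)).
Qed.

Lemma L2D f g : L2 f -> L2 g -> L2 (f + g).
Proof.
move=> Lf Lg; apply: L2I; first by apply: measurable_funD; exact: L2_measurable.
have h := integrableD measurableT (integrableD measurableT (integrable_ip Lf Lf) (integrable_ip Lg Lg))
   (integrableZl measurableT 2 (integrable_ip Lf Lg)).
apply: eq_integrable h => // x _; rewrite /= -!EFinM -!EFinD; congr EFin.
by rewrite -[(f + g) x]/(f x + g x); ring.
Qed.

Lemma L2Z (a : R) f : L2 f -> L2 (a *: f).
Proof.
move=> Lf; apply: L2I; first by apply: measurable_funM => //; exact: L2_measurable.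
have h := integrableZl measurableT (a ^+ 2) (integrable_ip Lf Lf).
apply: eq_integrable h => // x _; rewrite /= -!EFinM; congr EFin.
by rewrite -[(a *: f) x]/(a * f x); ring.
Qed.

Lemma ipC f g : ip f g = ip g f.
Proof. by apply: eq_Rintegral => x _; rewrite mulrC. Qed.

Lemma ipDl f g h : L2 f -> L2 g -> L2 h -> ip (f + g) h = ip f h + ip g h.
Proof.
move=> Lf Lg Lh; rewrite /ip -RintegralD//; [|exact: integrable_ip..].
by apply: eq_Rintegral => x _; rewrite -[(f + g) x]/(f x + g x) mulrDl.
Qed.

Lemma ipZl (a : R) f h : L2 f -> L2 h -> ip (a *: f) h = a * ip f h.
Proof.
move=> Lf Lh; rewrite /ip -RintegralZl//; last exact: integrable_ip.
by apply: eq_Rintegral => x _; rewrite -[(a *: f) x]/(a * f x) mulrA.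
Qed.

Lemma ip_ge0 f : 0 <= ip f f.
Proof. by apply: Rintegral_ge0 => x _; rewrite -expr2 sqr_ge0. Qed.

Lemma ip_CS f g : L2 f -> L2 g -> ip f g ^+ 2 <= ip f f * ip g g.
Proof. exact: (ip_CauchySchwarz L2D L2Z ipC ipDl ipZl ip_ge0). Qed.

Lemma ip_bounded f (K : R) : measurable_fun setT f -> (forall x, `|f x| <= K) ->
  ip f f <= K ^+ 2.
Proof.
move=> mf fK; have Lf := L2_bounded mf fK.
have K0 : 0 <= K by exact: le_trans (fK point).
apply: (@le_trans _ _ (\int[mu]_(x in setT) K ^+ 2)).
  apply: le_Rintegral => //; first exact: integrable_ip.
    apply: (@integrable_bounded (cst (K ^+ 2)) (K ^+ 2)) => // x.
    by rewrite ger0_norm// sqr_ge0.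
  move=> x _; rewrite -expr2 -[leLHS]real_normK ?num_real//.
  by rewrite lerXn2r// nnegrE.
by rewrite Rintegral_cst// mu1 mulr1.
Qed.

Lemma ip_ae0 f : L2 f -> ip f f = 0 -> f = (fun=> 0) %[ae mu].
Proof.
move=> Lf f0.
have mf := L2_measurable Lf.
have i0 : (\int[mu]_x `|(f x * f x)%:E| = 0)%E.
  under eq_integral do rewrite gee0_abs ?lee_fin -?expr2 ?sqr_ge0//.
  have := f0; rewrite /ip /Rintegral => f0'.
  under eq_integral do rewrite expr2.
  by rewrite -[LHS]fineK ?f0'//; apply: integrable_fin_num => //; exact: integrable_ip.
have mff : measurable_fun setT (fun x => (f x * f x)%:E).
  by apply/measurable_EFinP; exact: measurable_funM.
have /(ae_eq_integral_abs mu measurableT mff) h := i0.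
apply: filterS h => x /(_ I) [] /eqP.
by rewrite mulf_eq0 orbb => /eqP.
Qed.

Lemma ae0_ip f g : measurable_fun setT f -> measurable_fun setT g ->
  f = (fun=> 0) %[ae mu] -> ip f g = 0.
Proof.
move=> mf mg f0; rewrite /ip /Rintegral.
suff -> : (\int[mu]_x (f x * g x)%:E = \int[mu]_x (cst 0%E x))%E by rewrite integral0.
apply: ae_eq_integral => //.
  by apply/measurable_EFinP; exact: measurable_funM.
by apply: filterS f0 => x fx _; rewrite fx// mul0r.
Qed.

Lemma ae_ip f g h : measurable_fun setT f -> measurable_fun setT g ->
  measurable_fun setT h -> f = g %[ae mu] -> ip f h = ip g h.
Proof.
move=> mf mg mh fg; congr fine; apply: ae_eq_integral => //.
- by apply/measurable_EFinP; exact: measurable_funM.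
- by apply/measurable_EFinP; exact: measurable_funM.
- by apply: filterS fg => x fx _; rewrite fx.
Qed.

Lemma ae_L2 f g : L2 f -> measurable_fun setT g -> f = g %[ae mu] -> L2 g.
Proof.
move=> Lf mg fg; have mf := L2_measurable Lf; apply: L2I => //.
have if2 := integrable_ip Lf Lf.
apply/integrableP; split; first by apply/measurable_EFinP; exact: measurable_funX.
case/integrableP : if2 => _; apply: le_lt_trans.
rewrite le_eqVlt; apply/orP; left; apply/eqP.
apply: ae_eq_integral => //.
- by apply: measurableT_comp => //; apply/measurable_EFinP; exact: measurable_funX.
- by apply: measurableT_comp => //; apply/measurable_EFinP; exact: measurable_funM.
- by apply: filterS fg => x fx _ /=; rewrite -fx// expr2.
Qed.

(** * Nuclear series: boundedness, symmetry and compactness *)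

Section Nuclear.
Variables (cc : nat -> R) (e : nat -> T -> R).
Hypothesis ccv : cvgn (series (fun m => `|cc m|)).
Hypothesis me : forall m, measurable_fun setT (e m).
Hypothesis e1 : forall m x, `|e m x| <= 1.

Let Cc := limn (series (fun m => `|cc m|)).

Definition nuclear f (x : T) : R := limn (series (fun m => cc m * ip (e m) f * e m x)).

Let Le m : L2 (e m) := L2_bounded (me m) (e1 m).

Lemma nuclear_coef_le f m : L2 f -> `|ip (e m) f| <= Num.sqrt (ip f f).
Proof.
move=> Lf; rewrite -sqrtr_sqr ler_sqrt ?ip_ge0//.
rewrite (le_trans (ip_CS (Le m) Lf))// ler_piMl ?ip_ge0//.
by have := ip_bounded (me m) (e1 m); rewrite expr1n.
Qed.

(** The bounded coefficients [l] are left arbitrary because three kinds occur: [ip (e m) f] for the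
    operator, limits of such numbers in [nuclear_compact], and the constant 1 for the kernel at a
    fixed point in [hankel_series]. *)
Lemma bounded_series_cvg (l : nat -> R) (K : R) x : (forall m, `|l m| <= K) ->
  series (fun m => cc m * l m * e m x) @ \oo -->
    limn (series (fun m => cc m * l m * e m x)) /\
  `|limn (series (fun m => cc m * l m * e m x))| <= Cc * K.
Proof.
move=> lK; have K0 : 0 <= K by exact: le_trans (lK 0%N).
have ub m : `|cc m * l m * e m x| <= K * `|cc m|.
  rewrite (normrM (cc m * l m)) (normrM (cc m)).
  apply: (@le_trans _ _ (`|cc m| * `|l m| * 1)); first by rewrite ler_wpM2l// mulr_ge0.
  by rewrite mulr1 mulrC ler_wpM2r.
have cK : cvgn (series (K *: (fun m => `|cc m|))) by exact: is_cvg_seriesZ.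
have cn : cvgn [normed series (fun m => cc m * l m * e m x)].
  apply: (series_le_cvg _ _ _ cK) => m; [exact: normr_ge0|exact: mulr_ge0|exact: ub].
split; first exact: normed_cvg.
apply: le_trans (lim_series_norm cn) _.
rewrite mulrC -[K * _]/(K *: Cc) -lim_seriesZ//.
exact: lim_series_le.
Qed.

Lemma nuclear_cvg f x : L2 f ->
  series (fun m => cc m * ip (e m) f * e m x) @ \oo --> nuclear f x /\
  `|nuclear f x| <= Cc * Num.sqrt (ip f f).
Proof. by move=> Lf; apply: bounded_series_cvg => m; exact: nuclear_coef_le. Qed.

Lemma measurable_bounded_series (l : nat -> R) (K : R) : (forall m, `|l m| <= K) ->
  measurable_fun setT (fun x => limn (series (fun m => cc m * l m * e m x))).
Proof.
move=> lK; apply/measurable_EFinP.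
apply: (emeasurable_fun_cvg (fun n x => (series (fun m => cc m * l m * e m x) n)%:E)).
  move=> n; apply/measurable_EFinP; rewrite /series/=; apply: measurable_sum => m.
  exact: measurable_funM.
move=> x _; apply: cvg_EFin; first exact: nearW.
exact: (bounded_series_cvg x lK).1.
Qed.

Lemma L2_bounded_series (l : nat -> R) (K : R) : (forall m, `|l m| <= K) ->
  L2 (fun x => limn (series (fun m => cc m * l m * e m x))).
Proof.
move=> lK; apply: L2_bounded; first exact: measurable_bounded_series lK.
by move=> x; exact: (bounded_series_cvg x lK).2.
Qed.

Lemma L2_nuclear f : L2 f -> L2 (nuclear f).
Proof. by move=> Lf; apply: L2_bounded_series => m; exact: nuclear_coef_le. Qed.

Lemma bounded_series_ip (l : nat -> R) (K : R) g : (forall m, `|l m| <= K) -> L2 g ->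
  series (fun m => cc m * l m * ip (e m) g) @ \oo -->
    ip (fun x => limn (series (fun m => cc m * l m * e m x))) g.
Proof.
move=> lK Lg; have K0 : 0 <= K by exact: le_trans (lK 0%N).
have mg := L2_measurable Lg.
pose u m x := cc m * l m * (e m x * g x).
have iu m : mu.-integrable setT (fun x => (e m x * g x)%:E) by exact: integrable_ip.
have ig : mu.-integrable setT (EFin \o g).
  have L1 : L2 (cst 1) by apply: (@L2_bounded _ 1) => // x; rewrite normr1.
  by have := integrable_ip L1 Lg; apply: eq_integrable => // x _; rewrite /= mul1r.
pose G := \int[mu]_x `|g x|.
have G0 : 0 <= G by apply: Rintegral_ge0.
have [|||_ h] := @Rintegral_series _ _ _ mu setT measurableT u 
  (fun x => limn (series (fun m => cc m * l m * e m x)) * g x).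
- move=> m; apply: measurable_funM => //; exact: measurable_funM.
- have ub m : (\int[mu]_x `|u m x|%:E <= ((K * G) * `|cc m|)%:E)%E.
    have -> : (((K * G) * `|cc m|)%:E =
        \int[mu]_x ((K * `|cc m|)%:E * `|g x|%:E))%E.
      rewrite integralZl//; last exact: (integrable_norm ig).
      rewrite -[X in (_ * X)%E]fineK; last first.
        by apply: integrable_fin_num => //; exact: (integrable_norm ig).
      by rewrite -EFinM; congr EFin; rewrite /G /Rintegral; ring.
    apply: ge0_le_integral => //.
    - apply/measurable_EFinP; apply: measurableT_comp => //.
      apply: measurable_funM => //; exact: measurable_funM.
    - under eq_fun do rewrite -EFinM.
      apply/measurable_EFinP; apply: measurable_funM => //; exact: measurableT_comp.
    - move=> x _; rewrite -EFinM lee_fin /u (normrM (cc m * _)) (normrM (cc m)) (normrM (e m x)).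
      rewrite (mulrC K) ler_pM ?mulr_ge0//.
        by rewrite ler_wpM2l.
      by rewrite ler_piMl.
  apply: (@le_lt_trans _ _ (\sum_(m <oo) ((K * G) * `|cc m|)%:E)%E).
    apply: lee_nneseries => [m _ _|m _]; last exact: ub.
    by apply: integral_ge0 => x _; rewrite lee_fin.
  apply: nneseries_lty; first by move=> m; rewrite !mulr_ge0.
  exact: (is_cvg_seriesZ ccv).
- move=> x _.
  have h : (fun n => series (fun m => cc m * l m * e m x) n * g x) @ \oo -->
      limn (series (fun m => cc m * l m * e m x)) * g x.
    by apply: cvgM; [exact: (bounded_series_cvg x lK).1|exact: cvg_cst].
  apply: eq_cvgr h => n; rewrite /series/= mulr_suml; apply: eq_bigr => i _.
  by rewrite /u mulrA.
apply: eq_cvgr h => n; rewrite /series/=; apply: eq_bigr => m _.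
by rewrite /u RintegralZl//; exact: iu.
Qed.

Lemma nuclear_ip f g : L2 f -> L2 g ->
  series (fun m => cc m * ip (e m) f * ip (e m) g) @ \oo --> ip (nuclear f) g.
Proof. by move=> Lf; apply: bounded_series_ip => m; exact: nuclear_coef_le. Qed.

Lemma nuclear_sym f g : L2 f -> L2 g -> ip (nuclear f) g = ip f (nuclear g).
Proof.
move=> Lf Lg; rewrite [RHS]ipC.
have h1 := nuclear_ip Lf Lg; have h2 := nuclear_ip Lg Lf.
suff h3 : series (fun m => cc m * ip (e m) f * ip (e m) g) @ \oo --> ip (nuclear g) f.
  exact: cvg_unique h1 h3.
apply: eq_cvgr h2 => n; rewrite /series/=; apply: eq_bigr => m _; ring.
Qed.

Lemma nuclear_bnd f : L2 f -> ip (nuclear f) (nuclear f) <= Cc ^+ 2 * ip f f.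
Proof.
move=> Lf; rewrite -[X in _ * X]sqr_sqrtr ?ip_ge0// -exprMn.
apply: ip_bounded; first exact: L2_measurable (L2_nuclear Lf).
by move=> x; exact: (nuclear_cvg x Lf).2.
Qed.

(** A diagonal subsequence makes every coefficient [ip (e m) (g (s j))] converge to some [l m];
    summability of [cc] turns this into uniform convergence of the images to the series with
    coefficients [l m]. *)
Lemma nuclear_compact (g : nat -> T -> R) : (forall k, L2 (g k) /\ ip (g k) (g k) <= 1) ->
  exists (s : nat -> nat) (h : T -> R), [/\ forall j, (j <= s j)%N, L2 h &
    ip (nuclear (g (s j)) - h) (nuclear (g (s j)) - h) @[j --> \oo] --> (0 : R)].
Proof.
move=> gP; have Lg k : L2 (g k) by case: (gP k).
pose b m k := ip (e m) (g k).
have b1 m k : `|b m k| <= 1.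
  rewrite (le_trans (nuclear_coef_le m (Lg k)))// -[leRHS]sqrtr1 ler_sqrt//.
  by case: (gP k).
have [s [sj /choice[l hl]]] := diagonal_subsequence b1.
have l1 m : `|l m| <= 1.
  have h1 : `|b m (s j)| @[j --> \oo] --> `|l m| by exact: cvg_norm.
  have h2 : (fun=> 1 : R) @ \oo --> (1 : R) by exact: cvg_cst.
  by apply: (ler_cvg_to h1 h2); exact: nearW.
pose h x := limn (series (fun m => cc m * l m * e m x)).
have Lh : L2 h by exact: L2_bounded_series l1.
exists s, h; split => //.
have Cn n : series (fun m => `|cc m|) n <= Cc.
  apply: nondecreasing_cvgn_le => //.
  apply/nondecreasing_seqP => k; rewrite /series/= big_nat_recr//= lerDl.
  exact: normr_ge0.
(* A bound in sup norm: the first n coefficients exactly, then the tail, where |b - l| <= 2. *)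
pose B n j := series (fun m => `|cc m| * `|b m (s j) - l m|) n +
   2 * (Cc - series (fun m => `|cc m|) n).
have hB n j x : `|(nuclear (g (s j)) - h) x| <= B n j.
  have [c1 _] := bounded_series_cvg x (b1^~ (s j)).
  have [c2 _] := bounded_series_cvg x l1.
  have c3 : (fun N => series (fun m => cc m * b m (s j) * e m x) N -
      series (fun m => cc m * l m * e m x) N) @ \oo --> (nuclear (g (s j)) - h) x.
    exact: cvgB.
  have c4 : (fun N => `|series (fun m => cc m * b m (s j) * e m x) N -
      series (fun m => cc m * l m * e m x) N|) @ \oo --> `|(nuclear (g (s j)) - h) x|.
    exact: cvg_norm.
  have c5 : (fun=> B n j) @ \oo --> B n j by exact: cvg_cst.
  apply: (ler_cvg_to c4 c5); near=> N.
  have nN : (n <= N)%N by near: N; exact: nbhs_infty_ge.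
  rewrite /series/= -sumrB.
  have e2 : \sum_(0 <= m < N) (cc m * b m (s j) * e m x - cc m * l m * e m x) =
      \sum_(0 <= m < N) (cc m * (b m (s j) - l m) * e m x).
    by apply: eq_bigr => m _; ring.
  rewrite e2 (le_trans (ler_norm_sum _ _ _))//.
  rewrite (big_cat_nat (n := n))//= lerD//.
    apply: ler_sum => m _; rewrite (normrM (cc m * _)) (normrM (cc m)).
    by rewrite ler_piMr// mulr_ge0.
  apply: (@le_trans _ _ (\sum_(n <= m < N) 2 * `|cc m|)).
    apply: ler_sum => m _; rewrite (normrM (cc m * _)) (normrM (cc m)).
    apply: (@le_trans _ _ (`|cc m| * `|b m (s j) - l m|)); first by rewrite ler_piMr// mulr_ge0.
    rewrite mulrC ler_wpM2r//.
    have := ler_normB (b m (s j)) (l m); have := b1 m (s j); have := l1 m; lra.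
  rewrite -mulr_sumr ler_wpM2l// lerBrDl.
  have := Cn N; rewrite /series/= (big_cat_nat (n := n))//=.
apply/cvgrPdist_le => eps eps0; rewrite /=.
have B0 n : B n j @[j --> \oo] --> 2 * (Cc - series (fun m => `|cc m|) n).
  rewrite -[X in _ --> X]add0r; apply: cvgD; last exact: cvg_cst.
  apply: cvg_sum0 => m.
  rewrite -(mulr0 `|cc m|); apply: cvgM; first exact: cvg_cst.
  rewrite -(@normr0 _ R); apply: cvg_norm.
  by rewrite -(subrr (l m)); apply: cvgB; [exact: hl|exact: cvg_cst].
have C0 : 2 * (Cc - series (fun m => `|cc m|) n) @[n --> \oo] --> (0 : R).
  rewrite -(mulr0 2); apply: cvgM; first exact: cvg_cst.
  by rewrite -(subrr Cc); apply: cvgB; [exact: cvg_cst|exact: ccv].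
(* The squared norm is at most B^2 <= q^2, and q <= 1 gives q^2 <= q <= eps. *)
pose q := Num.min 1 eps.
have q0 : 0 < q by rewrite lt_min ltr01.
have [n hn] : exists n, 2 * (Cc - series (fun m => `|cc m|) n) < q.
  have /cvgrPdist_lt/(_ _ q0)[n _ hn] := C0.
  exists n; have := hn n (leqnn n); rewrite /= sub0r normrN ger0_norm//.
  by rewrite mulr_ge0// subr_ge0.
near=> j.
have Bq : B n j < q by near: j; apply: cvgr_lt (B0 n) _ hn.
have Bn0 : 0 <= B n j.
  rewrite addr_ge0//; last by rewrite mulr_ge0// subr_ge0.
  by rewrite /series/= sumr_ge0// => m _; rewrite mulr_ge0.
have Ld : L2 (nuclear (g (s j)) - h).
  by rewrite -scaleN1r; apply: L2D; [exact: L2_nuclear|exact: L2Z].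
rewrite sub0r normrN ger0_norm ?ip_ge0//.
apply: le_trans (ip_bounded (L2_measurable Ld) (hB n j)) _.
have q1 : q <= 1 by rewrite ge_min lexx.
have qe : q <= eps by rewrite ge_min lexx orbT.
nra.
Unshelve. all: by end_near. Qed.

End Nuclear.
End L2.

(** * The finite Hankel transform *)

Section L01.
Context {R : realType}.
Let mu := @lebesgue_measure R.

Definition I01 : set (measurableTypeR R) := `]0%R, 1%R[%classic.

Lemma mI01 : measurable I01. Proof. exact: measurable_itv. Qed.

Lemma in_I01 (x : R) : I01 x = (0 < x < 1) :> Prop.
Proof. by rewrite /I01/= in_itv. Qed.

Lemma leb01_setT : @leb01 R setT = 1%E.
Proof.
by rewrite /leb01 /= /mrestr setTI lebesgue_measure_itv/= lte01 oppr0 adde0.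
Qed.

Lemma leb01_integral (G : R -> R) :
  \int[leb01]_x ((G \_ I01) x) = \int[mu]_(x in I01) G x.
Proof.
rewrite /Rintegral; congr fine.
have e : (\int[leb01]_(x in I01) (G x)%:E = \int[mu]_(x in I01) (G x)%:E)%E.
  apply: eq_measure_integral => A mA AI.
  by rewrite /leb01 /= /mrestr (_ : A `&` _ = A)//; apply/setIidPl.
rewrite -e [RHS]integral_mkcond; apply: eq_integral => x _.
by rewrite restrict_EFin.
Qed.

Lemma ae01 (P : R -> Prop) : (forall x : R, 0 < x < 1 -> P x) -> {ae leb01, forall x, P x}.
Proof.
move=> h; exists (~` I01); split; first by apply: measurableC; exact: mI01.
  by rewrite /leb01 /= /mrestr setICl measure0.
by move=> x /= nP; rewrite in_I01 => /h.
Qed.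

Lemma L2_restrict (G : R -> R) (K : R) : measurable_fun I01 G ->
  (forall x : R, 0 < x < 1 -> `|G x| <= K) -> L2 leb01 (G \_ I01).
Proof.
move=> mG GK; apply: (L2_bounded leb01_setT (K := `|K|)).
  exact/(measurable_restrictT _ mI01).
move=> x; rewrite patchE; case: ifPn => [|_]; last by rewrite normr0.
by rewrite inE in_I01 => /GK/le_trans; apply; exact: ler_norm.
Qed.

End L01.

Section HankelNuclear.
Context {R : realType}.
Let mu := @lebesgue_measure R.
Let T := measurableTypeR R.
Variables (c nu : R).
Hypothesis (c0 : 0 < c) (nu0 : - (1 / 2) < nu).

(** Without the cut-off the bound by 1 that nuclear series require would fail beyond 1. *)
Definition emono01 (m : nat) : T -> R := emono nu m \_ I01.
Let e := emono01.

Lemma wt_ge0 (t : R) : 0 <= wt nu t. Proof. exact: powR_ge0. Qed.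

Lemma wt_le1 (t : R) : 0 < t -> t < 1 -> wt nu t <= 1.
Proof.
move=> t0 t1; rewrite /wt; have := nu0; set p := nu + 1 / 2 => nu0'.
have p0 : 0 <= p by rewrite /p; lra.
rewrite (_ : 1 = 1 `^ p); last by rewrite powR1.
rewrite ge0_ler_powR ?nnegrE//.
- exact: ltW.
- exact: ltW.
Qed.

Lemma measurable_emono01 m : measurable_fun setT (e m).
Proof. by apply/(measurable_restrictT _ mI01); exact: measurable_funTS (measurable_emono _ _). Qed.

Lemma emono01_le1 m x : `|e m x| <= 1.
Proof.
rewrite /e /emono01 patchE; case: ifPn => [|_]; last by rewrite normr0.
rewrite inE in_I01 => /andP[x0 x1]; rewrite ger0_norm ?emono_ge0//.
by rewrite /emono mulr_ile1 ?wt_ge0 ?wt_le1 ?exprn_ge0 ?(ltW x0)// exprn_ile1// ltW.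
Qed.

(** It vanishes outside ]0, 1[, where [hankel] need not; the two are equal almost everywhere for
    [leb01]. *)
Definition hankelN : (T -> R) -> T -> R := nuclear leb01 (ncoef c nu) e.

Lemma emono01E m x : 0 < x < 1 -> e m x = emono nu m x.
Proof. by move=> x01; rewrite /e /emono01 patchE ifT// inE in_I01. Qed.

(* Num.sqrt is 0 on negative numbers. *)
Lemma bkernel_le0 (x t : R) : 0 < x -> t <= 0 -> bkernel c nu x t = 0.
Proof.
by move=> x0 t0; rewrite /bkernel ler0_sqrtr ?mul0r// mulr_ge0_le0// mulr_ge0 ?ltW.
Qed.

Lemma measurable_bkernelT (x : R) : 0 < x -> measurable_fun [set: T] (bkernel c nu x).
Proof.
move=> x0.
have -> : bkernel c nu x = bkernel c nu x \_ (`]0%R, +oo[%classic : set T).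
  apply/funext => t; rewrite patchE; case: ifPn => //; rewrite notin_setE/= in_itv/= andbT.
  by move/negP; rewrite -leNgt => /(bkernel_le0 x0).
by apply/(measurable_restrictT _ (@mD R)); exact: measurable_bkernel.
Qed.

(** For fixed x the numbers [ncoef m * emono m x] are themselves summable weights, so the result on
    nuclear series applies in the variable t alone. All x > 0 are covered, not only x < 1, because
    membership in L^2 asks for measurability on the whole line. *)
Lemma hankel_series (f : T -> R) (x : R) : 0 < x -> L2 leb01 f ->
  series (fun m => ncoef c nu m * emono nu m x * ip leb01 (e m) f) @ \oo --> hankel c nu f x.
Proof.
move=> x0 Lf.
have ek : ip leb01 (bkernel c nu x) f = hankel c nu f x by [].
have cc : cvgn (series (fun m => `|ncoef c nu m * emono nu m x|)).
  apply: (@cvg_series_le _ _ (fun m => amp c nu * (2 * expR 2) * wt nu x *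
     ((kap c * x ^+ 2) ^+ m / m`!%:R))); last exact: cvg_exp_series.
  move=> m; rewrite normr_id normrM (ger0_norm (emono_ge0 _ _ x0)).
  have := ler_wpM2r (emono_ge0 nu m x0) (norm_ncoef_le c0 nu0 m).
  by move/le_trans; apply; rewrite /emono exprM [X in _ <= _ * (X / _)]exprMn; rewrite le_eqVlt; apply/orP; left; apply/eqP; ring.
have h := @bounded_series_ip _ _ _ leb01 leb01_setT _ e cc measurable_emono01 emono01_le1
  (fun=> 1) 1 f (fun=> _) Lf.
have {}h := h (ltac:(by rewrite normr1)).
have e2 : (fun m => ncoef c nu m * emono nu m x * 1 * ip leb01 (e m) f) =
   (fun m => ncoef c nu m * emono nu m x * ip leb01 (e m) f).
  by apply/funext => m; rewrite mulr1.
rewrite e2 in h; rewrite -ek.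
set k := fun t => limn _ in h.
suff -> : ip leb01 (bkernel c nu x) f = ip leb01 k f by exact: h.
apply: ae_ip.
- exact: measurable_bkernelT.
- apply: (measurable_bounded_series cc measurable_emono01 emono01_le1 (K := 1)) => m.
  by rewrite normr1.
- exact: L2_measurable Lf.
apply: ae01 => t t01 _; rewrite /k; apply/esym/cvg_lim => //.
have h2 := bkernel_series c0 nu0 x0 (proj1 (andP t01)).
by apply: eq_cvgr h2 => n; rewrite /series/=; apply: eq_bigr => m _; rewrite mulr1 emono01E.
Qed.

Lemma hankelE (f : T -> R) (x : R) : L2 leb01 f -> 0 < x < 1 -> hankel c nu f x = hankelN f x.
Proof.
move=> Lf x01; apply/esym/cvg_lim => //.
apply: eq_cvgr (hankel_series (proj1 (andP x01)) Lf) => n.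
by rewrite /series/=; apply: eq_bigr => m _; rewrite emono01E// mulrAC.
Qed.

Lemma hankel_le0 (f : T -> R) (x : R) : L2 leb01 f -> x <= 0 -> hankel c nu f x = 0.
Proof.
move=> Lf x0; rewrite -[LHS]/(ip leb01 (bkernel c nu x) f).
(* The kernel depends on x t only, so reflecting both variables reduces to a positive first
   variable. *)
have refl t : bkernel c nu x t = bkernel c nu (- x) (- t).
  by rewrite /bkernel (_ : c * - x * - t = c * x * t); last ring.
apply: ae0_ip; last 1 first.
- apply: ae01 => t /andP[t0 _] _; rewrite refl.
  have [->|xn0] := eqVneq x 0; first by rewrite /bkernel oppr0 mulr0 mul0r sqrtr0 mul0r.
  by apply: bkernel_le0; [rewrite oppr_gt0 lt_neqAle xn0|rewrite oppr_le0 ltW].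
- have [->|xn0] := eqVneq x 0.
    rewrite (_ : bkernel c nu 0 = cst 0); first exact: measurable_cst.
    by apply/funext => t; rewrite /bkernel mulr0 mul0r sqrtr0 mul0r.
  rewrite (_ : bkernel c nu x = bkernel c nu (- x) \o -%R); last by apply/funext => t; exact: refl.
  apply: measurableT_comp; last exact: oppr_measurable.
  by apply: measurable_bkernelT; rewrite oppr_gt0 lt_neqAle xn0.
- exact: L2_measurable Lf.
Qed.

Lemma measurable_hankel (f : T -> R) : L2 leb01 f -> measurable_fun [set: T] (hankel c nu f).
Proof.
move=> Lf.
have -> : hankel c nu f = hankel c nu f \_ (`]0%R, +oo[%classic : set T).
  apply/funext => x; rewrite patchE; case: ifPn => //; rewrite notin_setE/= in_itv/= andbT.
  by move/negP; rewrite -leNgt => /(hankel_le0 Lf).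
apply/(measurable_restrictT _ (@mD R)); apply/measurable_EFinP.
apply: (emeasurable_fun_cvg (fun n x =>
   (series (fun m => ncoef c nu m * emono nu m x * ip leb01 (e m) f) n)%:E)).
  move=> n; apply/measurable_EFinP; rewrite /series/=; apply: measurable_sum => m.
  have mm : measurable_fun [set: R] (fun x => ncoef c nu m * emono nu m x * ip leb01 (e m) f).
    by apply: measurable_funM => //; apply: measurable_funM => //; exact: measurable_emono.
  exact: measurable_funTS mm.
move=> x; rewrite in_itv0y => x0; apply: cvg_EFin; first exact: nearW.
exact: hankel_series.
Qed.

Lemma L2_hankelN f : L2 leb01 f -> L2 leb01 (hankelN f).
Proof.
exact: (L2_nuclear leb01_setT (cvg_ncoef c0 nu0) measurable_emono01 emono01_le1).
Qed.

Lemma hankel_ae f : L2 leb01 f -> hankelN f = hankel c nu f %[ae leb01].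
Proof. by move=> Lf; apply: ae01 => x x01 _; rewrite hankelE. Qed.

Lemma L2_hankel f : L2 leb01 f -> L2 leb01 (hankel c nu f).
Proof.
by move=> Lf; apply: ae_L2 (L2_hankelN Lf) (measurable_hankel Lf) (hankel_ae Lf).
Qed.

(** Only the coefficients [ip (e m) f] enter, hence equality everywhere. This lets the inner
    [hankel] of [hankelQ] be replaced by [hankelN]. *)
Lemma hankelN_ae (f g : T -> R) : L2 leb01 f -> L2 leb01 g -> f = g %[ae leb01] ->
  hankelN f = hankelN g.
Proof.
move=> Lf Lg fg; apply/funext => x; congr (limn (series _)); apply/funext => m.
congr (_ * _ * _); rewrite [LHS]ipC [RHS]ipC; apply: ae_ip => //; last exact: measurable_emono01.
- exact: L2_measurable Lf.
- exact: L2_measurable Lg.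
Qed.

Lemma hankelQE (f : T -> R) (x : R) : L2 leb01 f -> 0 < x < 1 ->
  hankelQ c nu f x = c * hankelN (hankelN f) x.
Proof.
move=> Lf x01; rewrite /hankelQ hankelE//; last exact: L2_hankel.
by rewrite (hankelN_ae (L2_hankelN Lf) (L2_hankel Lf) (hankel_ae Lf)).
Qed.

End HankelNuclear.

(** * A class of profiles stable under the Weyl integral *)

Section Smooth01.
Context {R : realType}.
Let mu := @lebesgue_measure R.
Let T := measurableTypeR R.
Let D : set T := `]0%R, +oo[%classic.

Lemma continuous_power_series (a : nat -> R) (A q y : R) :
  (forall m, `|a m| <= A * (q ^+ m / m`!%:R)) -> `|y| < 1 ->
  {for y, continuous (fun y : R => limn (series (fun m => a m * y ^+ m)))}.
Proof.
move=> aA y1.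
have cv (b : nat -> R) (B : R) : (forall m, `|b m| <= B * (q ^+ m / m`!%:R)) -> cvgn (pseries b 1).
  move=> bB; apply: (@cvg_series_le _ _ (fun m => B * (q ^+ m / m`!%:R))); last exact: cvg_exp_series.
  move=> m.
  by rewrite /= expr1n mulr1.
(* Differentiation shifts the coefficients; the factorial absorbs the factor m + 1, and the bound is
   only multiplied by q. *)
have di (b : nat -> R) (B : R) : (forall m, `|b m| <= B * (q ^+ m / m`!%:R)) ->
    forall m, `|pseries_diffs b m| <= (B * q) * (q ^+ m / m`!%:R).
  move=> bB m; rewrite /pseries_diffs normrM ger0_norm//.
  have := ler_wpM2l (ler0n R m.+1) (bB m.+1); move/le_trans; apply.
  rewrite le_eqVlt; apply/orP; left; apply/eqP; rewrite factS natrM exprS.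
  by field; rewrite nat1r !pnatr_eq0 -lt0n fact_gt0.
have h : is_derive y 1 (fun y => limn (pseries a y)) (limn (pseries (pseries_diffs a) y)).
  apply: (@pseries_snd_diffs _ a 1).
  - exact: cv aA.
  - exact: cv (di _ _ aA).
  - exact: cv (di _ _ (di _ _ aA)).
  - by rewrite normr1.
apply: differentiable_continuous; apply/derivable1_diffP.
by case: h.
Qed.

Lemma exp_approxD phi P C psi Q C' (a : R) : exp_approx phi P C -> exp_approx psi Q C' ->
  exp_approx (fun y => a * phi y + psi y) (fun m => a *: P m + Q m) (`|a| * C + C').
Proof.
have pD n y : phip (a *: P n + Q n) y = a * phip (P n) y + phip (Q n) y.
  by rewrite /phip hornerD hornerZ; ring.
move=> [mphi phiC PC Pphi] [mpsi psiC QC Qpsi]; split.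
- by apply: measurable_funD => //; exact: measurable_funM.
- move=> y y0; rewrite (le_trans (ler_normD _ _))// mulrDl lerD ?psiC// normrM -mulrA.
  by rewrite ler_wpM2l ?phiC.
- move=> m y y0; rewrite pD (le_trans (ler_normD _ _))// mulrDl lerD ?QC// normrM -mulrA.
  by rewrite ler_wpM2l ?PC.
- move=> y y0 y1; under eq_fun do rewrite pD.
  apply: cvgD; last exact: Qpsi.
  by apply: cvgM; [exact: cvg_cst|exact: Pphi].
Qed.

(** Asking for approximability rather than continuity makes stability under linear combinations and
    under the Weyl integral direct, and gives access to Plancherel and Sonine. *)
Definition smooth01 (phi : R -> R) :=
  (forall y : R, 1 <= y -> phi y = 0) /\ exists P C, exp_approx phi P C.

Lemma smooth01D phi psi (a : R) : smooth01 phi -> smooth01 psi ->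
  smooth01 (fun y => a * phi y + psi y).
Proof.
move=> [phi0 [P [C aphi]]] [psi0 [Q [C' apsi]]]; split.
  by move=> y y1; rewrite phi0// psi0// mulr0 addr0.
by do 2 eexists; exact: exp_approxD aphi apsi.
Qed.

Lemma smooth010 : smooth01 (fun=> 0).
Proof.
split=> //; exists (fun=> 0), 0; split => //.
- by move=> y _; rewrite normr0 mul0r.
- by move=> n y _; rewrite /phip horner0 mulr0 normr0 mul0r.
- by move=> y _ _; rewrite /phip horner0 mulr0; exact: cvg_cst.
Qed.

Lemma smooth01_sum n (a : 'I_n -> R) (phi : 'I_n -> R -> R) : (forall i, smooth01 (phi i)) ->
  smooth01 (fun y => \sum_i a i * phi i y).
Proof.
elim: n a phi => [|n IH] a phi sphi.
  rewrite (_ : (fun _ => _) = fun=> 0); first exact: smooth010.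
  by apply/funext => y; rewrite big_ord0.
rewrite (_ : (fun _ => _) = fun y => a ord0 * phi ord0 y +
    \sum_(i < n) a (lift ord0 i) * phi (lift ord0 i) y).
  by apply: smooth01D => //; exact: IH.
by apply/funext => y; rewrite big_ord_recl.
Qed.

Section Weyl.
Variables (nu nu' : R).
Hypothesis nunu : nu' < nu.

Lemma smooth01_weyl phi : smooth01 phi -> smooth01 (weyl nu nu' phi).
Proof.
move=> [phi0 [P [C aphi]]]; split; last by do 2 eexists; exact: exp_approx_weyl aphi.
move=> y y1; rewrite /weyl.
suff -> : \int[mu]_(z in `]0%R, +oo[) (z `^ (nu - nu' - 1) * phi (y + z)) =
   \int[mu]_(z in D) 0 by rewrite Rintegral_cst ?mul0r ?mulr0//; exact: mD.
by apply: eq_Rintegral => z; rewrite inE in_itv0y => z0; rewrite phi0 ?mulr0//; lra.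
Qed.

Lemma weylD phi psi (a v : R) : smooth01 phi -> smooth01 psi -> 0 < v ->
  weyl nu nu' (fun y => a * phi y + psi y) v = a * weyl nu nu' phi v + weyl nu nu' psi v.
Proof.
move=> [_ [P [C aphi]]] [_ [Q [C' apsi]]] v0.
have [i1 _] := weyl_cvg nunu aphi v0; have [i2 _] := weyl_cvg nunu apsi v0.
rewrite /weyl mulrCA -mulrDr; congr (_ * _).
rewrite -(RintegralZl a (@mD R) i1) -(RintegralD (@mD R) _ i2); last first.
  by have := integrableZl (@mD R) a i1.
by apply: eq_Rintegral => z _; ring.
Qed.

Lemma weyl_sum n (a : 'I_n -> R) (phi : 'I_n -> R -> R) (v : R) :
  (forall i, smooth01 (phi i)) -> 0 < v ->
  weyl nu nu' (fun y => \sum_i a i * phi i y) v = \sum_i a i * weyl nu nu' (phi i) v.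
Proof.
move=> + v0; elim: n a phi => [|n IH] a phi sphi.
  rewrite big_ord0 /weyl; under eq_Rintegral do rewrite big_ord0 mulr0.
  by rewrite Rintegral_cst ?mul0r ?mulr0//; exact: mD.
rewrite big_ord_recl -IH// -weylD//; last exact: smooth01_sum.
by congr weyl; apply/funext => y; rewrite big_ord_recl.
Qed.

End Weyl.

End Smooth01.

(** * Profiles on the half-line and functions on ]0, 1[ *)

Section Lift.
Context {R : realType}.
Let mu := @lebesgue_measure R.
Let T := measurableTypeR R.
Let D : set T := `]0%R, +oo[%classic.
Let J : set T := `[1%R, +oo[%classic.

Let DE (x : R) : D x = (0 < x) :> Prop. Proof. exact: in_itv0y. Qed.

(** If phi vanishes from 1 on, the cut-off changes nothing for t > 0, so the finite transform of the
    lift is the half-line transform restricted to ]0, 1[. *)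
Definition lift01 (nu : R) (phi : R -> R) : T -> R := (fun t => wt nu t * phi (t ^+ 2)) \_ I01.

Lemma lift01E nu phi (t : R) : 0 < t < 1 -> lift01 nu phi t = wt nu t * phi (t ^+ 2).
Proof. by move=> t01; rewrite /lift01 patchE ifT// inE in_I01. Qed.

Lemma lift01_sum nu n (a : 'I_n -> R) (phi : 'I_n -> R -> R) :
  lift01 nu (fun y => \sum_i a i * phi i y) = \sum_i a i *: lift01 nu (phi i).
Proof.
apply/funext => t; rewrite fct_sumE /lift01 patchE.
case: ifPn => [t01|/negbTE t01]; last first.
  rewrite big1// => i _.
  by rewrite -[LHS]/(a i * ((fun t => wt nu t * phi i (t ^+ 2)) \_ I01) t) patchE t01 mulr0.
rewrite mulr_sumr; apply: eq_bigr => i _.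
rewrite -[RHS]/(a i * ((fun t => wt nu t * phi i (t ^+ 2)) \_ I01) t) patchE t01.
by rewrite mulrCA.
Qed.

Lemma Rintegral_D01 (G : R -> R) : (forall t : R, 1 <= t -> G t = 0) ->
  \int[mu]_(t in D) G t = \int[mu]_(t in I01) G t.
Proof.
move=> G0; rewrite [LHS]Rintegral_mkcond [RHS]Rintegral_mkcond.
apply: eq_Rintegral => t _; rewrite !patchE.
have [t0|t0] := ltP 0 t; last first.
  rewrite ifF; last by apply/negP; rewrite inE DE; rewrite ltNge t0.
  by rewrite ifF//; apply/negP; rewrite inE in_I01 ltNge t0.
rewrite ifT; last by rewrite inE DE.
have [t1|t1] := ltP t 1; first by rewrite ifT// inE in_I01 t0 t1.
by rewrite G0// if_same.
Qed.

Lemma sqr_ge1 (t : R) : 1 <= t -> 1 <= t ^+ 2.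
Proof. by move=> t1; rewrite expr_ge1// (le_trans ler01). Qed.

(* a and a1 (b and b1) stand for the energies of the transform of f (of g) in
   ]0, 1[ and in [1, +oo[, and nf and ng for the squared norms of f and g. *)
Lemma concentration_arith (c lam q a a1 b b1 nf ng : R) :
  0 < c -> 0 < lam -> 0 < q -> a <= q * b -> q * b1 <= a1 ->
  0 <= a1 -> 0 <= b -> 0 <= b1 ->
  c * (a + a1) <= nf -> c * (b + b1) <= ng -> ng <= c * (b + b1) ->
  0 < nf -> lam * nf <= c * a -> 0 < ng /\ lam * ng <= c * b.
Proof.
move=> c0 lam0 q0 ab ab1 a10 b0 b10 bF bF' pF'.
move=> nf0 h.
have ca0 : 0 < c * a by apply: lt_le_trans h; rewrite mulr_gt0.
have a0 : 0 < a by rewrite -(pmulr_rgt0 _ c0).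
have b0' : 0 < b by rewrite -(pmulr_rgt0 _ q0); exact: lt_le_trans ab.
split.
  apply: lt_le_trans bF'; rewrite mulr_gt0// ltr_pwDl//.
(* By Bessel's inequality the part of the energy in ]0, 1[ is at most the squared norm. *)
have lam1 : lam <= 1.
  rewrite -(ler_pM2r nf0) mul1r (le_trans h)// (le_trans _ bF)//.
  by rewrite ler_pM2l// lerDl.
rewrite -(ler_pM2l q0).
(* First ng = c (b + b1) and q b1 <= a1. Then lam c a1 <= (1 - lam) c a, which is the hypothesis on
   f combined with Bessel, and a <= q b finishes since 1 - lam >= 0. *)
apply: (@le_trans _ _ (lam * (c * a1 + c * (q * b)))).
  rewrite mulrCA ler_pM2l//; apply: (@le_trans _ _ (q * (c * (b + b1)))).
    by rewrite ler_pM2l.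
  rewrite (_ : q * _ = c * (q * b1) + c * (q * b)); last by ring.
  by rewrite lerD2r ler_pM2l.
have h1 : lam * (c * a + c * a1) <= c * a.
  by apply: le_trans h; rewrite ler_pM2l// -mulrDr.
have h2 : c * a <= c * (q * b) by rewrite ler_pM2l.
have h3 : (1 - lam) * (c * a) <= (1 - lam) * (c * (q * b)) by rewrite ler_wpM2l// subr_ge0.
rewrite (_ : q * (c * b) = c * (q * b)); last by ring.
move: h1 h3; rewrite !mulrDr !mulrBl !mul1r.
set u := c * a; set v := c * a1; set w := c * (q * b); lra.
Qed.

Section Transform.
Variables (c nu : R).
Hypothesis (c0 : 0 < c) (nu0 : - (1 / 2) < nu).

Lemma L2_lift01 phi : smooth01 phi -> L2 leb01 (lift01 nu phi).
Proof.
move=> [phi0 [P [C [mphi phiC _ _]]]]; apply: (L2_restrict (K := C)).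
  apply: (@measurable_funS _ _ T R D); first exact: mD.
    by move=> t; rewrite in_I01 DE => /andP[].
  apply: measurable_funM; first exact: measurable_funTS (measurable_wt _).
  exact: measurable_sqr_comp.
move=> t /andP[t0 t1]; have t20 : 0 < t ^+ 2 by rewrite exprn_gt0.
have C0 : 0 <= C by have := le_trans (normr_ge0 _) (phiC _ t20); rewrite pmulr_lge0 ?expR_gt0.
rewrite normrM (ger0_norm (wt_ge0 _ _)).
apply: (@le_trans _ _ (1 * (C * expR (- t ^+ 2)))).
  by rewrite ler_pM ?wt_ge0 ?wt_le1 ?phiC.
by rewrite mul1r ler_piMr// -[leRHS]expR0 ler_expR oppr_le0 ltW.
Qed.

Lemma hankelN_lift01 phi (x : R) : smooth01 phi -> 0 < x < 1 ->
  hankelN c nu (lift01 nu phi) x = hankel0y c nu phi x.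
Proof.
move=> sphi x01; rewrite -hankelE//; last exact: L2_lift01.
rewrite /hankel0y Rintegral_D01; last first.
  by move=> t t1; rewrite sphi.1 ?sqr_ge1// !mulr0.
rewrite -leb01_integral; apply: eq_Rintegral => t _.
rewrite /lift01 !patchE; case: ifPn => // _; exact: mulr0.
Qed.

Lemma ip_lift01 phi : smooth01 phi ->
  ip leb01 (lift01 nu phi) (lift01 nu phi) = \int[mu]_(t in D) ((wt nu t * phi (t ^+ 2)) ^+ 2).
Proof.
move=> sphi; rewrite Rintegral_D01; last first.
  by move=> t t1; rewrite sphi.1 ?sqr_ge1// mulr0 expr0n.
rewrite -leb01_integral; apply: eq_Rintegral => t _.
by rewrite /lift01 !patchE; case: ifPn => _; [rewrite expr2|rewrite mulr0].
Qed.

Lemma ip_hankelN_lift01 phi : smooth01 phi ->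
  ip leb01 (hankelN c nu (lift01 nu phi)) (hankelN c nu (lift01 nu phi)) =
  \int[mu]_(x in I01) (hankel0y c nu phi x ^+ 2).
Proof.
move=> sphi; rewrite -leb01_integral; apply: eq_Rintegral => x _.
rewrite patchE; case: ifPn => [|x01].
  by rewrite inE in_I01 => x01; rewrite hankelN_lift01// expr2.
rewrite (_ : hankelN c nu (lift01 nu phi) x = 0) ?mulr0//.
rewrite /hankelN /nuclear (_ : (fun _ => _) = fun=> 0); last first.
  by apply/funext => m; rewrite /emono01 patchE (negbTE x01) mulr0.
apply/cvg_lim => //; rewrite (_ : series _ = fun=> 0); first exact: cvg_cst.
by apply/funext => n; rewrite /series/= big1.
Qed.

(** Since lam > 0, the equation can be solved for f: f = (c / lam) N (N f), with N = [hankelN]. So f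
    lies in the range of N and is a series of the x^(nu + 1/2 + 2 m), that is, x^(nu + 1/2) times a
    power series in x^2. *)
Lemma eigenfunction_lift01 (f : T -> R) (lam : R) : L2 leb01 f -> 0 < lam ->
  hankelQ c nu f = (fun x => lam * f x) %[ae leb01] ->
  exists2 phi, smooth01 phi & f = lift01 nu phi %[ae leb01].
Proof.
move=> Lf lam0 Qf.
have LN := L2_hankelN c0 nu0 Lf.
pose b m := c / lam * ip leb01 (emono01 nu m) (hankelN c nu f).
pose K := c / lam * Num.sqrt (ip leb01 (hankelN c nu f) (hankelN c nu f)).
have bK m : `|b m| <= K.
  rewrite /b normrM (gtr0_norm (divr_gt0 c0 lam0)) ler_wpM2l ?divr_ge0 ?(ltW c0) ?(ltW lam0)//.
  exact: (nuclear_coef_le leb01_setT (@measurable_emono01 _ _) (emono01_le1 nu0)).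
pose a m := ncoef c nu m * b m.
pose A := amp c nu * (2 * expR 2) * K.
have aA m : `|a m| <= A * (kap c ^+ m / m`!%:R).
  rewrite /a normrM; apply: (@le_trans _ _ (amp c nu * (2 * expR 2) * (kap c ^+ m / m`!%:R) * K)).
    by rewrite ler_pM// norm_ncoef_le.
  by rewrite /A mulrAC.
pose F (y : R) := limn (series (fun m => a m * y ^+ m)).
have FA (y : R) : 0 < y < 1 -> (series (fun m => a m * y ^+ m) @ \oo --> F y) /\
   `|F y| <= limn (series (fun m => A * (kap c ^+ m / m`!%:R))).
  move=> /andP[y0 y1].
  have le m : `|a m * y ^+ m| <= A * (kap c ^+ m / m`!%:R).
    rewrite normrM (ger0_norm (exprn_ge0 _ (ltW y0))); apply: le_trans (aA m).
    by rewrite ler_piMr// exprn_ile1// ltW.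
  have cn : cvgn [normed series (fun m => a m * y ^+ m)].
    apply: (@cvg_series_le _ _ (fun m => A * (kap c ^+ m / m`!%:R))); last exact: cvg_exp_series.
    by move=> m; rewrite normr_id.
  split; first exact: normed_cvg.
  apply: le_trans (lim_series_norm cn) _; apply: lim_series_le => //.
  exact: cvg_exp_series.
pose phi : R -> R := F \_ I01.
have phiE (y : R) : 0 < y < 1 -> phi y = F y.
  by move=> y01; rewrite /phi patchE ifT// inE in_I01.
have phi0 (y : R) : 1 <= y -> phi y = 0.
  by move=> y1; rewrite /phi patchE ifF//; apply/negP; rewrite inE in_I01 => /andP[_]; rewrite ltNge y1.
exists phi.
  split=> //; apply: (exp_approx_compact (C := limn (series (fun m => A * (kap c ^+ m / m`!%:R))))).
  - have mm : measurable_fun [set: T] phi.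
      apply/(measurable_restrictT _ mI01); apply/measurable_EFinP.
      apply: (emeasurable_fun_cvg (fun n (x : T) => (series (fun m => a m * (x : R) ^+ m) n)%:E)).
        move=> n; apply/measurable_EFinP; rewrite /series/=; apply: measurable_sum => m.
        have mm : measurable_fun [set: R] (fun x : R => a m * x ^+ m).
          by apply: measurable_funM => //; exact: measurable_funX.
        exact: measurable_funTS mm.
      move=> x; rewrite in_I01 => x01; apply: cvg_EFin; first exact: nearW.
      exact: (FA x x01).1.
    exact: measurable_funTS mm.
  - by move=> y y01; rewrite phiE//; exact: (FA y y01).2.
  - exact: phi0.
  - move=> y y01; have := y01 => /andP[y0 y1].
    have y1' : `|y| < 1 by rewrite ger0_norm// ltW.
    have cF := continuous_power_series aA y1'.
    suff : phi s @[s --> y] --> phi y by [].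
    rewrite phiE//; apply: cvg_trans cF; apply: near_eq_cvg.
    near=> s; rewrite phiE//; apply/andP; split.
      by near: s; exact: lt_nbhsr.
    by near: s; exact: lt_nbhsl.
suff key (x : R) : 0 < x < 1 -> hankelQ c nu f x = lam * f x -> f x = lift01 nu phi x.
  have h := ae01 key.
  by apply: (@filterS2 _ _ (ae_filter_ringOfSetsType leb01) _ _ _ _ Qf h) => x h1 h2 _; exact: h2 (h1 I).
move=> x01; rewrite hankelQE// => e.
have -> : f x = c / lam * hankelN c nu (hankelN c nu f) x.
  have := congr1 (fun z => lam^-1 * z) e; rewrite mulKf ?lt0r_neq0// => <-.
  by ring.
have x201 : 0 < x ^+ 2 < 1.
  by case/andP : x01 => x0 x1; rewrite exprn_gt0//= exprn_ilt1// ltW.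
rewrite lift01E// phiE//.
have [h1 _] := FA _ x201.
have [h2 _] := nuclear_cvg leb01_setT (cvg_ncoef c0 nu0) (@measurable_emono01 _ nu)
   (emono01_le1 nu0) x LN.
have h3 : (fun n => c / lam * series (fun m => ncoef c nu m *
    ip leb01 (emono01 nu m) (hankelN c nu f) * emono01 nu m x) n) @ \oo -->
    c / lam * hankelN c nu (hankelN c nu f) x.
  by apply: cvgM; [exact: cvg_cst|exact: h2].
have h4 : (fun n => wt nu x * series (fun m => a m * (x ^+ 2) ^+ m) n) @ \oo -->
    wt nu x * F (x ^+ 2).
  by apply: cvgM; [exact: cvg_cst|exact: h1].
suff h5 : (fun n => c / lam * series (fun m => ncoef c nu m *
    ip leb01 (emono01 nu m) (hankelN c nu f) * emono01 nu m x) n) @ \oo -->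
    wt nu x * F (x ^+ 2) by exact: cvg_unique h3 h5.
apply: eq_cvgr h4 => n; rewrite /series/= !mulr_sumr; apply: eq_bigr => m _.
rewrite emono01E// /emono exprM /a /b; ring.
Unshelve. all: by end_near. Qed.

End Transform.

Section Transfer.
Variables (c nu nu' : R).
Hypothesis (c0 : 0 < c) (nu0 : - (1 / 2) < nu') (nunu : nu' < nu).
Let nu1 : - (1 / 2) < nu := lt_trans nu0 nunu.

(* The Sonine factor x `^ (2 * (nu - nu')) is at most 1 on ]0, 1[ and at least
   1 beyond, so removing it raises the proportion of energy lying in ]0, 1[. *)
Lemma weyl_concentration phi (lam : R) : smooth01 phi -> 0 < lam ->
  let f := lift01 nu phi in let g := lift01 nu' (weyl nu nu' phi) in
  0 < ip leb01 f f ->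
  lam * ip leb01 f f <= c * ip leb01 (hankelN c nu f) (hankelN c nu f) ->
  0 < ip leb01 g g /\
  lam * ip leb01 g g <= c * ip leb01 (hankelN c nu' g) (hankelN c nu' g).
Proof.
move=> sphi lam0 f g.
have spsi := smooth01_weyl nunu sphi.
rewrite /f /g (ip_lift01 nu sphi) (ip_lift01 nu' spsi).
rewrite (ip_hankelN_lift01 c0 nu1 sphi) (ip_hankelN_lift01 c0 nu0 spsi).
have [_ [P [C aphi]]] := sphi; have [_ [Q [C' apsi]]] := spsi.
have [iF bF] := hankel0y_bessel c0 nu1 aphi.
have [iF' bF'] := hankel0y_bessel c0 nu0 apsi.
have pF' := hankel0y_plancherel_ge c0 nu0 apsi.
set psi := weyl nu nu' phi in spsi apsi iF' bF' pF' *.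
set nf := \int[mu]_(t in D) ((wt nu t * phi (t ^+ 2)) ^+ 2).
set ng := \int[mu]_(t in D) ((wt nu' t * psi (t ^+ 2)) ^+ 2).
set a := \int[mu]_(x in I01) (hankel0y c nu phi x ^+ 2).
set b := \int[mu]_(x in I01) (hankel0y c nu' psi x ^+ 2).
pose a1 := \int[mu]_(x in J) (hankel0y c nu phi x ^+ 2).
pose b1 := \int[mu]_(x in J) (hankel0y c nu' psi x ^+ 2).
have DIJ : D = I01 `|` J.
  apply/seteqP; split => x; rewrite DE /setU/= in_I01 /J/= in_itv/= andbT.
    by move=> x0; have [x1|x1] := ltP x 1; [left; rewrite x0|right].
  by case=> [/andP[]//|]; exact: lt_le_trans.
have mJ : measurable J by exact: measurable_itv.
have dIJ : [disjoint I01 & J].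
  apply/disj_setPS => x [] /=; rewrite in_I01 /J/= in_itv/= andbT => /andP[_ x1].
  by rewrite leNgt x1.
have ID : I01 `<=` D by rewrite DIJ; exact: subsetUl.
have JD : J `<=` D by rewrite DIJ; exact: subsetUr.
have split_ (G : R -> R) : mu.-integrable D (EFin \o G) ->
    \int[mu]_(x in D) G x = \int[mu]_(x in I01) G x + \int[mu]_(x in J) G x.
  by rewrite DIJ => iG; rewrite (Rintegral_setU mI01 mJ iG dIJ).
have iI (G : R -> R) : mu.-integrable D (EFin \o G) -> mu.-integrable I01 (EFin \o G).
  by apply: integrableS => //; [exact: mD|exact: mI01].
have iJ (G : R -> R) : mu.-integrable D (EFin \o G) -> mu.-integrable J (EFin \o G).
  by apply: integrableS => //; exact: mD.
(* The square of Sonine's factor is q x^(2 (nu - nu')); its constant part q merely rescales both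
   energies. *)
pose q := (c / 2) `^ (2 * (nu - nu')).
have c20 : 0 < c / 2 by rewrite divr_gt0.
have q0 : 0 < q by exact: powR_gt0.
have son (x : R) : 0 < x ->
    hankel0y c nu phi x ^+ 2 = x `^ (2 * (nu - nu')) * (q * hankel0y c nu' psi x ^+ 2).
  move=> x0; rewrite (sonine c0 nu0 nunu aphi x0) -/psi exprMn powRM ?ltW// exprMn.
  rewrite /q !(mulrC 2 (nu - nu')) !powRrM !powR_mulrn ?powR_ge0//; ring.
have dd0 : 0 <= 2 * (nu - nu') by have := nunu; lra.
have ab : a <= q * b.
  rewrite /b -(RintegralZl q mI01 (iI _ iF')).
  apply: le_Rintegral; first exact: mI01.
  - exact: iI iF.
  - by have := integrableZl mI01 q (iI _ iF').
  move=> x; rewrite in_I01 => /andP[x0 x1]; rewrite son//.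
  apply: ler_piMl; first by apply: mulr_ge0; [exact: ltW|exact: sqr_ge0].
  have := ge0_ler_powR dd0 (x := x) (y := 1); rewrite powR1; apply; rewrite ?nnegrE// ltW//.
have ab1 : q * b1 <= a1.
  rewrite /b1 -(RintegralZl q mJ (iJ _ iF')).
  apply: le_Rintegral => //.
  - by have := integrableZl mJ q (iJ _ iF').
  - exact: iJ iF.
  move=> x Jx; have x0 : 0 < x by have := JD _ Jx; rewrite DE.
  have x1 : 1 <= x by move: Jx; rewrite /J/= in_itv/= andbT.
  rewrite son//; apply: ler_peMl; first by apply: mulr_ge0; [exact: ltW|exact: sqr_ge0].
  have := ge0_ler_powR dd0 (x := 1) (y := x); rewrite powR1; apply; rewrite ?nnegrE// ltW//.
rewrite (split_ _ iF) -/a -/a1 in bF.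
rewrite (split_ _ iF') -/b -/b1 in bF' pF'.
have a10 : 0 <= a1 by apply: Rintegral_ge0 => x _; exact: sqr_ge0.
have b0 : 0 <= b by apply: Rintegral_ge0 => x _; exact: sqr_ge0.
have b10 : 0 <= b1 by apply: Rintegral_ge0 => x _; exact: sqr_ge0.
rewrite -/nf in bF *; rewrite -/ng in bF' pF'.
exact: concentration_arith c0 lam0 q0 ab ab1 a10 b0 b10 bF bF' pF'.
Qed.

End Transfer.
End Lift.

(** * Comparison of the eigenvalues *)

Section L2Sums.
Context d (T : measurableType d) (R : realType) (mu : {measure set T -> \bar R}).
Hypothesis mu1 : mu setT = 1%E.

Lemma L2_0 : L2 mu (0 : T -> R).
Proof.
apply: (L2_bounded mu1 (K := 0)); first exact: (measurable_cst (0 : R)).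
by move=> x; rewrite -[leLHS]/(`|0 : R|) normr0.
Qed.

Lemma L2_sum n (a : 'I_n -> R) (f : 'I_n -> T -> R) : (forall i, L2 mu (f i)) ->
  L2 mu (\sum_i a i *: f i).
Proof. exact: (lincomb_closed (@L2D _ T R mu) (@L2Z _ T R mu) a L2_0). Qed.

Lemma ip_suml n (a : 'I_n -> R) (f : 'I_n -> T -> R) h : (forall i, L2 mu (f i)) -> L2 mu h ->
  ip mu (\sum_i a i *: f i) h = \sum_i a i * ip mu (f i) h.
Proof.
move=> Lf Lh.
exact: (ip_lincombl (@L2D _ T R mu) (@L2Z _ T R mu) (@ipDl _ T R mu) (@ipZl _ T R mu) a Lh L2_0 Lf).
Qed.

Lemma ip_orthogonal_sum n (a : 'I_n -> R) (f : 'I_n -> T -> R) i : (forall i, L2 mu (f i)) ->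
  (forall i j, i != j -> ip mu (f i) (f j) = 0) ->
  ip mu (\sum_i a i *: f i) (f i) = a i * ip mu (f i) (f i).
Proof.
move=> Lf fo; rewrite ip_suml// (bigD1 i)//= big1 ?addr0// => j ji.
by rewrite fo// mulr0.
Qed.

End L2Sums.

(** * Orthogonal eigenfunctions and the list of eigenvalues *)

Section Spectrum.
Context {R : realType}.
Let T := measurableTypeR R.
Let mu := @leb01 R.
Variables (c : R) (N A : (T -> R) -> T -> R).
Hypothesis N_sym : forall f g, L2 mu f -> L2 mu g -> ip mu (N f) g = ip mu f (N g).
Hypothesis L2N : forall f, L2 mu f -> L2 mu (N f).
Hypothesis AN : forall f, L2 mu f -> A f = (c *: N (N f)) %[ae mu].

Lemma NN_sym f h : L2 mu f -> L2 mu h -> c * ip mu f (N (N h)) = ip mu (c *: N (N f)) h.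
Proof.
move=> Lf Lh; have LNf := L2N Lf; have LNh := L2N Lh; have LNNf := L2N LNf.
by rewrite (ipZl c LNNf Lh) (N_sym LNf Lh) (N_sym Lf LNh).
Qed.

(** The weak form of the eigenvalue equation spares the later arguments any null set. For the
    converse, the defect c N (N f) - lam f is tested against itself and has norm 0. *)
Lemma eigenspace01P (lam : R) f : eigenspace01 A lam f <->
  L2 mu f /\ forall h, L2 mu h -> c * ip mu f (N (N h)) = lam * ip mu f h.
Proof.
have LNN g : L2 mu g -> L2 mu (c *: N (N g)) by move=> Lg; apply: L2Z; do 2 apply: L2N.
split=> [[Lf Qf]|[Lf wf]]; split=> //.
  move=> h Lh; rewrite NN_sym// -ipZl//; apply: ae_ip.
  - exact: L2_measurable (LNN _ Lf).
  - exact: L2_measurable (L2Z lam Lf).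
  - exact: L2_measurable Lh.
  - apply: (@filterS2 _ _ (ae_filter_ringOfSetsType mu) _ _ _ _ Qf (AN Lf)) => x h1 h2 _.
    by rewrite -(h2 I) (h1 I).
have Lmf := L2Z (- lam) Lf.
have Lu := L2D (LNN _ Lf) Lmf.
have u0 : ip mu (c *: N (N f) + - lam *: f) (c *: N (N f) + - lam *: f) = 0.
  rewrite (ipDl (LNN _ Lf) Lmf Lu) -(NN_sym Lf Lu) (ipZl (- lam) Lf Lu).
  by rewrite (wf _ Lu) mulNr subrr.
have h := ip_ae0 Lu u0.
apply: (@filterS2 _ _ (ae_filter_ringOfSetsType mu) _ _ _ _ h (AN Lf)) => x h1 h2 _.
rewrite (h2 I); apply/eqP; rewrite -subr_eq0; apply/eqP.
by have := h1 I; rewrite -[LHS]/((c *: N (N f)) x + - lam * f x) mulNr.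
Qed.

Lemma eigenspace01_orthogonal (lam lam' : R) f g : eigenspace01 A lam f ->
  eigenspace01 A lam' g -> lam != lam' -> ip mu f g = 0.
Proof.
move=> /eigenspace01P[Lf wf] /eigenspace01P[Lg wg] ll.
have h : lam * ip mu f g = lam' * ip mu f g.
  rewrite -(wf _ Lg) [ip mu f g in RHS]ipC -(wg _ Lf) (NN_sym Lf Lg).
  by rewrite (ipZl c (L2N (L2N Lf)) Lg) ipC.
apply/eqP; apply: contraNT ll => fg0; apply/eqP; exact: mulIf fg0 _ _ h.
Qed.

Lemma eigenspace01_sum (lam : R) n (a : 'I_n -> R) (f : 'I_n -> T -> R) :
  (forall i, eigenspace01 A lam (f i)) -> eigenspace01 A lam (\sum_i a i *: f i).
Proof.
move=> ef; have Lf i : L2 mu (f i) by have [] := ef i.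
apply/eigenspace01P; split; first exact: (L2_sum leb01_setT).
move=> h Lh; rewrite !(ip_suml leb01_setT)//; last by do 2 apply: L2N.
rewrite !mulr_sumr; apply: eq_bigr => i _.
have /eigenspace01P[_ /(_ _ Lh) e] := ef i.
by rewrite mulrCA e; ring.
Qed.

Lemma ae_lin_indep_ip k (f : 'I_k -> T -> R) (a : 'I_k -> R) : (forall i, L2 mu (f i)) ->
  ae_lin_indep f -> ip mu (\sum_i a i *: f i) (\sum_i a i *: f i) = 0 -> forall i, a i = 0.
Proof.
move=> Lf lf e; apply: lf.
have h := ip_ae0 (L2_sum leb01_setT a Lf) e.
apply: (@filterS _ _ (ae_filter_ringOfSetsType mu) _ _ _ h) => x /(_ I) + _.
by rewrite fct_sumE.
Qed.

Lemma orthogonal_ae_lin_indep k (f : 'I_k -> T -> R) : (forall i, L2 mu (f i)) ->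
  (forall i, ip mu (f i) (f i) != 0) -> (forall i j, i != j -> ip mu (f i) (f j) = 0) ->
  ae_lin_indep f.
Proof.
move=> Lf fn0 fo a a0 i.
have Ls := L2_sum leb01_setT a Lf.
have a0' : \sum_i a i *: f i = (fun=> 0) %[ae mu].
  apply: (@filterS _ _ (ae_filter_ringOfSetsType mu) _ _ _ a0) => x /(_ I) + _.
  by rewrite fct_sumE.
have := ae0_ip (L2_measurable Ls) (L2_measurable (Lf i)) a0'.
rewrite (ip_orthogonal_sum leb01_setT)// => /eqP.
by rewrite mulf_eq0 (negbTE (fn0 i)) orbF => /eqP.
Qed.

Variable lam : nat -> R.
Hypothesis hlam : decreasing_eigenvalues A lam.

Lemma orthogonal_eigenfunctions n : exists e : nat -> T -> R,
  (forall i, (i < n)%N -> eigenspace01 A (lam i) (e i) /\ 0 < ip mu (e i) (e i)) /\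
  (forall i j, (i < n)%N -> (j < i)%N -> ip mu (e i) (e j) = 0).
Proof.
elim: n => [|n [e [eP eo]]]; first by exists (fun _ _ => 0).
pose S := [set i : 'I_n | lam i == lam n].
have [|f [ef lf]] := (hlam.2 (lam n) #|S|.+1).2.
  exists (fun i : 'I_#|S|.+1 => if unlift ord0 i is Some l then nat_of_ord (enum_val l : 'I_n) else n); split.
    move=> i j.
    have nlt (l : 'I_#|S|) : nat_of_ord (enum_val l : 'I_n) <> n.
      by move=> h; have := ltn_ord (enum_val l : 'I_n); rewrite h ltnn.
    case: unliftP => [i'|] ->; case: unliftP => [j'|] -> //.
    - by move=> /val_inj/enum_val_inj ->.
    - by move/nlt.
    - by move/esym/nlt.
  move=> i; case: unliftP => // l _; apply/eqP.
  by have := enum_valP l; rewrite inE.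
have Lf i : L2 mu (f i) by have [] := ef i.
pose M : 'M[R]_(#|S|.+1, #|S|) := \matrix_(i, l) ip mu (f i) (e (enum_val l : 'I_n)).
have [v vn0 vM] := exists_left_kernel M (ltnSn _).
pose g : T -> R := \sum_i v 0 i *: f i.
have eg : eigenspace01 A (lam n) g by exact: eigenspace01_sum.
have Lg : L2 mu g by have [] := eg.
exists (fun i => if (i < n)%N then e i else g); split.
  move=> i; rewrite ltnS leq_eqVlt => /predU1P[->|/[dup] ilt ->]; last exact: eP.
  rewrite ltnn; split=> //; rewrite lt_neqAle ip_ge0 andbT eq_sym; apply/eqP => g0.
  case/eqP : vn0; apply/rowP => i'; rewrite mxE.
  exact: (ae_lin_indep_ip (a := fun i => v 0 i) Lf lf g0).
move=> i j; rewrite ltnS leq_eqVlt => /predU1P[-> jn|/[dup] ilt -> ji]; last first.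
  by rewrite (ltn_trans ji ilt); exact: eo.
rewrite ltnn jn; have [jS|jS] := eqVneq (lam j) (lam n); last first.
  by apply: eigenspace01_orthogonal eg (eP j jn).1 _; rewrite eq_sym.
have jS' : Ordinal jn \in S by rewrite inE; apply/eqP.
have := congr1 (fun m : 'rV_#|S| => m 0 (enum_rank_in jS' (Ordinal jn))) vM.
rewrite !mxE (ip_suml leb01_setT)//; last by have [[]] := eP j jn.
move=> h; rewrite -[RHS]h; apply: eq_bigr => l _; rewrite mxE enum_rankK_in//.
Qed.

(** For each x, the given eigenfunctions with eigenvalue x are independent, so x occurs at that many
    distinct places. Places chosen for different values of x differ because [lam] differs there. *)
Lemma eigenvalues_injection n (e : nat -> T -> R) (nu : nat -> R) :
  (forall i, (i < n)%N -> eigenspace01 A (nu i) (e i) /\ 0 < ip mu (e i) (e i)) ->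
  (forall i j, (i < n)%N -> (j < i)%N -> ip mu (e i) (e j) = 0) ->
  exists q : 'I_n -> nat, injective q /\ forall i, lam (q i) = nu i.
Proof.
move=> eP eo.
have /choice[P PP] (x : R) : exists p : 'I_n -> nat,
    (forall i : 'I_n, nu i = x -> lam (p i) = x) /\
    (forall i j : 'I_n, nu i = x -> nu j = x -> p i = p j -> i = j).
  pose S := [set i : 'I_n | nu i == x].
  have inS (i : 'I_n) : nu i = x -> i \in S by move=> ix; rewrite inE; apply/eqP.
  have [|p [pinj plam]] := (hlam.2 x #|S|).1.
    exists (fun l => e (enum_val l : 'I_n)); split.
      by move=> l; have := enum_valP l; rewrite inE => /eqP <-; have [] := eP _ (ltn_ord (enum_val l : 'I_n)).
    apply: orthogonal_ae_lin_indep.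
    - by move=> l; have [[]] := eP _ (ltn_ord (enum_val l : 'I_n)).
    - by move=> l; have [_] := eP _ (ltn_ord (enum_val l : 'I_n)); rewrite lt0r => /andP[].
    - move=> l l' ll'.
      have : nat_of_ord (enum_val l : 'I_n) != (enum_val l' : 'I_n).
        by apply: contra_neq ll' => /val_inj/enum_val_inj.
      by rewrite neq_ltn => /orP[h|h]; [rewrite ipC|]; apply: eo.
  (* [enum_rank_in] asks for a member of S; when S is empty both conditions are vacuous. *)
  have [[i0 i0S]|S0] := pselect (exists i, i \in S); last first.
    by exists (fun=> 0%N); split=> i => [ix|j ix]; case: S0; exists i; exact: inS.
  exists (fun i => p (enum_rank_in i0S i)); split=> // i j ix jx /pinj.
  by apply: enum_rank_in_inj; exact: inS.
exists (fun i : 'I_n => P (nu i) i); split=> [i j|i]; last by have [h _] := PP (nu i); exact: h.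
have [hi inji] := PP (nu i); have [hj _] := PP (nu j).
move=> e1; have e2 : nu i = nu j by rewrite -(hi i erefl) -(hj j erefl) e1.
by apply: inji => //; rewrite e1 e2.
Qed.

(** Pigeonhole: if [lam n < x], monotonicity puts every place with a value at least x below n, and n
    + 1 distinct places do not fit there. *)
Lemma eigenvalue_ge n (x : R) (e : nat -> T -> R) (nu : nat -> R) :
  (forall i, (i < n.+1)%N -> [/\ eigenspace01 A (nu i) (e i), 0 < ip mu (e i) (e i) & x <= nu i]) ->
  (forall i j, (i < n.+1)%N -> (j < i)%N -> ip mu (e i) (e j) = 0) ->
  x <= lam n.
Proof.
move=> eP eo; have [|q [qinj qlam]] := eigenvalues_injection (n := n.+1) (nu := nu) _ eo.
  by move=> i /eP[].
rewrite leNgt; apply/negP => lx.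
have qn i : (q i < n)%N.
  rewrite ltnNge; apply/negP => nq.
  have := hlam.1 _ _ nq; rewrite qlam leNgt => /negP; apply.
  by have [_ _] := eP i (ltn_ord i); exact: lt_le_trans.
have inj : injective (fun i : 'I_n.+1 => Ordinal (qn i)) by move=> i j [/qinj].
by have := leq_card _ inj; rewrite !card_ord ltnn.
Qed.

End Spectrum.

Section HankelSpectrum.
Context {R : realType}.
Let T := measurableTypeR R.
Let mu := @leb01 R.
Variables (c nu : R).
Hypothesis (c0 : 0 < c) (nu0 : - (1 / 2) < nu).

Lemma hankelN_sym (f g : T -> R) : L2 mu f -> L2 mu g ->
  ip mu (hankelN c nu f) g = ip mu f (hankelN c nu g).
Proof.
exact: (nuclear_sym leb01_setT (cvg_ncoef c0 nu0) (@measurable_emono01 _ nu) (emono01_le1 nu0)).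
Qed.

Lemma hankelQ_ae (f : T -> R) : L2 mu f ->
  hankelQ c nu f = (c *: hankelN c nu (hankelN c nu f)) %[ae mu].
Proof. by move=> Lf; apply: ae01 => x x01 _; rewrite hankelQE. Qed.

Lemma hankel_minmax n (W : 'I_n -> T -> R) (lam : R) : 0 < lam -> (forall i, L2 mu (W i)) ->
  (forall a : 'I_n -> R, (exists i, a i != 0) -> let f := \sum_i a i *: W i in
     0 < ip mu f f /\ lam * ip mu f f <= c * ip mu (hankelN c nu f) (hankelN c nu f)) ->
  exists (e : nat -> T -> R) (x : nat -> R),
    (forall i, (i < n)%N -> [/\ eigenspace01 (hankelQ c nu) (x i) (e i),
        0 < ip mu (e i) (e i) & lam <= x i]) /\
    (forall i j, (i < n)%N -> (j < i)%N -> ip mu (e i) (e j) = 0).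
Proof.
move=> lam0 LW HW.
(* [orthogonal_eigenvectors] concerns N o N without the factor c, hence the threshold lam / c here
   and the eigenvalues [c * x i] below. *)
have lc0 : 0 < lam / c by rewrite divr_gt0.
have L2N := @L2_hankelN R c nu c0 nu0.
have [|e [x [eP eo]]] := orthogonal_eigenvectors (@L2D _ T R mu) (@L2Z _ T R mu) (@ipC _ T R mu)
  (@ipDl _ T R mu) (@ipZl _ T R mu) (@ip_ge0 _ T R mu) L2N hankelN_sym (sqr_ge0 _)
  (nuclear_bnd leb01_setT (cvg_ncoef c0 nu0) (@measurable_emono01 _ nu) (emono01_le1 nu0))
  (nuclear_compact leb01_setT (cvg_ncoef c0 nu0) (@measurable_emono01 _ nu) (emono01_le1 nu0))
  lc0 (L2_0 leb01_setT) LW.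
  move=> a an0; have [h1 h2] := HW a an0; split=> //.
  by rewrite mulrAC ler_pdivrMr// mulrC [leRHS]mulrC mulrC.
exists e, (fun i => c * x i); split; last exact: eo.
move=> i ilt; have [Le ep lx xe] := eP i ilt; split => //; last first.
  by rewrite -ler_pdivrMl// mulrC.
apply/(eigenspace01P hankelN_sym L2N hankelQ_ae); split=> // h Lh.
by rewrite -mulrA -(xe h Lh) (hankelN_sym (L2N _ Le) Lh) (hankelN_sym Le (L2N _ Lh)).
Qed.

End HankelSpectrum.

(** * Comparison of the orders nu and nu' *)

Section Monotone.
Context {R : realType}.
Let T := measurableTypeR R.
Let mu := @leb01 R.
Variables (c nu nu' : R).
Hypothesis (c0 : 0 < c) (nu0 : - (1 / 2) < nu') (nunu : nu' < nu).
Let nu1 : - (1 / 2) < nu := lt_trans nu0 nunu.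

Lemma lift01_weyl_sum n (a : 'I_n -> R) (phi : 'I_n -> R -> R) : (forall i, smooth01 (phi i)) ->
  lift01 nu' (weyl nu nu' (fun y => \sum_i a i * phi i y)) =
  \sum_i a i *: lift01 nu' (weyl nu nu' (phi i)).
Proof.
move=> sphi; rewrite -lift01_sum; apply/funext => t; rewrite /lift01 !patchE.
case: ifPn => //; rewrite inE in_I01 => /andP[t0 _].
by rewrite weyl_sum// exprn_gt0.
Qed.

(** The Rayleigh quotient of f is the mean of the [x i] with weights a_i^2 |E_i|^2. *)
Lemma orthogonal_combination n (E : nat -> T -> R) (x : nat -> R) (lam : R) :
  (forall i, (i < n)%N -> [/\ eigenspace01 (hankelQ c nu) (x i) (E i),
     0 < ip mu (E i) (E i) & lam <= x i]) ->
  (forall i j, (i < n)%N -> (j < i)%N -> ip mu (E i) (E j) = 0) ->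
  forall a : 'I_n -> R, (exists i, a i != 0) -> let f := \sum_i a i *: E i in
  0 < ip mu f f /\ lam * ip mu f f <= c * ip mu (hankelN c nu f) (hankelN c nu f).
Proof.
move=> EP Eo a [i0 ai0] f.
have L2N := @L2_hankelN R c nu c0 nu1.
have wE (i : 'I_n) := (eigenspace01P (hankelN_sym c0 nu1) L2N (hankelQ_ae c0 nu1) (x i) (E i)).1.
have LE (i : 'I_n) : L2 mu (E i) by have [[]] := EP i (ltn_ord i).
have EO (i j : 'I_n) : i != j -> ip mu (E i) (E j) = 0.
  move=> ij; have : (i : nat) != j by [].
  by rewrite neq_ltn => /orP[h|h]; [rewrite ipC|]; apply: Eo.
have Lf : L2 mu f by exact: (L2_sum leb01_setT).
have fE (i : 'I_n) : ip mu (E i) f = a i * ip mu (E i) (E i).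
  by rewrite ipC (ip_orthogonal_sum leb01_setT).
have ff : ip mu f f = \sum_i a i ^+ 2 * ip mu (E i) (E i).
  rewrite (ip_suml leb01_setT)//; apply: eq_bigr => i _; rewrite fE; ring.
have cff : c * ip mu (hankelN c nu f) (hankelN c nu f) =
    \sum_i a i ^+ 2 * (x i * ip mu (E i) (E i)).
  rewrite (hankelN_sym c0 nu1 Lf (L2N _ Lf)) (ip_suml leb01_setT)//; last exact/L2N/L2N.
  rewrite mulr_sumr; apply: eq_bigr => i _.
  have [eE _ _] := EP i (ltn_ord i).
  by rewrite mulrCA ((wE i eE).2 _ Lf) fE; ring.
split.
  rewrite ff (bigD1 i0)//=; apply: ltr_pwDl.
    have [_ e0 _] := EP i0 (ltn_ord i0).
    by rewrite mulr_gt0// lt_neqAle sqr_ge0 eq_sym sqrf_eq0 ai0.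
  by apply: sumr_ge0 => i _; rewrite mulr_ge0 ?sqr_ge0 ?ip_ge0.
rewrite cff ff mulr_sumr; apply: ler_sum => i _.
have [_ e0 lx] := EP i (ltn_ord i).
by rewrite mulrCA ler_wpM2l ?sqr_ge0// ler_wpM2r// ltW.
Qed.

Lemma hankel_eigenvalue_le (lam lam' : nat -> R) n :
  decreasing_eigenvalues (hankelQ c nu) lam -> decreasing_eigenvalues (hankelQ c nu') lam' ->
  lam n <= lam' n.
Proof.
move=> hlam hlam'.
have L2N := @L2_hankelN R c nu c0 nu1.
have L2N' := @L2_hankelN R c nu' c0 nu0.
(* For lam n <= 0 the eigenfunctions need not be lifts, but [lam' n] is nonnegative, being c |N e|^2
   / |e|^2 for an eigenfunction e. *)
have [lam0|lam0] := leP (lam n) 0.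
  apply: (le_trans lam0).
  have [e [eP _]] := orthogonal_eigenfunctions (hankelN_sym c0 nu0) L2N' (hankelQ_ae c0 nu0) hlam' n.+1.
  have [/(eigenspace01P (hankelN_sym c0 nu0) L2N' (hankelQ_ae c0 nu0))[Le we] e0] := eP n (ltnSn n).
  rewrite -(pmulr_lge0 _ e0) -(we _ Le) -(hankelN_sym c0 nu0 Le (L2N' _ Le)).
  by rewrite mulr_ge0 ?ip_ge0// ltW.
have [e [eP eo]] := orthogonal_eigenfunctions (hankelN_sym c0 nu1) L2N (hankelQ_ae c0 nu1) hlam n.+1.
have lami i : (i < n.+1)%N -> lam n <= lam i by rewrite ltnS => /hlam.1.
have /choice[phi phiP] i : exists phi, (i < n.+1)%N ->
    smooth01 phi /\ e i = lift01 nu phi %[ae leb01].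
  have [ilt|] := boolP (i < n.+1)%N; last by exists (fun=> 0).
  have [[Le Qe] _] := eP i ilt.
  have [phi sphi ephi] := eigenfunction_lift01 c0 nu1 Le (lt_le_trans lam0 (lami i ilt)) Qe.
  by exists phi.
(* The [e i] are lifts almost everywhere only. Combinations of the exact lifts [E i] are lifts of
   combinations of the [phi i], on which the Weyl integral acts linearly. *)
pose E i := lift01 nu (phi i).
have sphi (i : 'I_n.+1) : smooth01 (phi i) by have [] := phiP i (ltn_ord i).
have LE i : (i < n.+1)%N -> L2 mu (E i).
  by move=> /phiP[s _]; exact: L2_lift01.
have eE i : (i < n.+1)%N -> L2 mu (e i) /\ (forall h, L2 mu h -> ip mu (e i) h = ip mu (E i) h).
  move=> ilt; have [[Le _] _] := eP i ilt; split=> // h Lh.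
  apply: ae_ip; [exact: L2_measurable Le|exact: L2_measurable (LE i ilt)|exact: L2_measurable Lh|].
  by have [] := phiP i ilt.
have EE i j : (i < n.+1)%N -> (j < n.+1)%N -> ip mu (e i) (e j) = ip mu (E i) (E j).
  move=> ilt jlt; have [Lei ei] := eE i ilt; have [Lej ej] := eE j jlt.
  by rewrite (ei _ Lej) ipC (ej _ (LE i ilt)) ipC.
have wP := eigenspace01P (hankelN_sym c0 nu1) L2N (hankelQ_ae c0 nu1).
have EP i : (i < n.+1)%N -> [/\ eigenspace01 (hankelQ c nu) (lam i) (E i),
     0 < ip mu (E i) (E i) & lam n <= lam i].
  move=> ilt; have [/wP[Le we] e0] := eP i ilt; have [_ ei] := eE i ilt; split.
  - apply/wP; split; first exact: LE.
    by move=> h Lh; rewrite -!ei ?we//; exact/L2N/L2N.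
  - by rewrite -EE.
  - exact: lami.
have EO i j : (i < n.+1)%N -> (j < i)%N -> ip mu (E i) (E j) = 0.
  by move=> ilt ji; rewrite -EE ?eo// (ltn_trans ji).
have comb := orthogonal_combination EP EO.
pose W (i : 'I_n.+1) := lift01 nu' (weyl nu nu' (phi i)).
have [||e' [x [e'P e'o]]] := hankel_minmax c0 nu0 (W := W) lam0.
- by move=> i; apply: L2_lift01 => //; exact: smooth01_weyl.
(* Positivity of the norm, the first conclusion of [weyl_concentration], also yields the linear
   independence of the [W i]. *)
- move=> a an0; rewrite /= /W -lift01_weyl_sum//.
  have := comb a an0; rewrite /= -lift01_sum => -[h1 h2].
  by apply: (weyl_concentration c0 nu0 nunu) => //; exact: smooth01_sum.
exact: (eigenvalue_ge hlam' e'P e'o).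
Qed.

End Monotone.

Theorem theorem5 (R : realType) (c : R) (hc : 0 < c)
    (lambda : R -> nat -> R)
    (hlambda : forall alpha : R, - (1 / 2) < alpha ->
       decreasing_eigenvalues (hankelQ c alpha) (lambda alpha)) :
  forall (n : nat) (alpha alpha' : R),
    alpha' <= alpha -> - (1 / 2) < alpha' ->
    lambda alpha n <= lambda alpha' n.
Proof.
move=> n alpha alpha'; rewrite le_eqVlt => /predU1P[->//|alt] a0.
apply: (hankel_eigenvalue_le hc a0 alt); apply: hlambda => //.
exact: lt_trans alt.
Qed.
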